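(* Let $s>0$. There exist positive constants $c$ and $C$ and two sequences $(u_n)_{n\ge1}$, $(\widetilde u_n)_{n\ge1}$ of solutions of the Benjamin–Ono equation $u_t+Hu_{xx}+uu_x=0$ on $[0,1]\times\mathbb R$, with $u_n,\widetilde u_n\in C([0,1];H^\sigma(\mathbb R))$ for every $\sigma\ge0$, such that: (i) for every $t\in[0,1]$, $\sup_n\|u_n(t,\cdot)\|_{H^s(\mathbb R)}+\sup_n\|\widetilde u_n(t,\cdot)\|_{H^s(\mathbb R)}\le C$; (ii) $\lim_{n\to\infty}\|u_n(0,\cdot)-\widetilde u_n(0,\cdot)\|_{H^s(\mathbb R)}=0$; (iii) for every $t\in[0,1]$, $\liminf_{n\to\infty}\|u_n(t,\cdot)-\widetilde u_n(t,\cdot)\|_{H^s(\mathbb R)}\ge c\sin t$. In particular, the flow map of the Benjamin–Ono equation is not uniformly continuous on bounded subsets of $H^s(\mathbb R)$.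
   Context: $H$ denotes the Hilbert transform on $\mathbb R$, i.e. the Fourier multiplier with symbol $-i\,\mathrm{sgn}(\xi)$ (equivalently $Hf(x)=\frac1\pi\,\mathrm{p.v.}\int_{\mathbb R}\frac{f(y)}{x-y}\,dy$). The Sobolev norm is $\|f\|_{H^s}=\|(1+|D|^2)^{s/2}f\|_{L^2}$, where $(1+|D|^2)^{s/2}$ is the Fourier multiplier with symbol $(1+\xi^2)^{s/2}$. *)

(* Defs.v *)
From HB Require Import structures.
From mathcomp Require Import all_boot all_order all_algebra.
From mathcomp Require Import all_classical all_reals all_analysis.
Set Implicit Arguments. Unset Strict Implicit. Unset Printing Implicit Defensive.
Import Order.TTheory GRing.Theory Num.Theory.
Import numFieldNormedType.Exports.
Local Open Scope classical_set_scope.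
Local Open Scope ring_scope.

Section BO.
Variable R : realType.
Notation mu := (@lebesgue_measure R).

(* Gaussian-regularized Fourier integrals (real and imaginary parts, up to sign):
   int f(x) e^{-e x^2} cos(x xi) dx  and  int f(x) e^{-e x^2} sin(x xi) dx.
   For f in L^2 the integrands are integrable. *)
Definition gft_cos (f : R -> R) (e xi : R) : R :=
  Rintegral mu setT (fun x => f x * expR (- (e * x ^+ 2)) * cos (x * xi)).
Definition gft_sin (f : R -> R) (e xi : R) : R :=
  Rintegral mu setT (fun x => f x * expR (- (e * x ^+ 2)) * sin (x * xi)).

(* Fourier transform of an L^2 function, \hat f(xi) = int f(x) e^{-i x xi} dx,
   defined (a.e., at every Lebesgue point of \hat f) as the limit of the
   Gauss–Weierstrass regularizations with e = 1/(n+1). *)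
Definition fourier_cos (f : R -> R) (xi : R) : R :=
  lim ((fun n : nat => gft_cos f (n.+1%:R)^-1 xi) @ \oo).
Definition fourier_sin (f : R -> R) (xi : R) : R :=
  lim ((fun n : nat => gft_sin f (n.+1%:R)^-1 xi) @ \oo).

Definition Hs_norm2 (s : R) (f : R -> R) : \bar R :=
  ((2 * pi)^-1)%:E *
  (\int[mu]_(xi in setT)
     ((1 + xi ^+ 2) `^ s * (fourier_cos f xi ^+ 2 + fourier_sin f xi ^+ 2))%:E)%E.

Definition Hs_norm (s : R) (f : R -> R) : R := Num.sqrt (fine (Hs_norm2 s f)).

Definition in_Hs (s : R) (f : R -> R) : Prop :=
  measurable_fun setT f /\
  (\int[mu]_(x in setT) ((f x) ^+ 2)%:E < +oo)%E /\
  (Hs_norm2 s f < +oo)%E.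

Definition hilbert_pv (f : R -> R) (x v : R) : Prop :=
  (fun e => pi^-1 * Rintegral mu [set y | e < `|x - y|] (fun y => f y / (x - y)))
    @ 0^'+ --> v.

Definition cont_Hs (sigma : R) (u : R -> R -> R) : Prop :=
  (forall t, 0 <= t <= 1 -> in_Hs sigma (u t)) /\
  (forall t0, 0 <= t0 <= 1 -> forall eps, 0 < eps -> exists2 delta, 0 < delta &
     forall t, 0 <= t <= 1 -> `|t - t0| < delta ->
       Hs_norm sigma (fun x => u t x - u t0 x) < eps).

Definition BO_solution (u : R -> R -> R) : Prop :=
  (forall sigma, 0 <= sigma -> cont_Hs sigma u) /\
  (forall t x, 0 < t < 1 ->
     derivable (fun s => u s x) t 1 /\
     derivable (u t) x 1 /\
     derivable (derive1 (u t)) x 1 /\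
     exists v, hilbert_pv (derive1 (derive1 (u t))) x v /\
       derive1 (fun s => u s x) t + v + u t x * derive1 (u t) x = 0).

End BO.

(* Main.v *)
(* Solutions are sought as superpositions u(t,x) = int h(t,k) cas(xk) dk, cas = cos + sin (a
   Hartley transform, which keeps everything real).  In this representation products become
   convolutions, and the Benjamin-Ono flow is the rotation of the pair (h(k), h(-k)) by the
   angle t k|k| plus a quadratic term; once the rotation is factored out, the profile g solves
   a fixed-point equation, which contracts in a Cauchy-Kovalevskaya scale of weights
   exp(-rho (1 - t/2) |k|) V(k) as soon as V * V <= kap V with 64 kap <= rho.

   Take m large, be = (q/m)^2, and let both data contain a carrier of width be around the
   frequency pi m, with H^s norm of order 1; the data of u_n contain in addition a bump l of
   size om/m and width be at frequency zero, whose norm tends to 0.  The two solutions differ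
   at first order by the interaction of l with the carrier, which is almost resonant: near the
   carrier the difference of the profiles has a time derivative of fixed sign and of the size
   of the carrier itself, times om.  The envelope V is a comb of bumps of width be at the
   multiples of pi m times a polynomially decaying factor; it makes all remaining interactions
   O(om^2), uniformly in m. *)
From HB Require Import structures.
From mathcomp Require Import all_boot all_order all_algebra.
From mathcomp Require Import all_classical all_reals all_analysis.
From mathcomp Require Import measurable_realfun ring lra.
Require Import Defs.
Import Order.TTheory GRing.Theory Num.Theory.
Import numFieldNormedType.Exports.
Local Open Scope classical_set_scope.
Local Open Scope ring_scope.
Set Implicit Arguments. Unset Strict Implicit. Unset Printing Implicit Defensive.

(** The carrier must not be damped, which forces [rho] down to [1 / m], and with it [kap] to at most
    that order. Products generate every multiple of [pi m], so the weight has to live at all of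
    them, while a weight without gaps between them has too large a mass. The comb meets both
    demands: convolving teeth of width [be] gives teeth of comparable width, and [kap] sees only the
    height times the width of a tooth, of order [om / m].

    In physical space the bump is a slow flow of speed about [om / m] on the spatial scale [1 / be]
    of the carrier. In time [t] it shifts the carrier by about [t om / m], hence its phase by order
    [om t], although the [L^2] norm of the bump is only of order [(om / m) / sqrt be = om / q]. Thus
    [om] is fixed, small enough for the error [O(om^2)] to lose against the drift, while [q], and
    [m] as a power of it, tends to infinity. The resonance is inexact because [k |k|] varies by the
    order of [be m = q^2 / m] over a tooth, which is small. *)

Lemma eq_le (R : realType) (x y : R) : x = y -> x <= y.
Proof. by move->. Qed.

(** * Integrals over the line *)

Section integrals.
Context {R : realType}.
Notation mu := (@lebesgue_measure R).
Implicit Types f g : R -> R.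

Lemma measurable_affine (a b : R) : measurable_fun setT (fun x : R => a * x + b).
Proof. by apply: measurable_funD => //; apply: measurable_funM. Qed.

(** The pushforward of Lebesgue measure under the affine map, scaled by [|a|], agrees with Lebesgue
    measure on the intervals []c, d]], hence everywhere. A negative slope turns the preimage into an
    interval closed on the left, hence the two cases. *)
Lemma ge0_integral_affine (a b : R) (f : R -> \bar R) : a != 0 ->
  measurable_fun setT f -> (forall x, (0 <= f x)%E) ->
  (\int[mu]_x f x = `|a|%:E * \int[mu]_x f (a * x + b)%R)%E.
Proof.
move=> a0 mf f0.
have na0 : 0 <= `|a| by [].
pose phi : measurableTypeR R -> measurableTypeR R := fun x : R => a * x + b.
have mphi : measurable_fun setT phi := measurable_affine a b.
pose nu := measure_function_pushforward__canonical__measure_function_Measure mu mphi.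
pose nu' := (mscale (NngNum na0) nu : {measure set _ -> \bar R}).
transitivity (\int[nu']_x f x)%E.
  apply: eq_measure_integral => /= A mA _.
  apply: (@lebesgue_measure_unique R nu') => // _ [[c d] _ <-] /=.
  rewrite /mscale/= /pushforward.
  have [a_gt0|a_lt0|/eqP] := ltgtP 0 a; last by rewrite eq_sym (negbTE a0).
  - rewrite (_ : _ @^-1` _ = `](c - b) / a, (d - b) / a]%classic).
      rewrite !lebesgue_measure_itv/= !lte_fin ltr_pM2r ?invr_gt0// ltrD2r.
      case: ifPn => _; last by rewrite mule0.
      rewrite -!EFinB -EFinM gtr0_norm//; congr EFin; field.
      by rewrite lt0r_neq0.
    apply/seteqP; split => x /=; rewrite !in_itv/= ltr_pdivrMr// ler_pdivlMr//;
      by rewrite ltrBlDr lerBrDr (mulrC x).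
  - rewrite (_ : _ @^-1` _ = `[(d - b) / a, (c - b) / a[%classic).
      rewrite !lebesgue_measure_itv/= !lte_fin ltr_nM2r ?invr_lt0// ltrD2r.
      case: ifPn => _; last by rewrite mule0.
      rewrite -!EFinB -EFinM ltr0_norm//; congr EFin; field.
      by rewrite ltr0_neq0.
    apply/seteqP; split => x /=; rewrite !in_itv/= ler_ndivrMr// ltr_ndivlMr//;
      by rewrite ltrBlDr lerBrDr (mulrC x) andbC.
rewrite ge0_integral_mscale//=.
by rewrite ge0_integral_pushforward.
Qed.

Definition L1 (f : R -> R) : Prop := mu.-integrable setT (EFin \o f).
Definition I (f : R -> R) : R := Rintegral mu setT f.

Lemma L1_measurable f : L1 f -> measurable_fun setT f.
Proof. by move=> /integrableP[/measurable_EFinP]. Qed.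

Lemma L1_le f g : measurable_fun setT f -> (forall x, `|f x| <= g x) -> L1 g -> L1 f.
Proof.
move=> mf fg g1; apply: le_integrable g1 => //; first exact/measurable_EFinP.
by move=> x _ /=; rewrite lee_fin (le_trans (fg x))// ler_norm.
Qed.

Lemma L1P f (C : R) : measurable_fun setT f ->
  (\int[mu]_x (`|f x|%:E) <= C%:E)%E -> L1 f.
Proof.
move=> mf h; apply/integrableP; split; first exact/measurable_EFinP.
by rewrite (le_lt_trans _ (ltry C)).
Qed.

Lemma L1_norm f : L1 f -> L1 (fun x => `|f x|).
Proof. exact: integrable_norm. Qed.

Lemma L1_Z k f : L1 f -> L1 (fun x => k * f x).
Proof.
move=> f1; rewrite /L1 (_ : _ \o _ = (fun x => k%:E * (EFin \o f) x)%E) //.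
exact: integrableZl.
Qed.

Lemma L1_D f g : L1 f -> L1 g -> L1 (fun x => f x + g x).
Proof.
move=> f1 g1; rewrite /L1 (_ : _ \o _ = ((EFin \o f) \+ (EFin \o g))%E) //.
exact: integrableD.
Qed.

Lemma L1_B f g : L1 f -> L1 g -> L1 (fun x => f x - g x).
Proof.
move=> f1 g1; rewrite /L1 (_ : _ \o _ = ((EFin \o f) \- (EFin \o g))%E) //.
exact: integrableB.
Qed.

Lemma L1_Mbounded f g (M : R) : measurable_fun setT g ->
  (forall x, `|g x| <= M) -> L1 f -> L1 (fun x => f x * g x).
Proof.
move=> mg gM f1; apply: (@L1_le _ (fun x => M * `|f x|)).
- by apply: measurable_funM => //; exact: L1_measurable.
- by move=> x; rewrite normrM mulrC ler_wpM2r.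
- exact/L1_Z/L1_norm.
Qed.

Lemma IZ k f : L1 f -> I (fun x => k * f x) = k * I f.
Proof. exact: RintegralZl. Qed.

Lemma ID f g : L1 f -> L1 g -> I (fun x => f x + g x) = I f + I g.
Proof. exact: RintegralD. Qed.

Lemma IB f g : L1 f -> L1 g -> I (fun x => f x - g x) = I f - I g.
Proof. exact: RintegralB. Qed.

Lemma I_ge0 f : (forall x, 0 <= f x) -> 0 <= I f.
Proof. by move=> f0; apply: Rintegral_ge0. Qed.

Lemma I_le f g : L1 f -> L1 g -> (forall x, f x <= g x) -> I f <= I g.
Proof. by move=> f1 g1 fg; apply: le_Rintegral. Qed.

Lemma I_norm f : L1 f -> `|I f| <= I (fun x => `|f x|).
Proof. exact: le_normr_Rintegral. Qed.

Lemma I_norm_le f g : measurable_fun setT f -> L1 g -> (forall x, `|f x| <= g x) ->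
  `|I f| <= I g.
Proof.
move=> mf g1 fg; have f1 := L1_le mf fg g1.
by apply: (le_trans (I_norm f1)); apply: I_le => //; exact: L1_norm.
Qed.

Lemma EFin_I f : L1 f -> (\int[mu]_x (f x)%:E)%E = (I f)%:E.
Proof. by move=> f1; rewrite fineK//; apply: integrable_fin_num. Qed.

Lemma eq_I f g : f =1 g -> I f = I g.
Proof. by move=> fg; congr I; apply/funext. Qed.

Lemma L1_affine (a b : R) f : a != 0 -> L1 f -> L1 (fun x => f (a * x + b)).
Proof.
move=> a0 f1; apply/integrableP; split.
  apply/measurable_EFinP; apply: measurableT_comp (L1_measurable f1) _.
  exact: measurable_affine.
have /integrableP[mf] := f1.
rewrite (ge0_integral_affine b a0); last 2 first.
  exact: measurableT_comp.
  by move=> x; rewrite abse_ge0.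
move=> h; rewrite ltNge leye_eq; apply/negP => /eqP E; move: h.
by rewrite /= in E *; rewrite E gt0_muley ?ltxx// lte_fin normr_gt0.
Qed.

Lemma I_affine (a b : R) f : a != 0 -> L1 f ->
  I f = `|a| * I (fun x => f (a * x + b)).
Proof.
move=> a0 f1.
have pos g : (forall x, 0 <= g x) -> L1 g -> I g = `|a| * I (fun x => g (a * x + b)).
  move=> g0 g1; apply: EFin_inj; rewrite EFinM -!EFin_I//; last exact: L1_affine.
  by rewrite (ge0_integral_affine b a0)//; case/integrableP: g1.
have nf1 := L1_norm f1.
(* Writing [f] as [(|f| + f) - |f|] reduces to nonnegative integrands. *)
have E1 : I f = I (fun x => `|f x| + f x) - I (fun x => `|f x|).
  by rewrite ID// addrAC subrr add0r.
have L1a g : L1 g -> L1 (fun x => g (a * x + b)) by exact: L1_affine.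
have h1 := pos (fun x => `|f x| + f x).
have h2 := pos (fun x => `|f x|).
rewrite E1 h1; last 2 first.
- by move=> x; have := ler_norm (- f x); rewrite normrN; lra.
- exact: L1_D.
rewrite h2 // (ID (L1a (fun x => `|f x|) nf1) (L1a f f1)); ring.
Qed.

Lemma L1_shift b f : L1 f -> L1 (fun x => f (x + b)).
Proof.
move=> /(L1_affine b (oner_neq0 _)).
by under [X in L1 X -> _]funext do rewrite mul1r.
Qed.

Lemma I_shift b f : L1 f -> I (fun x => f (x + b)) = I f.
Proof.
move=> f1; rewrite (I_affine b (oner_neq0 _) f1) normr1 mul1r.
by apply: eq_I => x; rewrite mul1r.
Qed.

Lemma L1_opp f : L1 f -> L1 (fun x => f (- x)).
Proof.
move=> f1; have : (-1 : R) != 0 by rewrite oppr_eq0 oner_neq0.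
move=> /(L1_affine 0) /(_ f1).
by under [X in L1 X -> _]funext do rewrite mulN1r addr0.
Qed.

Lemma I_opp f : L1 f -> I (fun x => f (- x)) = I f.
Proof.
move=> f1; have h : (-1 : R) != 0 by rewrite oppr_eq0 oner_neq0.
rewrite (I_affine 0 h f1) normrN1 mul1r.
by apply: eq_I => x; rewrite mulN1r addr0.
Qed.

Lemma L1_refl b f : L1 f -> L1 (fun x => f (b - x)).
Proof.
move=> f1; have := L1_opp (L1_shift b f1).
by under [X in L1 X -> _]funext do rewrite addrC.
Qed.

Lemma I_refl b f : L1 f -> I (fun x => f (b - x)) = I f.
Proof.
move=> f1; rewrite -(I_shift b f1) -(I_opp (L1_shift b f1)).
by apply: eq_I => x; rewrite addrC.
Qed.

Lemma I_odd f : L1 f -> (forall x, f (- x) = - f x) -> I f = 0.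
Proof.
move=> f1 fN; have := I_opp f1.
rewrite (_ : I _ = - I f); first by move=> h; lra.
rewrite -mulN1r -IZ//; apply: eq_I => x; rewrite fN; ring.
Qed.

End integrals.

(** * Limits, derivatives and iterated integrals *)

Section derivatives_of_integrals.
Context {R : realType}.
Notation mu := (@lebesgue_measure R).
Implicit Types f g : R -> R.

(** [G - F] has nonnegative derivative. This and the next lemma stand in for the integration of
    differential inequalities, so derivatives are asked for only on the open interval. *)
Lemma derive_mono (F G dF dG : R -> R) (a b : R) : a <= b ->
  (forall x, a <= x <= b -> {for x, continuous F}) ->
  (forall x, a <= x <= b -> {for x, continuous G}) ->
  (forall x, a < x < b -> is_derive x 1 F (dF x)) ->
  (forall x, a < x < b -> is_derive x 1 G (dG x)) ->
  (forall x, a < x < b -> dF x <= dG x) -> F b - F a <= G b - G a.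
Proof.
move=> ab cF cG hF hG h.
suff : G a - F a <= G b - F b by lra.
have D x : a < x < b -> is_derive x 1 (fun x => G x - F x) (dG x - dF x).
  by move=> hx; have := hF _ hx; have := hG _ hx => ? ?; apply: is_deriveB.
apply: (@ger0_derive1_le_cc _ (fun x => G x - F x) a b) => //.
- by move=> x; rewrite in_itv/= => /D ?; apply: ex_derive.
- move=> x; rewrite in_itv/= => hx; have ? := D _ hx.
  by rewrite derive1E derive_val subr_ge0 h.
- apply: continuous_in_subspaceT => x; rewrite inE /= in_itv/= => hx.
  by apply: continuousB; [apply: cG|apply: cF].
- by rewrite in_itv/= lexx.
- by rewrite in_itv/= lexx ab.
Qed.

Lemma derive_norm_le (F G dF dG : R -> R) (a b : R) : a <= b ->
  (forall x, a <= x <= b -> {for x, continuous F}) ->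
  (forall x, a <= x <= b -> {for x, continuous G}) ->
  (forall x, a < x < b -> is_derive x 1 F (dF x)) ->
  (forall x, a < x < b -> is_derive x 1 G (dG x)) ->
  (forall x, a < x < b -> `|dF x| <= dG x) -> `|F b - F a| <= G b - G a.
Proof.
move=> ab cF cG hF hG h.
rewrite ler_norml; apply/andP; split; last first.
  by apply: (derive_mono ab cF cG hF hG) => x /h; apply: le_trans; rewrite ler_norm.
rewrite lerNl.
have cN x : a <= x <= b -> {for x, continuous (fun x => - F x)}.
  by move=> hx; apply: continuousN; apply: cF.
have hN x : a < x < b -> is_derive x 1 (fun x => - F x) (- dF x).
  by move=> /hF ?; apply: is_deriveN.
rewrite opprB -(opprK (F a)) addrC.
apply: (derive_mono ab cN cG hN hG) => x /h; apply: le_trans.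
by rewrite -normrN ler_norm.
Qed.

Lemma I_cvg (fn : nat -> R -> R) f g : (forall n, measurable_fun setT (fn n)) ->
  L1 g -> (forall n x, `|fn n x| <= g x) ->
  (forall x, fn n x @[n --> \oo] --> f x) ->
  L1 f /\ I (fn n) @[n --> \oo] --> I f.
Proof.
move=> mfn g1 fg cf.
have mf : measurable_fun setT f.
  by apply: (measurable_fun_cvg (h := fn)) => // x _; apply: cf.
have fle x : `|f x| <= g x.
  have h : `|fn n x| @[n --> \oo] --> `|f x| by apply: cvg_norm; exact: cf.
  rewrite -(cvg_lim _ h)//; apply: limr_le; first by apply/cvg_ex; exists `|f x|.
  by apply: nearW.
have f1 := L1_le mf fle g1; split=> //.
have H : (\int[mu]_x (fn n x)%:E @[n --> \oo] --> \int[mu]_x (f x)%:E)%E.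
  apply: (@dominated_cvg _ _ _ mu _ _ (fun n x => (fn n x)%:E) _ (EFin \o g)) => //.
  - by move=> n; apply/measurable_EFinP; exact: mfn.
  - by move=> x _; apply: cvg_EFin; [exact: nearW|exact: cf].
  - by move=> n x _; rewrite /= lee_fin fg.
rewrite EFin_I// in H; move/fine_cvgP : H => [_]; apply: cvg_trans.
by apply: near_eq_cvg; apply: nearW => n.
Qed.

Lemma I_continuous_in (f : R -> R -> R) g u v :
  (forall x, u < x < v -> measurable_fun setT (f x)) ->
  L1 g -> (forall x y, u < x < v -> `|f x y| <= g y) ->
  (forall y, {in `]u, v[, continuous (f ^~ y)}) ->
  forall x, u < x < v -> {for x, continuous (fun x => I (f x))}.
Proof.
move=> mf g1 fg cf x xuv.
have E z : `]u, v[%classic z -> u < z < v by rewrite /= in_itv.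
apply: (@continuity_under_integral R _ _ mu f setT measurableT u v _ _ g) => //.
- by move=> z /E hz; apply: (L1_le (mf _ hz) _ g1) => y; apply: fg.
- apply: aeW => y _ z; rewrite inE /= => hz; apply: cf; exact: hz.
- by move=> z /E hz; apply: aeW => y _; apply: fg.
- by rewrite inE /= in_itv.
Qed.

Lemma I_continuous (f : R -> R -> R) g :
  (forall x, measurable_fun setT (f x)) ->
  L1 g -> (forall x y, `|f x y| <= g y) ->
  (forall y, continuous (f ^~ y)) -> continuous (fun x => I (f x)).
Proof.
move=> mf g1 fg cf x.
apply: (@I_continuous_in f g (x - 1) (x + 1)) => //.
  by move=> y z _; apply: cf.
by lra.
Qed.

Lemma I_is_derive (f df : R -> R -> R) g u v x0 : u < x0 < v ->
  (forall x, u < x < v -> L1 (f x)) ->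
  (forall x y, u < x < v -> is_derive x 1 (f ^~ y) (df x y)) ->
  (forall x y, u < x < v -> `|df x y| <= g y) -> L1 g ->
  is_derive x0 1 (fun x => I (f x)) (I (df x0)).
Proof.
move=> x0uv f1 fdf dfg g1.
have E z : `]u, v[%classic z -> u < z < v by rewrite /= in_itv.
have d1 x y : u < x < v -> partial1of2 f x y = df x y.
  by move=> /(fdf x y) ?; rewrite partial1of2E derive_val.
have g0 y : 0 <= g y by apply: le_trans (dfg x0 y x0uv).
have a1 : `]u, v[%classic x0 by rewrite /= in_itv.
have a2 z : `]u, v[%classic z -> mu.-integrable setT (EFin \o f z) by move=> /E /f1.
have a3 z y : `]u, v[%classic z -> setT y -> derivable (f^~ y) z 1.
  by move=> /E /(fdf z y) ? _; apply: ex_derive.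
have a4 z y : `]u, v[%classic z -> setT y -> `|partial1of2 f z y| <= g y.
  by move=> /E hz _; rewrite d1//; apply: dfg.
apply: DeriveDef.
  exact: (@derivable_under_integral R _ _ mu f setT measurableT x0 u v a1 a2 a3 g).
rewrite -derive1E.
rewrite (@differentiation_under_integral R _ _ mu f setT measurableT x0 u v a1 a2 a3 g)//.
by apply: eq_I => y; rewrite d1.
Qed.

(** Integrability is asked of every section, not of almost every one, so that the real-valued inner
    integrals agree with the extended ones at each point; the majorant [g] then gives joint
    integrability by Tonelli. *)
Lemma I_fubini (F : R -> R -> R) g :
  measurable_fun setT (fun z : R * R => F z.1 z.2) ->
  (forall x, L1 (F x)) -> (forall y, L1 (F ^~ y)) ->
  L1 g -> (forall x, I (fun y => `|F x y|) <= g x) ->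
  [/\ I (fun x => I (F x)) = I (fun y => I (F ^~ y)),
      L1 (fun x => I (F x)) & L1 (fun y => I (F ^~ y))].
Proof.
move=> mF F1 F2 g1 Fg.
pose f := fun z : R * R => (F z.1 z.2)%:E.
have mf : measurable_fun setT f by apply/measurable_EFinP.
have maf : measurable_fun setT (abse \o f) by exact: measurableT_comp.
have imf : (mu \x mu)%E.-integrable setT f.
  apply/(@integrable12ltyP _ _ _ _ R mu mu f mf).
  under eq_integral => x _.
    rewrite (_ : (\int[mu]_y `|f (x, y)|)%E = (I (fun y => `|F x y|))%:E); last first.
      by rewrite -EFin_I//; exact: L1_norm.
    over.
  have /integrableP[mg] := g1; apply: le_lt_trans; apply: ge0_le_integral => //.
  - by move=> x _; rewrite lee_fin I_ge0.
  - have := measurable_fun_fubini_tonelli_F (m2 := mu) (abse \o f).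
    rewrite (_ : fubini_F _ _ = (fun x => (I (fun y => `|F x y|))%:E)).
      by move=> /(_ maf (fun=> abse_ge0 _)).
    by apply/funext => x; rewrite /fubini_F -EFin_I//; exact: L1_norm.
  - exact: measurableT_comp.
  - by move=> x _; rewrite /= lee_fin (le_trans (Fg x))// ler_norm.
have H := Fubini imf.
have e1 : fubini_F mu f = EFin \o (fun x => I (F x)).
  by apply/funext => x; rewrite /fubini_F /= -EFin_I.
have e2 : fubini_G mu f = EFin \o (fun y => I (F ^~ y)).
  by apply/funext => x; rewrite /fubini_G /= -EFin_I.
have h2 : L1 (fun y => I (F ^~ y)).
  apply/integrableP; rewrite -e2; split; first exact: measurable_fubini_G imf.
  apply: le_lt_trans ((@integrable21ltyP _ _ _ _ R mu mu f mf).1 imf).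
  apply: ge0_le_integral; [exact: measurableT|by []| | | ].
  - by apply: measurableT_comp => //; exact: measurable_fubini_G imf.
  - exact: (measurable_fun_fubini_tonelli_G (m1 := mu) (abse \o f) maf (fun=> abse_ge0 _)).
  - move=> y _; apply: le_abse_integral => //.
    by have /integrableP[] := F2 y.
have h1 : L1 (fun x => I (F x)) by rewrite /L1 -e1; exact: integrable_fubini_F imf.
split; [|exact: h1|exact: h2].
apply: EFin_inj; rewrite -(EFin_I h1) -(EFin_I h2).
transitivity (\int[mu]_x \int[mu]_y f (x, y))%E.
  by apply: eq_integral => x _; rewrite -EFin_I.
by rewrite H; apply: eq_integral => x _; rewrite -EFin_I.
Qed.

(** The primitive that vanishes at [0]. The base point [-1] keeps [0] in the interior, so that it is
    differentiable at every point of [[0, 1]]. *)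
Definition prim (F : R -> R) (x : R) : R :=
  Rintegral mu `[-1, x] F - Rintegral mu `[-1, 0] F.

Lemma prim0 (F : R -> R) : prim F 0 = 0.
Proof. exact: subrr. Qed.

Lemma is_derive_prim (F : R -> R) (x : R) : continuous F -> -1 < x -> is_derive x 1 (prim F) (F x).
Proof.
move=> cF x1.
have iF : mu.-integrable `[-1, x + 1] (EFin \o F).
  apply: continuous_compact_integrable; first exact: segment_compact.
  exact: continuous_subspaceT.
have xx1 : x < x + 1 by lra.
have [d1 d2] := continuous_FTC1_closed xx1 iF x1 (cF x).
rewrite -[F x]subr0; apply: is_deriveB.
by apply: DeriveDef; [exact: d1|rewrite -derive1E; exact: d2].
Qed.

Lemma I_setT_lim f : L1 f ->
  Rintegral mu `[- n%:R, n%:R] f @[n --> \oo] --> I f.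
Proof.
move=> f1.
pose fn (n : nat) := f \_ `[- n%:R, n%:R].
have mfn n : measurable_fun setT (fn n).
  by apply/(measurable_restrict f) => //; rewrite setTI; apply: measurable_funTS;
    exact: L1_measurable.
have [//|||_ H] := I_cvg (fn := fn) (f := f) (g := fun x => `|f x|) mfn.
- exact: L1_norm.
- by move=> n x; rewrite /fn patchE; case: ifPn; rewrite ?normr0.
- move=> x; apply: cvg_near_cst.
  near=> n; rewrite /fn patchE ifT// inE /= in_itv/= -ler_norml.
  by near: n; apply: nbhs_infty_ger.
- apply: cvg_trans H; apply: near_eq_cvg; apply: nearW => n.
  by rewrite /I /fn -Rintegral_mkcond.
Unshelve. all: by end_near. Qed.

(** The fundamental theorem on [[- n, n]], with [n] tending to infinity. Applied to products, it is
    integration by parts on the line. *)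
Lemma I_derive0 (F f : R -> R) : (forall x : R, is_derive x 1 F (f x)) ->
  continuous f -> L1 f -> F n%:R @[n --> \oo] --> (0 : R) ->
  F (- n%:R) @[n --> \oo] --> (0 : R) -> I f = 0.
Proof.
move=> Ff cf f1 F0 F0'.
have H := I_setT_lim f1.
suff E : Rintegral mu `[- n%:R, n%:R] f @[n --> \oo] --> (0 : R).
  exact: cvg_unique H E.
rewrite -(subr0 (0 : R)); apply: cvg_trans (cvgB F0 F0'); apply: near_eq_cvg.
have cF : continuous F.
  move=> x; apply: differentiable_continuous; apply/derivable1_diffP.
  by have ? := Ff x; apply: ex_derive.
near=> n.
have n0 : (0 : R) < n%:R by rewrite ltr0n; near: n; exists 1%N.
have nn : - n%:R < n%:R :> R by lra.
rewrite /Rintegral (@continuous_FTC2 _ f F _ _ nn)//.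
- exact: continuous_subspaceT.
- split.
  + by move=> x _; have ? := Ff x; apply: ex_derive.
  + exact/cvg_at_right_filter/cF.
  + exact/cvg_at_left_filter/cF.
- by move=> x _; have ? := Ff x; rewrite derive1E derive_val.
Unshelve. all: by end_near. Qed.

End derivatives_of_integrals.

(** * Continuity and derivative rules, with their automation *)

Section calculus.
Context {R : realType}.
Implicit Types f g : R -> R.

Lemma cont_cst (c : R) : continuous (fun _ : R => c).
Proof. by move=> x; apply: cvg_cst. Qed.
Lemma cont_id : continuous (fun x : R => x).
Proof. by move=> x; apply: cvg_id. Qed.
Lemma cont_D f g : continuous f -> continuous g -> continuous (fun x => f x + g x).
Proof. by move=> cf cg x; apply: continuousD; [apply: cf|apply: cg]. Qed.
Lemma cont_N f : continuous f -> continuous (fun x => - f x).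
Proof. by move=> cf x; apply: continuousN; apply: cf. Qed.
Lemma cont_M f g : continuous f -> continuous g -> continuous (fun x => f x * g x).
Proof. by move=> cf cg x; apply: continuousM; [apply: cf|apply: cg]. Qed.
Lemma cont_X f n : continuous f -> continuous (fun x => f x ^+ n).
Proof.
move=> cf x; apply: (continuous_comp (g := fun z : R => z ^+ n)); first exact: cf.
exact: exprn_continuous.
Qed.
Lemma cont_comp (h : R -> R) f : continuous h -> continuous f -> continuous (fun x => h (f x)).
Proof. by move=> ch cf x; apply: continuous_comp; [apply: cf|apply: ch]. Qed.
Lemma cont_norm f : continuous f -> continuous (fun x => `|f x|).
Proof. by move=> cf x; apply: continuous_comp; [apply: cf|apply: norm_continuous]. Qed.
Lemma cont_expR f : continuous f -> continuous (fun x => expR (f x)).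
Proof. by move=> cf; apply: cont_comp => //; exact: continuous_expR. Qed.
Lemma cont_cos f : continuous f -> continuous (fun x => cos (f x)).
Proof. by move=> cf; apply: cont_comp => //; exact: continuous_cos. Qed.
Lemma cont_sin f : continuous f -> continuous (fun x => sin (f x)).
Proof. by move=> cf; apply: cont_comp => //; exact: continuous_sin. Qed.
Lemma cont_mulc (c : R) : continuous ( *%R c).
Proof. by move=> x; apply: cvgM; [apply: cvg_cst|apply: cvg_id]. Qed.
Lemma cont_addc (c : R) : continuous (+%R c).
Proof. by move=> x; apply: cvgD; [apply: cvg_cst|apply: cvg_id]. Qed.
Lemma cont_opp : continuous (-%R : R -> R).
Proof. exact: cont_N cont_id. Qed.
Lemma cont_V f : continuous f -> (forall x, f x != 0) -> continuous (fun x => (f x)^-1).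
Proof. by move=> cf f0 x; apply: cvgV; [exact: f0|exact: cf]. Qed.

(** The form on which the tactic [isd] matches; [isd_eq] turns its outcome into [is_derive], leaving
    an equation between the computed and the expected derivative. *)
Definition isder f (x a : R) : Prop := is_derive x 1 f a.

Lemma isd_cst (c x : R) : isder (fun _ : R => c) x 0.
Proof. exact: is_derive_cst. Qed.
Lemma isd_id (x : R) : isder (fun x : R => x) x 1.
Proof. exact: is_derive_id. Qed.
Lemma isd_D f g (x a b : R) : isder f x a -> isder g x b ->
  isder (fun x => f x + g x) x (a + b).
Proof. by rewrite /isder => ? ?; apply: is_deriveD. Qed.
Lemma isd_N f (x a : R) : isder f x a -> isder (fun x => - f x) x (- a).
Proof. by rewrite /isder => ?; apply: is_deriveN. Qed.
Lemma isd_M f g (x a b : R) : isder f x a -> isder g x b ->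
  isder (fun x => f x * g x) x (f x * b + g x * a).
Proof. by rewrite /isder => ? ?; apply: is_deriveM. Qed.
Lemma isd_comp (h : R -> R) f (x a b : R) : isder h (f x) a -> isder f x b ->
  isder (fun x => h (f x)) x (a * b).
Proof. by rewrite /isder => ? ?; apply: is_derive1_comp. Qed.
Lemma isd_X f n (x a : R) : isder f x a ->
  isder (fun x => f x ^+ n.+1) x (n.+1%:R * f x ^+ n * a).
Proof.
by move=> hf; have := @is_deriveX _ _ f n.+1 x 1 a hf; rewrite exprfctE.
Qed.
Lemma isd_expR f (x a : R) : isder f x a ->
  isder (fun x => expR (f x)) x (expR (f x) * a).
Proof. by move=> h; apply: (isd_comp (is_derive_expR _) h). Qed.
Lemma isd_cos f (x a : R) : isder f x a ->
  isder (fun x => cos (f x)) x (- sin (f x) * a).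
Proof. by move=> h; apply: (isd_comp (is_derive_cos _) h). Qed.
Lemma isd_sin f (x a : R) : isder f x a ->
  isder (fun x => sin (f x)) x (cos (f x) * a).
Proof. by move=> h; apply: (isd_comp (is_derive_sin _) h). Qed.

Lemma isd_eq f (x a b : R) : isder f x a -> a = b -> is_derive x 1 f b.
Proof. by rewrite /isder => h <-. Qed.

Lemma isd_cont_at f (x a : R) : is_derive x 1 f a -> {for x, continuous f}.
Proof.
move=> ?; apply: differentiable_continuous; apply/derivable1_diffP.
exact: ex_derive.
Qed.
Lemma isd_cont f (df : R -> R) : (forall x : R, is_derive x 1 f (df x)) -> continuous f.
Proof. by move=> h x; apply: isd_cont_at (h x). Qed.

Lemma cont_meas f : continuous f -> measurable_fun setT f.
Proof. exact: continuous_measurable_fun. Qed.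
End calculus.

Ltac cont := try assumption; lazymatch goal with
  | |- forall z, continuous_at z (fun x => @?u x + @?v x) => apply: cont_D; cont
  | |- forall z, continuous_at z (fun x => - @?u x) => apply: cont_N; cont
  | |- forall z, continuous_at z (fun x => @?u x * @?v x) => apply: cont_M; cont
  | |- forall z, continuous_at z (fun x => @?u x ^+ _) => apply: cont_X; cont
  | |- forall z, continuous_at z (fun x => `|@?u x|) => apply: cont_norm; cont
  | |- forall z, continuous_at z (fun x => expR (@?u x)) => apply: cont_expR; cont
  | |- forall z, continuous_at z (fun x => cos (@?u x)) => apply: cont_cos; cont
  | |- forall z, continuous_at z (fun x => sin (@?u x)) => apply: cont_sin; cont
  | |- forall z, continuous_at z (fun x => x) => apply: cont_id
  | |- forall z, continuous_at z ( *%R ?c) => apply: cont_mulc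
  | |- forall z, continuous_at z (-%R) => apply: cont_opp
  | |- forall z, continuous_at z Num.Def.normr => apply: norm_continuous
  | |- forall z, continuous_at z expR => apply: continuous_expR
  | |- forall z, continuous_at z cos => apply: continuous_cos
  | |- forall z, continuous_at z sin => apply: continuous_sin
  | |- forall z, continuous_at z (+%R ?c) => apply: cont_addc
  | |- forall z, continuous_at z (fun _ => ?c) => apply: cont_cst
  | |- _ => idtac end.
Ltac isd := try eassumption; lazymatch goal with
  | |- isder (fun x => @?u x + @?v x) _ _ => apply: isd_D; isd
  | |- isder (fun x => - @?u x) _ _ => apply: isd_N; isd
  | |- isder (fun x => @?u x * @?v x) _ _ => apply: isd_M; isd
  | |- isder (fun x => @?u x ^+ _) _ _ => apply: isd_X; isd
  | |- isder (fun x => expR (@?u x)) _ _ => apply: isd_expR; isd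
  | |- isder (fun x => cos (@?u x)) _ _ => apply: isd_cos; isd
  | |- isder (fun x => sin (@?u x)) _ _ => apply: isd_sin; isd
  | |- isder (fun x => x) _ _ => apply: isd_id
  | |- isder ( *%R ?c) ?x _ => apply: (isd_M (isd_cst c x) (isd_id x))
  | |- isder (-%R) ?x _ => apply: (isd_N (isd_id x))
  | |- isder (+%R ?c) ?x _ => apply: (isd_D (isd_cst c x) (isd_id x))
  | |- isder (fun _ => ?c) _ _ => apply: isd_cst
  | |- _ => idtac end.

(** * The Hartley transform *)

Section gauss.
Context {R : realType}.
Implicit Types (f g h : R -> R) (x y e k : R).

Definition cas x := cos x + sin x.

Lemma cas_le2 x : `|cas x| <= 2.
Proof.
apply: (le_trans (ler_normD _ _)).
by have := cos_max x; have := sin_max x; lra.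
Qed.

Lemma cont_cas f : continuous f -> continuous (fun x => cas (f x)).
Proof. by move=> cf; rewrite /cas; cont. Qed.

Lemma isd_cas f x (a : R) : isder f x a ->
  isder (fun x => cas (f x)) x (cas (- f x) * a).
Proof.
move=> hf; rewrite /cas; apply: isd_eq; [isd|].
by rewrite /cas cosN sinN; ring.
Qed.

Lemma cas_cos x y : cas x * cos y = (cas (x - y) + cas (x + y)) / 2.
Proof. by rewrite /cas !cosD !sinD cosN sinN; field. Qed.

Lemma cas_sin x y : cas x * sin y = (cas (y - x) - cas (- (x + y))) / 2.
Proof. by rewrite /cas !(cosN, sinN, cosD, sinD); field. Qed.

Lemma cas_cas x y : cas x * cas y =
  (cas (x - y) + cas (y - x) + cas (x + y) - cas (- (x + y))) / 2.
Proof. by rewrite /cas !(cosN, sinN, cosD, sinD); field. Qed.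

Lemma cas_B x y : cas (x - y) = cas x * cos y - cas (- x) * sin y.
Proof. by rewrite /cas !(cosN, sinN, cosD, sinD); ring. Qed.

Definition gau e x := expR (- (e * x ^+ 2)).

Lemma gau_ge0 e x : 0 <= gau e x. Proof. exact: expR_ge0. Qed.
Lemma cont_gau e f : continuous f -> continuous (fun x => gau e (f x)).
Proof. by move=> cf; rewrite /gau; cont. Qed.
Lemma gauN e x : gau e (- x) = gau e x. Proof. by rewrite /gau sqrrN. Qed.
Lemma gau_le1 e x : 0 <= e -> gau e x <= 1.
Proof. by move=> e0; rewrite /gau -expR0 ler_expR oppr_le0 mulr_ge0 ?sqr_ge0. Qed.

Lemma gau_sqrt e x : 0 <= e -> gau 1 (Num.sqrt e * x) = gau e x.
Proof. by move=> e0; rewrite /gau mul1r exprMn sqr_sqrtr. Qed.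

Lemma L1_gau1 : L1 (@gau 1).
Proof.
rewrite /L1 (_ : _ \o _ = EFin \o @gauss_fun R); first exact: integrableT_gauss.
by apply/funext => x; rewrite /= /gau mul1r.
Qed.

Lemma I_gau1 : I (@gau 1) = Num.sqrt pi.
Proof.
rewrite -[RHS]/(fine (Num.sqrt pi)%:E) -integralT_gauss; congr fine.
by apply: eq_integral => x _; rewrite /gau mul1r.
Qed.

Lemma L1_gau e : 0 < e -> L1 (@gau e).
Proof.
move=> e0; have s0 : Num.sqrt e != 0 by rewrite gt_eqF// sqrtr_gt0.
have := L1_affine 0 s0 L1_gau1.
by under [X in L1 X -> _]funext do rewrite addr0 gau_sqrt ?ltW//.
Qed.

Lemma gau_moment x : `|x| * gau 1 x <= gau 2^-1 x.
Proof.
have h : `|x| <= expR (2^-1 * x ^+ 2).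
  apply: (le_trans _ (expR_ge1Dx _)).
  by have := sqr_ge0 (`|x| - 1); rewrite sqrrB1 real_normK ?num_real//; lra.
apply: (le_trans (ler_wpM2r (gau_ge0 _ _) h)).
by rewrite /gau -expRD ler_expR; lra.
Qed.

Lemma gau1_decay : gau 1 n%:R @[n --> \oo] --> (0 : R).
Proof.
have := cvg_comp _ _ cvgr_idn (@cvg_gauss_fun R).
by apply: cvg_trans; apply: near_eq_cvg; apply: nearW => n; rewrite /gau mul1r.
Qed.

Lemma gaucas_dom e y x : `|gau e x * cas (x * y)| <= 2 * gau e x.
Proof. by rewrite normrM ger0_norm ?gau_ge0// mulrC ler_wpM2r ?gau_ge0 ?cas_le2. Qed.

Lemma L1_gaucas e y : 0 < e -> L1 (fun x => gau e x * cas (x * y)).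
Proof.
move=> e0; apply: (L1_le (g := fun x => 2 * gau e x)).
- by apply: cont_meas; apply: cont_M; [apply: cont_gau; cont|apply: cont_cas; cont].
- by move=> x; apply: gaucas_dom.
- by apply: L1_Z; apply: L1_gau.
Qed.

(* [phi' = - (y / 2) phi] determines the transform of the Gaussian. *)
Let phi y := I (fun x => gau 1 x * cas (x * y)).
Let dphi y := I (fun x => gau 1 x * (cas (- (x * y)) * x)).

Let phi_dom x y : `|gau 1 x * (cas (- (x * y)) * x)| <= 2 * gau 2^-1 x.
Proof.
rewrite normrM ger0_norm ?gau_ge0// normrM mulrCA.
have h1 := gau_moment x; have h2 := cas_le2 (- (x * y)).
apply: ler_pM => //; first by rewrite mulr_ge0 ?gau_ge0.
by rewrite mulrC.
Qed.

Let isd_phi y : is_derive y 1 phi (dphi y).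
Proof.
apply: (@I_is_derive R (fun y x => gau 1 x * cas (x * y))
  (fun y x => gau 1 x * (cas (- (x * y)) * x)) (fun x => 2 * gau 2^-1 x) (y - 1) (y + 1)).
- lra.
- by move=> z _; apply: L1_gaucas.
- move=> z x _; apply: isd_eq; [apply: isd_M; [apply: isd_cst|apply: isd_cas; isd]|].
  by rewrite /= !(mulr0, addr0, mulr1).
- by move=> z x _; apply: phi_dom.
- by apply: L1_Z; apply: L1_gau; rewrite invr_gt0.
Qed.

(** The derivative in [x] of [gau 1 x * cas (- (x * y))] is a combination of the two integrands, and
    its integral over the line vanishes. *)
Let dphiE y : dphi y = - (y / 2) * phi y.
Proof.
pose F x := gau 1 x * cas (- (x * y)).
pose f x := - 2 * (gau 1 x * (cas (- (x * y)) * x)) - y * (gau 1 x * cas (x * y)).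
have l1 : L1 (fun x => gau 1 x * (cas (- (x * y)) * x)).
  apply: (L1_le (g := fun x => 2 * gau 2^-1 x)).
  - apply: cont_meas; apply: cont_M; [apply: cont_gau; cont|].
    by apply: cont_M; [apply: cont_cas; cont|cont].
  - by move=> x; apply: phi_dom.
  - by apply: L1_Z; apply: L1_gau; rewrite invr_gt0.
have l2 : L1 (fun x => gau 1 x * cas (x * y)) by apply: L1_gaucas.
suff : I f = 0.
  rewrite /f (IB (L1_Z (-2) l1) (L1_Z y l2)) !IZ// -/(dphi y) -/(phi y) => h.
  by lra.
apply: (@I_derive0 R F).
- move=> x; rewrite /F /gau; apply: isd_eq.
    apply: isd_M; [isd|apply: isd_cas; isd].
  by rewrite /f /gau opprK; ring.
- apply: cont_D; [|apply: cont_N]; apply: cont_M; try cont.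
  + by apply: cont_gau; cont.
  + by apply: cont_cas; cont.
  + by apply: cont_gau; cont.
  + by apply: cont_cas; cont.
- exact: L1_B (L1_Z (-2) l1) (L1_Z y l2).
- apply: (@squeeze_cvgr _ _ _ _ (fun n => - (2 * gau 1 n%:R)) (fun n => 2 * gau 1 n%:R)).
  + apply: nearW => n; rewrite -ler_norml /F -mulNr.
    by rewrite mulNr; have := gaucas_dom 1 (- y) n%:R; rewrite mulrN.
  + by rewrite -oppr0 -(mulr0 2); apply: cvgN; apply: cvgM; [apply: cvg_cst|apply: gau1_decay].
  + by rewrite -(mulr0 2); apply: cvgM; [apply: cvg_cst|apply: gau1_decay].
- apply: (@squeeze_cvgr _ _ _ _ (fun n => - (2 * gau 1 n%:R)) (fun n => 2 * gau 1 n%:R)).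
  + apply: nearW => n; rewrite -ler_norml /F.
    by have := gaucas_dom 1 y n%:R; rewrite gauN mulNr opprK.
  + by rewrite -oppr0 -(mulr0 2); apply: cvgN; apply: cvgM; [apply: cvg_cst|apply: gau1_decay].
  + by rewrite -(mulr0 2); apply: cvgM; [apply: cvg_cst|apply: gau1_decay].
Qed.

Lemma I_gau1cas y : I (fun x => gau 1 x * cas (x * y)) = Num.sqrt pi * gau 4^-1 y.
Proof.
pose psi z := phi z * expR (4^-1 * z ^+ 2).
have d (z : R) : is_derive z 1 psi 0.
  apply: isd_eq; [apply: isd_M; [apply: isd_phi|isd]|].
  by rewrite /= dphiE; field.
have := is_derive_0_is_cst y 0 d; rewrite /psi expr0n /= mulr0 expR0 mulr1 => h.
have <- : phi 0 = Num.sqrt pi.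
  by rewrite -I_gau1; apply: eq_I => x; rewrite mulr0 /cas cos0 sin0 addr0 mulr1.
by rewrite -h /gau -mulrA -expRD addrN expR0 mulr1.
Qed.

(** The Hartley transform of [gau e]: a heat kernel of total mass [2 * pi] that concentrates at [0]
    as [e] tends to [0]. *)
Definition kern e y := Num.sqrt pi / Num.sqrt e * gau (4 * e)^-1 y.

Lemma kern_ge0 e y : 0 <= kern e y.
Proof. by rewrite mulr_ge0 ?gau_ge0// divr_ge0 ?sqrtr_ge0. Qed.

Lemma kernN e y : kern e (- y) = kern e y.
Proof. by rewrite /kern gauN. Qed.

Lemma cont_kern e f : continuous f -> continuous (fun x => kern e (f x)).
Proof. by move=> cf; apply: cont_M; [apply: cont_cst|apply: cont_gau]. Qed.

Lemma I_gaucas e y : 0 < e -> I (fun x => gau e x * cas (x * y)) = kern e y.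
Proof.
move=> e0; have s0 : Num.sqrt e != 0 by rewrite gt_eqF// sqrtr_gt0.
have := I_affine 0 s0 (L1_gaucas (y / Num.sqrt e) ltr01).
rewrite I_gau1cas ger0_norm ?sqrtr_ge0// => h.
rewrite /kern (_ : gau (4 * e)^-1 y = gau 4^-1 (y / Num.sqrt e)); last first.
  by rewrite /gau expr_div_n sqr_sqrtr ?ltW// invfM; congr (expR (- _)); ring.
rewrite mulrAC h mulrAC mulfV// mul1r; apply: eq_I => x.
rewrite addr0 gau_sqrt ?ltW//; congr (_ * cas _); field.
exact: s0.
Qed.

Lemma L1_kern e : 0 < e -> L1 (@kern e).
Proof. by move=> e0; apply: L1_Z; apply: L1_gau; rewrite invr_gt0 mulr_gt0. Qed.

(** The substitution [k = 2 * sqrt e * z + xi] replaces the concentrating kernel by a fixed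
    Gaussian; the limit in [e] then acts on the argument of [h] alone. *)
Lemma I_kern_subst e h xi M : 0 < e -> continuous h -> (forall k, `|h k| <= M) ->
  I (fun k => h k * kern e (k - xi)) =
  I (fun z => 2 * Num.sqrt pi * (h (2 * Num.sqrt e * z + xi) * gau 1 z)).
Proof.
move=> e0 ch hM.
have s0 : Num.sqrt e != 0 by rewrite gt_eqF// sqrtr_gt0.
have s1 : 2 * Num.sqrt e != 0 by rewrite mulf_neq0.
have l1 : L1 (fun k => h k * kern e (k - xi)).
  under eq_fun do rewrite mulrC.
  apply: (L1_Mbounded (M := M)) => //; first exact: cont_meas.
  exact: (L1_shift (- xi) (L1_kern e0)).
rewrite (I_affine xi s1 l1) ger0_norm ?mulr_ge0 ?sqrtr_ge0//.
have l2 := L1_affine xi s1 l1.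
rewrite -(IZ _ l2); apply: eq_I => z; rewrite addrK /kern.
rewrite (_ : gau (4 * e)^-1 _ = gau 1 z).
  by set u := h _; field.
rewrite /gau mul1r !exprMn sqr_sqrtr ?ltW//; congr (expR (- _)); field.
by rewrite gt_eqF.
Qed.

Lemma I_kern e xi : 0 < e -> I (fun k => kern e (k - xi)) = 2 * pi.
Proof.
move=> e0; have := @I_kern_subst e (fun=> 1) xi 1 e0 (@cont_cst _ _).
rewrite normr1 => /(_ (fun=> lexx _)).
under eq_I do rewrite mul1r.
under [in RHS]eq_I do rewrite mul1r.
rewrite (IZ _ L1_gau1) I_gau1 => ->.
by rewrite -mulrA -expr2 sqr_sqrtr// pi_ge0.
Qed.

Lemma kern_approx h xi M : continuous h -> (forall k, `|h k| <= M) ->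
  I (fun k => h k * kern (n.+1%:R)^-1 (k - xi)) @[n --> \oo] --> 2 * pi * h xi.
Proof.
move=> ch hM.
have en0 n : (0 : R) < (n.+1%:R)^-1 by rewrite invr_gt0.
under eq_fun do rewrite (I_kern_subst xi (en0 _) ch hM).
pose c := 2 * Num.sqrt pi : R.
have m0 : 0 <= c by rewrite mulr_ge0 ?sqrtr_ge0.
have e_cvg : Num.sqrt (n.+1%:R^-1 : R) @[n --> \oo] --> (0 : R).
  rewrite -[X in _ --> X]sqrtr0; apply: continuous_cvg; first exact: sqrt_continuous.
  exact: cvg_harmonic.
have [||||_] := @I_cvg R (fun n z => c * (h (2 * Num.sqrt (n.+1%:R)^-1 * z + xi) * gau 1 z))
  (fun z => c * (h xi * gau 1 z)) (fun z => c * (M * gau 1 z)).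
- move=> n; apply: cont_meas; apply: cont_M; cont; last by apply: cont_gau; cont.
  by apply: (cont_comp (h := h)) => //; cont.
- by apply: L1_Z; apply: L1_Z; exact: L1_gau1.
- move=> n x; rewrite normrM (ger0_norm m0) ler_wpM2l// normrM (ger0_norm (gau_ge0 _ _)).
  by rewrite ler_wpM2r ?gau_ge0.
- move=> x; apply: cvgM; first exact: cvg_cst.
  apply: cvgM; last exact: cvg_cst.
  apply: (@continuous_cvg _ _ _ _ _ _ h); first exact: ch.
  rewrite -[X in _ --> X]add0r; apply: cvgD; last exact: cvg_cst.
  rewrite -[X in _ --> X](mul0r x); apply: cvgM; last exact: cvg_cst.
  by rewrite -(mulr0 2); apply: cvgM; [exact: cvg_cst|exact: e_cvg].
rewrite (IZ _ (L1_Z _ L1_gau1)) (IZ _ L1_gau1) I_gau1.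
rewrite (_ : _ * (_ * _) = 2 * pi * h xi) //.
have hs : Num.sqrt pi * Num.sqrt pi = pi :> R by rewrite -expr2 sqr_sqrtr// pi_ge0.
by rewrite /c -[in RHS]hs; ring.
Qed.

End gauss.

(** * Inversion, Sobolev norms and square integrability *)

Section hartley.
Context {R : realType}.
Notation mu := (@lebesgue_measure R).
Implicit Types (f g h b : R -> R) (x y e k : R).

Lemma L1_mull f g (M : R) : measurable_fun setT g -> (forall x, `|g x| <= M) ->
  L1 f -> L1 (fun x => g x * f x).
Proof. by move=> mg gM f1; under eq_fun do rewrite mulrC; apply: L1_Mbounded f1. Qed.

(** The double integrand is dominated by [A * |h k| * |b x|], a product of integrable functions of
    separate variables. *)
Lemma I_swap h b (a : R -> R -> R) (A : R) : L1 h -> L1 b ->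
  measurable_fun setT (fun z : R * R => a z.1 z.2) ->
  (forall x k, `|a x k| <= A) ->
  [/\ I (fun x => I (fun k => h k * a x k) * b x) = I (fun k => h k * I (fun x => a x k * b x)),
    L1 (fun x => I (fun k => h k * a x k) * b x) &
    L1 (fun k => h k * I (fun x => a x k * b x))].
Proof.
move=> h1 b1 ma aA.
have A0 : 0 <= A by apply: le_trans (aA 0 0).
have mh := L1_measurable h1; have mb := L1_measurable b1.
have ma1 x : measurable_fun setT (a x).
  exact: (measurableT_comp ma (pair1_measurable x)).
have ma2 k : measurable_fun setT (a ^~ k).
  exact: (measurableT_comp ma (pair2_measurable k)).
pose F x k := h k * a x k * b x.
have hx x : L1 (fun k => h k * a x k) by apply: L1_Mbounded h1; [exact: ma1|].
have hk k : L1 (fun x => a x k * b x) by apply: L1_mull b1; [exact: ma2|].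
have mF : measurable_fun setT (fun z : R * R => F z.1 z.2).
  apply: measurable_funM; [apply: measurable_funM => //|].
  - exact: (measurableT_comp mh measurable_snd).
  - exact: (measurableT_comp mb measurable_fst).
have F1 x : L1 (F x).
  by rewrite /F; under eq_fun do rewrite mulrC; apply: L1_Z.
have F2 k : L1 (F ^~ k).
  by rewrite /F; under eq_fun do rewrite -mulrA; apply: L1_Z.
have g1 : L1 (fun x => A * I (fun k => `|h k|) * `|b x|) by apply: L1_Z; apply: L1_norm.
have Fg x : I (fun k => `|F x k|) <= A * I (fun k => `|h k|) * `|b x|.
  rewrite mulrC -(IZ _ (L1_norm h1)) -IZ; last by apply: L1_Z; apply: L1_norm.
  apply: I_le.
  - exact: L1_norm.
  - by apply: L1_Z; apply: L1_Z; apply: L1_norm.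
  - move=> k; rewrite /F !normrM mulrC ler_wpM2l// mulrC ler_wpM2r//.
have [E e1 e2] := I_fubini mF F1 F2 g1 Fg.
have E1 x : I (fun k => h k * a x k) * b x = I (F x).
  by rewrite mulrC -IZ//; apply: eq_I => k; rewrite mulrC.
have E2 k : h k * I (fun x => a x k * b x) = I (F ^~ k).
  by rewrite -IZ//; apply: eq_I => x; rewrite mulrA.
split.
- by rewrite (eq_I E1) E; apply: eq_I => k; rewrite E2.
- by rewrite (_ : (fun x => _) = (fun x => I (F x)))//; apply/funext.
- by rewrite (_ : (fun k => _) = (fun k => I (F ^~ k)))//; apply/funext.
Qed.

Lemma meas2_cas : measurable_fun setT (fun z : R * R => cas (z.1 * z.2)).
Proof.
have c : continuous (@cas R) by exact: (cont_cas (@cont_id R)).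
by apply: (measurableT_comp (cont_meas c)); exact: measurable_funM.
Qed.

Lemma I_swap_cas h b : L1 h -> L1 b ->
  [/\ I (fun x => I (fun k => h k * cas (x * k)) * b x) =
        I (fun k => h k * I (fun x => cas (x * k) * b x)),
    L1 (fun x => I (fun k => h k * cas (x * k)) * b x) &
    L1 (fun k => h k * I (fun x => cas (x * k) * b x))].
Proof.
move=> h1 b1.
exact: (@I_swap h b (fun x k => cas (x * k)) 2 h1 b1 meas2_cas (fun x k => cas_le2 _)).
Qed.

Definition hart h x := I (fun k => h k * cas (x * k)).

Lemma L1_hcas h x : L1 h -> L1 (fun k => h k * cas (x * k)).
Proof.
apply: (L1_Mbounded (M := 2)); last by move=> k; exact: cas_le2.
by apply: cont_meas; apply: cont_cas; cont.
Qed.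

Lemma hart_le h x : L1 h -> `|hart h x| <= 2 * I (fun k => `|h k|).
Proof.
move=> h1; rewrite -IZ; last exact: L1_norm.
apply: I_norm_le.
- exact: L1_measurable (L1_hcas _ h1).
- by apply: L1_Z; apply: L1_norm.
- by move=> k; rewrite normrM mulrC ler_wpM2r// cas_le2.
Qed.

Lemma cont_hart h : L1 h -> continuous (hart h).
Proof.
move=> h1; apply: (@I_continuous R _ (fun k => 2 * `|h k|)).
- by move=> x; exact: L1_measurable (L1_hcas _ h1).
- by apply: L1_Z; apply: L1_norm.
- by move=> x k; rewrite normrM mulrC ler_wpM2r// cas_le2.
- move=> k; apply: cont_M; first by cont.
  by apply: cont_cas; cont.
Qed.

Lemma hart_B h g x : L1 h -> L1 g -> hart (fun k => h k - g k) x = hart h x - hart g x.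
Proof.
move=> h1 g1; rewrite -IB; [|exact: L1_hcas..].
by apply: eq_I => k; rewrite mulrBl.
Qed.

Section inversion.
Variables (h : R -> R) (M : R).
Hypotheses (ch : continuous h) (hM : forall k, `|h k| <= M) (h1 : L1 h).

Lemma L1_hkern e xi : 0 < e -> L1 (fun k => h k * kern e (k - xi)).
Proof.
move=> e0; apply: (L1_mull (M := M)) => //; first exact: cont_meas.
exact: (L1_shift (- xi) (L1_kern e0)).
Qed.

Let b_cos e xi : 0 < e -> L1 (fun x => gau e x * cos (x * xi)).
Proof.
move=> e0; apply: (L1_Mbounded (M := 1)); last exact: L1_gau.
- by apply: cont_meas; cont.
- by move=> x; exact: cos_max.
Qed.

Let b_sin e xi : 0 < e -> L1 (fun x => gau e x * sin (x * xi)).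
Proof.
move=> e0; apply: (L1_Mbounded (M := 1)); last exact: L1_gau.
- by apply: cont_meas; cont.
- by move=> x; exact: sin_max.
Qed.

(** After the exchange of integrals, [cas (x * k) * cos (x * xi)] splits into the frequencies
    [k - xi] and [k + xi], each of which integrates against the Gaussian to [kern e]. The sine
    version differs by a sign. *)
Lemma gft_cos_hart e xi : 0 < e -> gft_cos (hart h) e xi =
  2^-1 * I (fun k => h k * kern e (k - xi)) + 2^-1 * I (fun k => h k * kern e (k - - xi)).
Proof.
move=> e0.
have [E _ _] := I_swap_cas h1 (b_cos xi e0).
transitivity (I (fun x => hart h x * (gau e x * cos (x * xi)))).
  by apply: eq_I => x; rewrite mulrA.
have l1 := L1_hkern xi e0; have l2 := L1_hkern (- xi) e0.
rewrite E -!IZ// -ID; [|exact: L1_Z..].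
apply: eq_I => k.
rewrite -!(I_gaucas _ e0).
have c1 := L1_gaucas (k - xi) e0; have c2 := L1_gaucas (k - - xi) e0.
rewrite (_ : I _ = I (fun x => 2^-1 * (gau e x * cas (x * (k - xi)) + gau e x * cas (x * (k - - xi))))).
  by rewrite IZ ?ID//; [ring|exact: L1_D].
apply: eq_I => x; rewrite mulrCA cas_cos (_ : x * (k - xi) = x * k - x * xi); last by ring.
by rewrite (_ : x * (k - - xi) = x * k + x * xi); [field|ring].
Qed.

Lemma gft_sin_hart e xi : 0 < e -> gft_sin (hart h) e xi =
  2^-1 * I (fun k => h k * kern e (k - xi)) - 2^-1 * I (fun k => h k * kern e (k - - xi)).
Proof.
move=> e0.
have [E _ _] := I_swap_cas h1 (b_sin xi e0).
transitivity (I (fun x => hart h x * (gau e x * sin (x * xi)))).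
  by apply: eq_I => x; rewrite mulrA.
have l1 := L1_hkern xi e0; have l2 := L1_hkern (- xi) e0.
rewrite E -!IZ// -IB; [|exact: L1_Z..].
apply: eq_I => k.
rewrite -(kernN e (k - xi)) -(kernN e (k - - xi)) -!(I_gaucas _ e0).
have c1 := L1_gaucas (- (k - xi)) e0; have c2 := L1_gaucas (- (k - - xi)) e0.
rewrite (_ : I _ = I (fun x => 2^-1 * (gau e x * cas (x * - (k - xi)) - gau e x * cas (x * - (k - - xi))))).
  by rewrite IZ ?IB//; [ring|exact: L1_B].
apply: eq_I => x; rewrite mulrCA cas_sin (_ : x * - (k - xi) = x * xi - x * k); last by ring.
by rewrite (_ : x * - (k - - xi) = - (x * k + x * xi)); [field|ring].
Qed.

Lemma fourier_cos_hart xi : fourier_cos (hart h) xi = pi * (h xi + h (- xi)).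
Proof.
apply: cvg_lim => //.
under eq_fun do rewrite gft_cos_hart//.
rewrite (_ : pi * _ = 2^-1 * (2 * pi * h xi) + 2^-1 * (2 * pi * h (- xi))); last by field.
by apply: cvgD; apply: cvgM; [exact: cvg_cst|exact: (kern_approx ch hM)|
  exact: cvg_cst|exact: (kern_approx ch hM)].
Qed.

Lemma fourier_sin_hart xi : fourier_sin (hart h) xi = pi * (h xi - h (- xi)).
Proof.
apply: cvg_lim => //.
under eq_fun do rewrite gft_sin_hart//.
rewrite (_ : pi * _ = 2^-1 * (2 * pi * h xi) - 2^-1 * (2 * pi * h (- xi))); last by field.
by apply: cvgB; apply: cvgM; [exact: cvg_cst|exact: (kern_approx ch hM)|
  exact: cvg_cst|exact: (kern_approx ch hM)].
Qed.

(** The squares of [h xi + h (- xi)] and [h xi - h (- xi)] add up without cross terms. The norm thus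
    depends on the pair [(h xi, h (- xi))] only through its length, which a rotation of the pair
    preserves. *)
Lemma Hs_norm2_hart s : Hs_norm2 s (hart h) =
  (\int[mu]_xi (pi * ((1 + xi ^+ 2) `^ s * (h xi ^+ 2 + h (- xi) ^+ 2)))%:E)%E.
Proof.
have p0 := pi_gt0 R.
rewrite /Hs_norm2 -ge0_integralZl//=.
- apply: eq_integral => xi _; rewrite fourier_cos_hart fourier_sin_hart -EFinM.
  by congr EFin; move: (gt_eqF p0); move: (pi : R) => p hp; field; rewrite hp.
- apply/measurable_EFinP.
  have ch' : continuous (fun k => h (- k)) by apply: (cont_comp (h := h)) => //; cont.
  have E : (fun xi => (1 + xi ^+ 2) `^ s *
        (fourier_cos (hart h) xi ^+ 2 + fourier_sin (hart h) xi ^+ 2)) =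
      (fun xi => (1 + xi ^+ 2) `^ s *
        ((pi * (h xi + h (- xi))) ^+ 2 + (pi * (h xi - h (- xi))) ^+ 2)).
    by apply/funext => xi; rewrite fourier_cos_hart fourier_sin_hart.
  rewrite E; apply: measurable_funM.
    apply: (measurableT_comp (measurable_powR s)).
    by apply: cont_meas; cont.
  by apply: cont_meas; cont.
- by move=> xi _; rewrite lee_fin mulr_ge0// ?powR_ge0// addr_ge0// sqr_ge0.
- by rewrite lee_fin invr_ge0 mulr_ge0// ltW.
Qed.

(** A Plancherel inequality at positive [e]: once one factor [hart h] is expanded and the integrals
    exchanged, the integral in [x] is the convolution of [h] with [kern e], at most
    [M * (2 * pi)]. *)
Lemma gauss_energy e : 0 < e ->
  I (fun x => hart h x * (hart h x * gau e x)) <= I (fun k => `|h k|) * (M * (2 * pi))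
  /\ L1 (fun x => hart h x * (hart h x * gau e x)).
Proof.
move=> e0.
have b1 : L1 (fun x => hart h x * gau e x).
  apply: (L1_mull (M := 2 * I (fun k => `|h k|))).
  - by apply: cont_meas; apply: cont_hart.
  - by move=> x; apply: hart_le.
  - exact: L1_gau.
have [E l1 l2] := I_swap_cas h1 b1.
split; last exact: l1.
rewrite E.
have Ik k : I (fun x => cas (x * k) * (hart h x * gau e x)) = I (fun n => h n * kern e (n - k)).
  have [E' _ _] := I_swap_cas h1 (L1_gaucas k e0).
  transitivity (I (fun x => hart h x * (gau e x * cas (x * k)))).
    by apply: eq_I => x; ring.
  rewrite E'; apply: eq_I => n; congr (_ * _).
  have c1 y := L1_gaucas y e0.
  rewrite (_ : I _ = I (fun x => 2^-1 * ((gau e x * cas (x * (n - k)) + gau e x * cas (x * (k - n)))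
     + (gau e x * cas (x * (n + k)) - gau e x * cas (x * - (n + k)))))).
    rewrite IZ; last by apply: L1_D; [exact: L1_D|exact: L1_B].
    rewrite ID; [|exact: L1_D|exact: L1_B].
    rewrite ID// IB// !(I_gaucas _ e0) kernN -(kernN e (n - k)) opprB; by field.
  apply: eq_I => x; rewrite mulrCA cas_cas (_ : x * (n - k) = x * n - x * k); last by ring.
  rewrite (_ : x * (k - n) = x * k - x * n); last by ring.
  rewrite (_ : x * (n + k) = x * n + x * k); last by ring.
  by rewrite (_ : x * - (n + k) = - (x * n + x * k)); [field|ring].
apply: (le_trans (ler_norm _)).
have -> : I (fun k => `|h k|) * (M * (2 * pi)) = I (fun k => M * (2 * pi) * `|h k|).
  by rewrite IZ; [rewrite mulrC|exact: L1_norm].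
apply: I_norm_le.
- exact: L1_measurable l2.
- by apply: L1_Z; apply: L1_norm.
- move=> k; rewrite normrM mulrC ler_wpM2r// Ik.
  rewrite -(I_kern k e0) -IZ; last exact: (L1_shift (- k) (L1_kern e0)).
  apply: I_norm_le.
  + exact: L1_measurable (L1_hkern k e0).
  + by apply: L1_Z; exact: (L1_shift (- k) (L1_kern e0)).
  + by move=> n; rewrite normrM (ger0_norm (kern_ge0 _ _)) ler_wpM2r ?kern_ge0.
Qed.

(** The Gaussian weights increase to [1], and [gauss_energy] bounds the weighted integrals uniformly
    in [e], so monotone convergence applies. *)
Lemma hart_L2 : (\int[mu]_x ((hart h x) ^+ 2)%:E < +oo)%E.
Proof.
pose C := I (fun k => `|h k|) * (M * (2 * pi)).
pose en (n : nat) : R := (n.+1%:R)^-1.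
have en0 n : 0 < en n by rewrite invr_gt0.
pose F n x := hart h x * (hart h x * gau (en n) x).
have F0 n x : 0 <= F n x.
  by rewrite /F mulrA mulr_ge0 ?gau_ge0// -expr2 sqr_ge0.
have mF n : measurable_fun setT (F n) := L1_measurable (gauss_energy (en0 n)).2.
have emF n : measurable_fun setT (fun x => (F n x)%:E) by apply/measurable_EFinP; exact: mF.
apply: (@le_lt_trans _ _ C%:E); last exact: ltry.
have H : (limn (fun n => \int[mu]_x (F n x)%:E) = \int[mu]_x limn (fun n => (F n x)%:E))%E.
  rewrite monotone_convergence//.
  - by move=> n x _; rewrite lee_fin.
  - move=> x _ m n mn; rewrite lee_fin /F !mulrA ler_wpM2l// -?expr2 ?sqr_ge0//.
    rewrite /gau ler_expR lerN2 ler_wpM2r ?sqr_ge0// /en lef_pV2 ?posrE//.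
    by rewrite ler_nat ltnS.
rewrite (_ : (\int[mu]_x _)%E = (\int[mu]_x limn (fun n => (F n x)%:E))%E); last first.
  apply: eq_integral => x _; apply/esym/cvg_lim => //.
  apply: cvg_EFin; first exact: nearW.
  rewrite -[X in _ --> X]mulr1 expr2 -mulrA; apply: cvgM; first exact: cvg_cst.
  apply: cvgM; first exact: cvg_cst.
  rewrite -expR0; apply: (@continuous_cvg _ _ _ _ _ _ expR); first exact: continuous_expR.
  rewrite -oppr0 -(mul0r (x ^+ 2)); apply: cvgN; apply: cvgM; last exact: cvg_cst.
  exact: cvg_harmonic.
rewrite -H; apply: lime_le.
  apply: ereal_nondecreasing_is_cvgn => m n mn; apply: ge0_le_integral => //.
  - by move=> x _; rewrite lee_fin.
  - exact: emF.
  - exact: emF.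
  - move=> x _; rewrite lee_fin /F !mulrA ler_wpM2l// -?expr2 ?sqr_ge0//.
    rewrite /gau ler_expR lerN2 ler_wpM2r ?sqr_ge0// /en lef_pV2 ?posrE//.
    by rewrite ler_nat ltnS.
apply: nearW => n; rewrite EFin_I; last exact: (gauss_energy (en0 n)).2.
by rewrite lee_fin; exact: (gauss_energy (en0 n)).1.
Qed.

End inversion.

End hartley.

(** * Derivatives and products on the Hartley side *)

Section hartley_calculus.
Context {R : realType}.
Implicit Types (f g h b : R -> R) (x y e k z : R).

Lemma mulcas_le (a y : R) : `|a * cas y| <= 2 * `|a|.
Proof. by rewrite normrM mulrC ler_wpM2r// cas_le2. Qed.

(** Differentiating [cas (x * k)] in [x] produces [k * cas (- (x * k))]; the reflection of [k]
    restores the form of a Hartley integral. *)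
Lemma isd_hart h x : L1 h -> L1 (fun k => k * h k) ->
  is_derive x 1 (hart h) (hart (fun k => - (k * h (- k))) x).
Proof.
move=> h1 kh1.
have E : hart (fun k => - (k * h (- k))) x = I (fun k => h k * (cas (- (x * k)) * k)).
  rewrite -I_opp; last first.
    apply: (L1_le (g := fun k => 2 * `|k * h k|)).
    - apply: measurable_funM; first exact: L1_measurable.
      by apply: cont_meas; apply: cont_M; [apply: cont_cas; cont|cont].
    - move=> k; rewrite (_ : h k * _ = k * h k * cas (- (x * k))); last by ring.
      exact: mulcas_le.
    - by apply: L1_Z; apply: L1_norm.
  by apply: eq_I => k; rewrite (_ : - (x * - k) = x * k); ring.
rewrite E; apply: (@I_is_derive R (fun x k => h k * cas (x * k))
   (fun x k => h k * (cas (- (x * k)) * k)) (fun k => 2 * `|k * h k|) (x - 1) (x + 1)).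
- lra.
- by move=> y _; apply: L1_hcas.
- move=> y k _; apply: isd_eq.
    apply: isd_M; [apply: isd_cst|apply: isd_cas; apply: isd_M; [apply: isd_id|apply: isd_cst]].
  by rewrite /= !(mulr0, addr0, add0r, mulr1).
- move=> y k _; rewrite (_ : h k * _ = k * h k * cas (- (y * k))); last by ring.
  exact: mulcas_le.
- by apply: L1_Z; apply: L1_norm.
Qed.

(* [Q f g] is the Hartley side of the pointwise product. *)
Definition Qker f z e := f (z + e) + f (e - z) + f (z - e) - f (- z - e).
Definition Q f g z := 2^-1 * I (fun e => Qker f z e * g e).

Lemma L1_Qker f e : L1 f -> L1 (fun z => Qker f z e).
Proof.
move=> f1; apply: L1_B; [apply: L1_D; [apply: L1_D|]|].
- exact: L1_shift.
- exact: L1_refl.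
- exact: L1_shift.
- by have := L1_refl (- e) f1; under [X in L1 X -> _]funext do rewrite addrC.
Qed.

Lemma I_normQker f e : L1 f -> I (fun z => `|Qker f z e|) <= 4 * I (fun k => `|f k|).
Proof.
move=> f1; have nf1 := L1_norm f1.
have l1 := L1_shift e nf1; have l2 := L1_refl e nf1.
have l3 := L1_shift (- e) nf1; have l4 := L1_refl (- e) nf1.
rewrite (_ : 4 * _ = I (fun z => (`|f (z + e)| + `|f (e - z)|) + (`|f (z - e)| + `|f (- e - z)|))).
  apply: I_le.
  - by apply: L1_norm; apply: L1_Qker.
  - by apply: L1_D; apply: L1_D.
  - move=> z; rewrite /Qker (addrC (- z) (- e)) -addrA -addrA.
    apply: (le_trans (ler_normD _ _)); rewrite -addrA lerD2l.
    apply: (le_trans (ler_normD _ _)); rewrite lerD2l.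
    exact: ler_normB.
rewrite ID; [|exact: L1_D|exact: L1_D].
rewrite (ID l1 l2) (ID l3 l4) (I_shift e nf1) (I_refl e nf1) (I_shift (- e) nf1) (I_refl (- e) nf1).
ring.
Qed.

(** Each of the four terms of [cas_cas] becomes a term of [Qker] after a translation or reflection
    of the frequency of [f]; Fubini then collects the coefficient of [cas (x * z)]. *)
Lemma hart_mul f g x : continuous f -> continuous g -> L1 f -> L1 g ->
  (forall z, L1 (fun e => Qker f z e * g e)) ->
  hart f x * hart g x = hart (Q f g) x.
Proof.
move=> cf cg f1 g1 q1.
have mf := cont_meas cf; have mg := cont_meas cg.
pose F e z := 2^-1 * (Qker f z e * g e) * cas (x * z).
have mF : measurable_fun setT (fun p : R * R => F p.1 p.2).
  have m1 := @measurable_fst _ _ (measurableTypeR R) (measurableTypeR R).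
  have m2 := @measurable_snd _ _ (measurableTypeR R) (measurableTypeR R).
  apply: measurable_funM; [apply: measurable_funM => //; apply: measurable_funM|].
  - apply: measurable_funB; [apply: measurable_funD; [apply: measurable_funD|]|];
      apply: (measurableT_comp mf).
    + exact: measurable_funD.
    + exact: measurable_funB.
    + exact: measurable_funB.
    + by apply: measurable_funB => //; apply: measurable_funN.
  - exact: (measurableT_comp mg).
  - have c : continuous (fun y => cas (x * y)) by apply: cont_cas; cont.
    exact: (measurableT_comp (cont_meas c)).
have lk e : L1 (fun z => Qker f z e * cas (x * z)) by apply: L1_hcas; apply: L1_Qker.
have FE e : F e = (fun z => 2^-1 * g e * (Qker f z e * cas (x * z))).
  by apply/funext => z; rewrite /F; ring.
have F1 e : L1 (F e) by rewrite FE; apply: L1_Z.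
have F2 z : L1 (F ^~ z).
  rewrite (_ : F ^~ z = fun e => cas (x * z) * (2^-1 * (Qker f z e * g e))).
    by apply: L1_Z; apply: L1_Z.
  by apply/funext => e; rewrite /F mulrC.
have l1 : L1 (fun e => 4 * I (fun k => `|f k|) * `|g e|) by apply: L1_Z; apply: L1_norm.
have Fg e : I (fun z => `|F e z|) <= 4 * I (fun k => `|f k|) * `|g e|.
  apply: (@le_trans _ _ (I (fun z => `|g e| * `|Qker f z e|))).
    apply: I_le; first exact: L1_norm.
      by apply: L1_Z; apply: L1_norm; apply: L1_Qker.
    move=> z; rewrite /F !normrM (ger0_norm (_ : 0 <= 2^-1)) ?invr_ge0//.
    have h1 := cas_le2 (x * z).
    have h2 : 0 <= `|Qker f z e| * `|g e| by rewrite mulr_ge0.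
    have h3 : 0 <= `|cas (x * z)| by [].
    by rewrite (mulrC `|g e|); nra.
  rewrite IZ; last by apply: L1_norm; apply: L1_Qker.
  by rewrite mulrC ler_wpM2r// I_normQker.
have [E _ _] := I_fubini mF F1 F2 l1 Fg.
have -> : hart (Q f g) x = I (fun z => I (F ^~ z)).
  apply: eq_I => z; rewrite /Q mulrC -(IZ _ (q1 z)) -(IZ _ (L1_Z _ (q1 z))).
  by apply: eq_I => e; rewrite /F mulrC.
rewrite -E mulrC.
have -> : hart g x * hart f x = I (fun e => hart f x * (g e * cas (x * e))).
  by rewrite IZ; [rewrite mulrC|exact: L1_hcas].
apply: eq_I => e; rewrite FE (IZ _ (lk e)).
suff -> : I (fun z => Qker f z e * cas (x * z)) = 2 * (hart f x * cas (x * e)) by field.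
have c1 := L1_hcas x f1.
have l2 := L1_hcas x (L1_shift e f1).
have l3 := L1_hcas x (L1_refl e f1).
have l4 := L1_hcas x (L1_shift (- e) f1).
have l5 := L1_hcas x (L1_refl (- e) f1).
have gen (u : R -> R) : continuous u -> L1 (fun k => f k * cas (x * u k)).
  move=> cu; apply: L1_Mbounded f1; last by move=> k; exact: cas_le2.
  by apply: cont_meas; apply: cont_cas; cont.
have G1 : L1 (fun k => f k * cas (x * (k - e))) by apply: gen; cont.
have G2 : L1 (fun k => f k * cas (x * (e - k))) by apply: gen; cont.
have G3 : L1 (fun k => f k * cas (x * (k + e))) by apply: gen; cont.
have G4 : L1 (fun k => f k * cas (x * (- e - k))) by apply: gen; cont.
have -> : I (fun z => Qker f z e * cas (x * z)) =
  (I (fun z => f (z + e) * cas (x * z)) + I (fun z => f (e - z) * cas (x * z)))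
  + (I (fun z => f (z - e) * cas (x * z)) - I (fun z => f (- e - z) * cas (x * z))).
  rewrite -(ID l2 l3) -(IB l4 l5) -(ID (L1_D l2 l3) (L1_B l4 l5)).
  by apply: eq_I => z; rewrite /Qker (addrC (- z) (- e)); ring.
have E1 : I (fun z => f (z + e) * cas (x * z)) = I (fun k => f k * cas (x * (k - e))).
  by rewrite -(I_shift e G1); apply: eq_I => z; rewrite addrK.
have E2 : I (fun z => f (e - z) * cas (x * z)) = I (fun k => f k * cas (x * (e - k))).
  by rewrite -(I_refl e G2); apply: eq_I => z; rewrite subKr.
have E3 : I (fun z => f (z - e) * cas (x * z)) = I (fun k => f k * cas (x * (k + e))).
  by rewrite -(I_shift (- e) G3); apply: eq_I => z; rewrite subrK.
have E4 : I (fun z => f (- e - z) * cas (x * z)) = I (fun k => f k * cas (x * (- e - k))).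
  by rewrite -(I_refl (- e) G4); apply: eq_I => z; rewrite subKr.
rewrite E1 E2 E3 E4 -(ID G1 G2) -(IB G3 G4) -(ID (L1_D G1 G2) (L1_B G3 G4)).
rewrite (mulrC (hart f x)) mulrA -(IZ _ c1); apply: eq_I => k.
have e1 : x * (k - e) = x * k - x * e by ring.
have e2 : x * (e - k) = x * e - x * k by ring.
have e3 : x * (k + e) = x * k + x * e by ring.
have e4 : x * (- e - k) = - (x * k + x * e) by ring.
rewrite e1 e2 e3 e4.
transitivity (2 * (f k * (cas (x * k) * cas (x * e)))); last by ring.
by rewrite cas_cas; field.
Qed.

End hartley_calculus.

(** * The principal value integral *)

Section hilbert.
Context {R : realType}.
Notation mu := (@lebesgue_measure R).
Implicit Types (f g h b : R -> R) (x y e k z d : R).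

(** The inverse is the pointwise limit of the continuous functions [z / (z^2 + 1 / (n + 1))], also
    at [z = 0], where the convention [0^-1 = 0] agrees with the limit. *)
Lemma measurable_inv : measurable_fun setT (fun z : R => z^-1).
Proof.
pose F (n : nat) z := z / (z ^+ 2 + (n.+1%:R)^-1).
have pos (n : nat) z : 0 < z ^+ 2 + (n.+1%:R)^-1.
  by apply: ltr_wpDl; rewrite ?sqr_ge0// invr_gt0.
apply: (measurable_fun_cvg (h := F)) => //.
  move=> n; apply: cont_meas; apply: cont_M; first by cont.
  apply: cont_V; first by cont.
  by move=> z; rewrite gt_eqF.
move=> z _; have [->|z0] := eqVneq z 0.
  by rewrite invr0; apply: cvg_near_cst; apply: nearW => n; rewrite /F mul0r.
have -> : z^-1 = z / (z ^+ 2 + 0) by rewrite addr0 expr2 invfM mulrA divff// mul1r.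
apply: cvgM; first exact: cvg_cst.
apply: cvgV; first by rewrite addr0 expf_neq0.
by apply: cvgD; [exact: cvg_cst|exact: cvg_harmonic].
Qed.

Lemma L1_oneDsqrV : L1 (fun z : R => (1 + z ^+ 2)^-1).
Proof.
have pos z : 0 < 1 + z ^+ 2 by rewrite ltr_pwDl// sqr_ge0.
have c : continuous (fun z : R => (1 + z ^+ 2)^-1).
  by apply: cont_V; [cont|move=> z; rewrite gt_eqF].
apply: (@L1P _ _ pi); first exact: cont_meas.
under eq_integral do rewrite ger0_norm ?invr_ge0 ?ltW//.
rewrite ge0_symfun_integralT//=; last 2 first.
- by move=> x; rewrite invr_ge0 ltW.
- by move=> x /=; rewrite sqrrN.
rewrite (_ : [set x | _] = `[0, +oo[%classic); last first.
  by apply/seteqP; split => x/=; rewrite in_itv/= andbT.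
rewrite (_ : (\int[mu]_(x in _) _)%E = (pi / 2)%:E); last first.
  by rewrite -(@integral0y_oneDsqr R).
by rewrite -EFinM lee_fin mulrC divfK.
Qed.

(** The value at [z = 0] is the limit, so that [sinc z] is for every [z] the primitive of
    [cos (z * k)] in [k] that vanishes at [0]. *)
Definition sinc z k := if z == 0 then k else sin (z * k) / z.

Lemma measurable_sinc k : measurable_fun setT (fun z => sinc z k).
Proof.
apply: measurable_fun_ifT => //.
  by apply: measurable_fun_eqr.
apply: measurable_funM; last exact: measurable_inv.
by apply: cont_meas; cont.
Qed.

Lemma isd_sinc z k : is_derive k 1 (sinc z) (cos (z * k)).
Proof.
rewrite /sinc; have [->|z0] := eqVneq z 0.
  by rewrite mul0r cos0; exact: (isd_id k).
apply: isd_eq; [isd|]; rewrite /=; field; exact: z0.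
Qed.

Lemma sinc0 z : sinc z 0 = 0.
Proof. by rewrite /sinc mulr0 sin0 mul0r if_same. Qed.

Lemma sinc_le z k : `|sinc z k| <= `|k|.
Proof.
have pos y : 0 <= y -> `|sinc z y| <= y.
  move=> y0; have := @derive_norm_le R (sinc z) (fun y => y) (fun k => cos (z * k)) (fun=> 1) 0 y y0.
  rewrite sinc0 !subr0; apply.
  - by move=> x _; apply: (isd_cont_at (a := cos (z * x))); exact: isd_sinc.
  - by move=> x _; exact: cont_id.
  - by move=> x _; exact: isd_sinc.
  - by move=> x _; exact: cos_max.
have [k0|k0] := leP 0 k; first by rewrite (ger0_norm k0) pos.
rewrite (ltr0_norm k0) (_ : sinc z k = - sinc z (- k)) ?normrN ?pos ?oppr_ge0 ?ltW//.
by rewrite /sinc; case: ifP => _; rewrite ?opprK// mulrN sinN mulNr opprK.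
Qed.

(* Gaussian regularization of the integral of [sin (z k) / z], whose value is [pi * sg k]. *)
Definition J d k := I (fun z => gau d z * sinc z k).

Lemma L1_gausinc d k : 0 < d -> L1 (fun z => gau d z * sinc z k).
Proof.
move=> d0; apply: (L1_Mbounded (M := `|k|)); last exact: L1_gau.
- exact: measurable_sinc.
- by move=> z; exact: sinc_le.
Qed.

Lemma J_scale d k : 0 < d -> J d k = J 1 (k / Num.sqrt d).
Proof.
move=> d0; have s0 : Num.sqrt d != 0 by rewrite gt_eqF// sqrtr_gt0.
rewrite /J (I_affine 0 s0 (L1_gausinc (k / Num.sqrt d) ltr01)) ger0_norm ?sqrtr_ge0//.
rewrite -IZ; last first.
  have := L1_affine 0 s0 (L1_gausinc (k / Num.sqrt d) ltr01); exact.
apply: eq_I => z; rewrite addr0 gau_sqrt ?ltW// mulrCA; congr (_ * _).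
rewrite /sinc mulf_eq0 (negbTE s0) /=; have [_|z0] := eqVneq z 0.
  by field.
rewrite (_ : Num.sqrt d * z * (k / Num.sqrt d) = z * k); last by field.
by field; rewrite ?s0 ?z0.
Qed.

Lemma I_gaucos d k : 0 < d -> I (fun z => gau d z * cos (z * k)) = kern d k.
Proof.
move=> d0; rewrite -(I_gaucas k d0).
have l1 : L1 (fun z => gau d z * cos (z * k)).
  apply: (L1_Mbounded (M := 1)); last exact: L1_gau.
    by apply: cont_meas; cont.
  by move=> z; exact: cos_max.
have l2 : L1 (fun z => gau d z * sin (z * k)).
  apply: (L1_Mbounded (M := 1)); last exact: L1_gau.
    by apply: cont_meas; cont.
  by move=> z; exact: sin_max.
rewrite -[LHS]addr0 -(_ : I (fun z => gau d z * sin (z * k)) = 0); last first.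
  by apply: I_odd => // z; rewrite gauN mulNr sinN mulrN.
by rewrite -(ID l1 l2); apply: eq_I => z; rewrite mulrDr.
Qed.

Lemma isd_J k : is_derive k 1 (J 1) (kern 1 k).
Proof.
rewrite -(I_gaucos k ltr01).
apply: (@I_is_derive R (fun k z => gau 1 z * sinc z k)
  (fun k z => gau 1 z * cos (z * k)) (@gau R 1) (k - 1) (k + 1)).
- lra.
- by move=> y _; exact: L1_gausinc.
- move=> y z _; apply: isd_eq; [apply: isd_M; [apply: isd_cst|apply: isd_sinc]|].
  by rewrite /= mulr0 addr0.
- move=> y z _; rewrite normrM ger0_norm ?gau_ge0// -[leRHS]mulr1.
  by rewrite ler_wpM2l ?gau_ge0// cos_max.
- exact: L1_gau1.
Qed.

Lemma JN d k : 0 < d -> J d (- k) = - J d k.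
Proof.
move=> d0; rewrite /J -[RHS]mulN1r -IZ; last exact: L1_gausinc.
apply: eq_I => z; rewrite mulN1r -mulrN; congr (_ * _).
by rewrite /sinc; case: ifP => // _; rewrite mulrN sinN mulNr.
Qed.

(** [J 1] is an odd primitive of [kern 1], whose total mass is [2 * pi]; each half-line carries half
    of it. *)
Lemma cvg_J1 : J 1 n%:R @[n --> \oo] --> (pi : R).
Proof.
have H := I_setT_lim (@L1_kern R 1 ltr01).
have K : I (@kern R 1) = 2 * pi.
  by rewrite -(I_kern 0 (@ltr01 R)); apply: eq_I => z; rewrite subr0.
rewrite K in H.
rewrite (_ : pi = 2^-1 * (2 * pi)); last by rewrite mulKf.
have : (2^-1 : R) * Rintegral mu `[- n%:R, n%:R] (@kern R 1) @[n --> \oo] --> 2^-1 * (2 * pi : R).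
  by apply: cvgM; [exact: cvg_cst|exact: H].
apply: cvg_trans; apply: near_eq_cvg.
near=> n.
have n0 : (0 : R) < n%:R by rewrite ltr0n; near: n; exists 1%N.
have nn : - n%:R < n%:R :> R by lra.
have cJ : continuous (J 1) by apply: (isd_cont (df := @kern R 1)) => x; exact: isd_J.
have ck : continuous (@kern R 1).
  by move=> z; refine (@cont_kern R 1 (fun x => x) (@cont_id R) z).
rewrite /Rintegral (@continuous_FTC2 _ (@kern R 1) (J 1) _ _ nn).
- by rewrite /= JN// opprK; field.
- exact: continuous_subspaceT.
- split.
  + by move=> x _; have ? := isd_J x; apply: ex_derive.
  + exact/cvg_at_right_filter/cJ.
  + exact/cvg_at_left_filter/cJ.
- by move=> x _; have ? := isd_J x; rewrite derive1E derive_val.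
Unshelve. all: by end_near. Qed.

Lemma J1_mono x y : x <= y -> J 1 x <= J 1 y.
Proof.
move=> xy; have cJ : continuous (J 1).
  by apply: (isd_cont (df := @kern R 1)) => z; exact: isd_J.
have := @derive_mono R (fun=> 0) (J 1) (fun=> 0) (@kern R 1) x y xy (fun x _ => @cont_cst R 0 x) (fun x _ => cJ x).
rewrite subrr subr_ge0; apply.
- by move=> z _; exact: isd_J.
- by move=> z _; exact: kern_ge0.
Qed.

Lemma J1_0 : J 1 0 = 0.
Proof.
rewrite /J (_ : (fun z => _) = (fun=> 0)); last by apply/funext => z; rewrite sinc0 mulr0.
by rewrite /I /Rintegral integral0.
Qed.

Lemma J1_le_pi x : `|J 1 x| <= pi.
Proof.
have pos y : 0 <= y -> `|J 1 y| <= pi.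
  move=> y0; rewrite ger0_norm; last by rewrite -J1_0; exact: J1_mono.
  rewrite -(cvg_lim _ cvg_J1)//; apply: limr_ge; first by apply/cvg_ex; exists pi; exact: cvg_J1.
  near=> n; apply: J1_mono.
  by near: n; apply: nbhs_infty_ger.
have [x0|x0] := leP 0 x; first exact: pos.
by rewrite -(opprK x) JN// normrN pos// oppr_ge0 ltW.
Unshelve. all: by end_near. Qed.

(** By [J_scale], removing the regularization sends the argument of [J 1] to infinity, with the sign
    of [k]. *)
Lemma cvg_J k : J (n.+1%:R)^-1 k @[n --> \oo] --> pi * Num.sg k.
Proof.
have en0 (n : nat) : (0 : R) < (n.+1%:R)^-1 by rewrite invr_gt0.
have posk y : 0 < y -> J (n.+1%:R)^-1 y @[n --> \oo] --> pi.
  move=> y0; apply/cvgrPdist_le => eps eps0.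
  have /cvgrPdist_le /(_ _ eps0) [m _ hm] := cvg_J1.
  near=> n.
  have hn : J 1 m%:R <= J (n.+1%:R)^-1 y.
    rewrite (J_scale y (en0 n)); apply: J1_mono.
    rewrite sqrtrV// invrK mulrC -ler_pdivrMr//.
    have h0 : 0 <= m%:R / y by rewrite divr_ge0// ltW.
    rewrite -[leLHS](ger0_norm h0) -sqrtr_sqr ler_wsqrtr//.
    apply: (@le_trans _ _ n%:R); last by rewrite ler_nat.
    by near: n; apply: nbhs_infty_ger.
  have h1 := hm m (leqnn m).
  have h2 : J (n.+1%:R)^-1 y <= pi by rewrite (J_scale y (en0 n)); apply: (le_trans (ler_norm _)); exact: J1_le_pi.
  rewrite ger0_norm ?subr_ge0//; apply: le_trans h1; apply: le_trans (ler_norm _).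
  by rewrite lerB.
have [k0|k0|<-] := ltgtP 0 k.
- by rewrite gtr0_sg// mulr1; apply: posk.
- rewrite ltr0_sg// mulrN1.
  have nk0 : 0 < - k by rewrite oppr_gt0.
  have : - J (n.+1%:R)^-1 (- k) @[n --> \oo] --> - (pi : R) by apply: cvgN; exact: posk.
  by apply: cvg_trans; apply: near_eq_cvg; apply: nearW => n; rewrite -(JN (- k) (en0 n)) opprK.
- rewrite sgr0 mulr0; apply: cvg_near_cst; apply: nearW => n.
  by rewrite (J_scale 0 (en0 n)) mul0r J1_0.
Unshelve. all: by end_near. Qed.

End hilbert.

(** * The Hilbert transform of a Hartley integral *)

Section hilbert_pv.
Context {R : realType}.
Notation mu := (@lebesgue_measure R).
Implicit Types (f g h b : R -> R) (x y e k z d : R).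

Lemma L1_indic_itv (a b : R) : L1 (\1_`[a, b]).
Proof. exact: integrable_indic_itv. Qed.

Lemma I_indic_itv (a b : R) : a <= b -> I \1_`[a, b] = b - a.
Proof.
move=> ab; rewrite /I /Rintegral integral_indic// setIT.
have E : lebesgue_measure (`[a, b]%classic : set R) = (b - a)%:E.
  rewrite lebesgue_measure_itv/= lte_fin.
  by case: ltgtP ab => // -> _; rewrite subrr.
by rewrite -[RHS]/(fine (b - a)%:E) -E.
Qed.

(** The truncated kernel of the principal value in the variable [z = x - y]. *)
Definition cut e z := if e < `|z| then z^-1 else 0.

Lemma measurable_cut e : measurable_fun setT (cut e).
Proof.
apply: measurable_fun_ifT => //; last exact: measurable_inv.
by apply: measurable_fun_ltr => //; exact: cont_meas (cont_norm (@cont_id R)).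
Qed.

Lemma cut_le e z : 0 < e -> `|cut e z| <= e^-1.
Proof.
move=> e0; rewrite /cut; case: ltP => h; last by rewrite normr0 invr_ge0 ltW.
by rewrite normfV lef_pV2 ?posrE ?ltW// (lt_trans e0).
Qed.

Lemma cutN e z : cut e (- z) = - cut e z.
Proof. by rewrite /cut normrN; case: ifP => _; rewrite ?oppr0// invrN. Qed.

Lemma cut_sqr_le e z : 0 < e -> cut e z ^+ 2 <= (1 + e ^- 2) * (1 + z ^+ 2)^-1.
Proof.
move=> e0; have p z' : 0 < 1 + z' ^+ 2 :> R by rewrite ltr_pwDl// sqr_ge0.
rewrite /cut; case: ltP => h; last first.
  rewrite expr0n; apply: mulr_ge0; last by rewrite invr_ge0 ltW.
  by rewrite addr_ge0// invr_ge0 sqr_ge0.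
have z0 : z != 0 by rewrite -normr_gt0 (lt_trans e0).
have z2 : 0 < z ^+ 2 by rewrite exprn_even_gt0.
have h2 : e ^+ 2 <= z ^+ 2.
  by rewrite -(real_normK (num_real z)); apply: lerXn2r; rewrite ?nnegrE// ltW.
have e2 : 0 < e ^+ 2 by rewrite exprn_gt0.
have h3 : z ^- 2 <= e ^- 2 by rewrite lef_pV2 ?posrE.
have h4 : z ^- 2 * z ^+ 2 = 1 by rewrite mulVf ?gt_eqF.
by rewrite ler_pdivlMr// exprVn mulrDr mulr1 h4 addrC lerD2l.
Qed.

Lemma sinc_cut e z k : 0 < e ->
  `|sinc z k - sin (z * k) * cut e z| <= `|k| * \1_`[- e, e] z.
Proof.
move=> e0; rewrite /cut indicE; case: ltP => h.
  have z0 : z != 0 by rewrite -normr_gt0 (lt_trans e0).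
  by rewrite /sinc (negbTE z0) subrr normr0 mulr_ge0.
rewrite mulr0 subr0 mem_set ?mulr1; first exact: sinc_le.
by rewrite /= in_itv/= -ler_norml.
Qed.

Lemma hart_sqr_L1 f M : continuous f -> (forall k, `|f k| <= M) -> L1 f ->
  L1 (fun x => hart f x ^+ 2).
Proof.
move=> cf fM f1; have cH := cont_hart f1.
apply/integrableP; split.
  by apply/measurable_EFinP; apply: cont_meas; cont.
under eq_integral do rewrite /= ger0_norm ?sqr_ge0//.
exact: hart_L2 cf fM f1.
Qed.

(** Both factors are square integrable, and their product is dominated by the sum of their
    squares. *)
Lemma L1_hart_cut f M e x : 0 < e -> continuous f -> (forall k, `|f k| <= M) -> L1 f ->
  L1 (fun z => hart f (x - z) * cut e z).
Proof.
move=> e0 cf fM f1.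
apply: (L1_le (g := fun z => hart f (x - z) ^+ 2 + (1 + e ^- 2) * (1 + z ^+ 2)^-1)).
- apply: measurable_funM; last exact: measurable_cut.
  by apply: cont_meas; apply: (cont_comp (h := hart f)); [exact: cont_hart|cont].
- move=> z; rewrite normrM; have := cut_sqr_le z e0.
  rewrite -(real_normK (num_real (cut e z))) -(real_normK (num_real (hart f (x - z)))).
  set a := `|hart _ _|; set b := `|cut _ _|; have := sqr_ge0 (a - b); rewrite sqrrB.
  have : 0 <= a * b by rewrite mulr_ge0 /a /b.
  by rewrite -mulr_natr; lra.
- apply: L1_D; last exact/L1_Z/L1_oneDsqrV.
  exact: L1_refl (hart_sqr_L1 cf fM f1).
Qed.

Lemma meas2_cas_sub x : measurable_fun setT (fun p : R * R => cas ((x - p.1) * p.2)).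
Proof.
have c : continuous (@cas R) by exact: (cont_cas (@cont_id R)).
apply: (measurableT_comp (cont_meas c)); apply: measurable_funM => //.
exact: measurable_funB.
Qed.

Lemma L1_cutgau e d : 0 < e -> 0 < d -> L1 (fun z => cut e z * gau d z).
Proof.
move=> e0 d0; apply: (L1_mull (M := e^-1)); last exact: L1_gau.
  exact: measurable_cut.
by move=> z; exact: cut_le.
Qed.

(** In the expansion of [cas (x * k - z * k)] the cosine of [z * k] meets the odd function [cut e]
    and integrates to zero. *)
Lemma I_cut_cas e d x k : 0 < e -> 0 < d ->
  I (fun z => cas ((x - z) * k) * (cut e z * gau d z)) =
  - (cas (- (x * k)) * I (fun z => sin (z * k) * (cut e z * gau d z))).
Proof.
move=> e0 d0; have l := L1_cutgau e0 d0.
have l1 : L1 (fun z => cos (z * k) * (cut e z * gau d z)).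
  apply: (L1_mull (M := 1)) => //; first by apply: cont_meas; cont.
  by move=> z; exact: cos_max.
have l2 : L1 (fun z => sin (z * k) * (cut e z * gau d z)).
  apply: (L1_mull (M := 1)) => //; first by apply: cont_meas; cont.
  by move=> z; exact: sin_max.
have o : I (fun z => cos (z * k) * (cut e z * gau d z)) = 0.
  by apply: I_odd => // z; rewrite mulNr cosN cutN gauN mulNr mulrN.
rewrite -[LHS]subr0 -(mulr0 (cas (x * k))) -o -(IZ _ l1) -(IZ _ l2).
rewrite -[RHS]mulN1r -(IZ _ (L1_Z _ l2)).
have l3 : L1 (fun z => cas ((x - z) * k) * (cut e z * gau d z)).
  apply: (L1_mull (M := 2)) => //.
    by apply: cont_meas; apply: cont_cas; cont.
  by move=> z; exact: cas_le2.
rewrite -(IB l3 (L1_Z _ l1)); apply: eq_I => z.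
by rewrite mulrBl cas_B; ring.
Qed.

Section pv.
Variables (f : R -> R) (M x : R).
Hypotheses (cf : continuous f) (fM : forall k, `|f k| <= M) (f1 : L1 f)
  (kf1 : L1 (fun k => k * f k)).

Let V := I (fun k => f k * cas (- (x * k)) * Num.sg k).
Let C := I (fun k => `|k * f k|).
Let dn (n : nat) : R := (n.+1%:R)^-1.
Let dn0 n : 0 < dn n. Proof. by rewrite invr_gt0. Qed.

Let lfc : L1 (fun k => f k * cas (- (x * k))).
Proof.
apply: (L1_Mbounded (M := 2)) => //; first by apply: cont_meas; apply: cont_cas; cont.
by move=> k; exact: cas_le2.
Qed.

Let cont_J d : 0 < d -> continuous (J d).
Proof.
move=> d0; have c1 : continuous (@J R 1) := isd_cont (@isd_J R).
rewrite (_ : J d = fun k => J 1 ((Num.sqrt d)^-1 * k)).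
  by apply: (cont_comp (h := J 1)) => //; cont.
by apply/funext => k; rewrite J_scale// mulrC.
Qed.

Let J_le d k : 0 < d -> `|J d k| <= pi.
Proof. by move=> d0; rewrite J_scale//; exact: J1_le_pi. Qed.

Let cvgV : L1 (fun k => f k * cas (- (x * k)) * Num.sg k) /\
  I (fun k => f k * cas (- (x * k)) * J (dn n) k) @[n --> \oo] --> pi * V.
Proof.
have [||||H1 H2] := @I_cvg R (fun n k => f k * cas (- (x * k)) * J (dn n) k)
  (fun k => f k * cas (- (x * k)) * (pi * Num.sg k)) (fun k => pi * `|f k * cas (- (x * k))|).
- move=> n; apply: measurable_funM; first exact: L1_measurable lfc.
  by apply: cont_meas; exact: cont_J.
- by apply: L1_Z; exact: L1_norm.
- by move=> n k; rewrite normrM mulrC ler_wpM2r// J_le.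
- by move=> k; apply: cvgM; [exact: cvg_cst|exact: cvg_J].
have p0 : (pi : R) != 0 by rewrite gt_eqF// pi_gt0.
have lV : L1 (fun k => f k * cas (- (x * k)) * Num.sg k).
  have H3 := L1_Z (pi^-1) H1.
  rewrite (_ : (fun k => _) =
    (fun k => pi^-1 * (f k * cas (- (x * k)) * (pi * Num.sg k))))//.
  by apply/funext => k; rewrite mulrCA mulKf.
split=> //; rewrite -(IZ _ lV).
by rewrite (_ : (fun x0 => _) = (fun k => f k * cas (- (x * k)) * (pi * Num.sg k)))//;
  apply/funext => k; rewrite mulrCA.
Qed.

(** The Gaussian factor makes Fubini available. Replacing the truncated sine integral by [J d k]
    costs at most the integral of [|k|] over [[- e, e]], that is [2 * e * |k|]; the other factor [2]
    bounds [cas]. The error does not depend on [d]. *)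
Let pv_reg e d : 0 < e -> 0 < d ->
  `|I (fun z => hart f (x - z) * cut e z * gau d z)
    + I (fun k => f k * cas (- (x * k)) * J d k)| <= 4 * e * C.
Proof.
move=> e0 d0.
have [E _ l1] := @I_swap R f (fun z => cut e z * gau d z) (fun z k => cas ((x - z) * k)) 2
  f1 (L1_cutgau e0 d0) (meas2_cas_sub x) (fun z k => cas_le2 _).
have lJ : L1 (fun k => f k * cas (- (x * k)) * J d k).
  apply: (L1_Mbounded (M := pi)) => //; first by apply: cont_meas; exact: cont_J.
  by move=> k; exact: J_le.
have -> : I (fun z => hart f (x - z) * cut e z * gau d z) =
    I (fun k => f k * I (fun z => cas ((x - z) * k) * (cut e z * gau d z))).
  by rewrite -E; apply: eq_I => z; rewrite mulrA.
rewrite -(ID l1 lJ).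
have lC : L1 (fun k => `|k * f k|) by exact: L1_norm.
rewrite /C -(IZ _ lC); apply: I_norm_le; [|exact: L1_Z|].
  exact: L1_measurable (L1_D l1 lJ).
move=> k; rewrite (I_cut_cas x k e0 d0).
set s := I (fun z => sin (z * k) * _).
rewrite (_ : _ + _ = f k * (J d k - s) * cas (- (x * k))); last by ring.
apply: (le_trans (mulcas_le _ _)).
rewrite (_ : 4 * e * _ = 2 * (`|f k| * (2 * e * `|k|))); last by rewrite normrM; ring.
rewrite ler_wpM2l// normrM ler_wpM2l//.
have lg := L1_gausinc k d0.
have ls : L1 (fun z => sin (z * k) * (cut e z * gau d z)).
  apply: (L1_mull (M := 1)); first by apply: cont_meas; cont.
    by move=> z; exact: sin_max.
  exact: L1_cutgau.
rewrite /J /s -(IB lg ls).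
have li := L1_indic_itv (- e) e.
rewrite (_ : 2 * e * `|k| = I (fun z => `|k| * \1_`[- e, e] z)); last first.
  by rewrite (IZ _ li) I_indic_itv; [ring|lra].
apply: I_norm_le; [exact: L1_measurable (L1_B lg ls)|exact: L1_Z|].
move=> z; rewrite (_ : _ - _ = gau d z * (sinc z k - sin (z * k) * cut e z)); last by ring.
rewrite normrM ger0_norm ?gau_ge0//.
apply: (@le_trans _ _ (1 * `|sinc z k - sin (z * k) * cut e z|)).
  by rewrite ler_wpM2r// gau_le1// ltW.
by rewrite mul1r; exact: sinc_cut.
Qed.

(** Dominated convergence in [d] on both terms of [pv_reg]; the error stays linear in [e], which
    gives the principal value. *)
Let pv_bound e : 0 < e ->
  `|I (fun z => hart f (x - z) * cut e z) + pi * V| <= 4 * e * C.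
Proof.
move=> e0; have [lV cV] := cvgV.
have lF := L1_hart_cut x e0 cf fM f1.
have [||||_ cF] := @I_cvg R (fun n z => hart f (x - z) * cut e z * gau (dn n) z)
   (fun z => hart f (x - z) * cut e z) (fun z => `|hart f (x - z) * cut e z|).
- move=> n; apply: measurable_funM; first exact: L1_measurable lF.
  by apply: cont_meas; apply: cont_gau; cont.
- exact: L1_norm.
- move=> n z; rewrite normrM (ger0_norm (gau_ge0 _ _)) ler_piMr//.
  by rewrite gau_le1// ltW.
- move=> z; rewrite -[X in _ --> X]mulr1; apply: cvgM; first exact: cvg_cst.
  rewrite -expR0; apply: (@continuous_cvg _ _ _ _ _ _ expR); first exact: continuous_expR.
  rewrite -oppr0 -(mul0r (z ^+ 2)); apply: cvgN; apply: cvgM; last exact: cvg_cst.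
  exact: cvg_harmonic.
have H : `|I (fun z => hart f (x - z) * cut e z * gau (dn n) z)
    + I (fun k => f k * cas (- (x * k)) * J (dn n) k)| @[n --> \oo] -->
    `|I (fun z => hart f (x - z) * cut e z) + pi * V|.
  by apply: cvg_norm; apply: cvgD; [exact: cF|exact: cV].
rewrite -(cvg_lim _ H)//; apply: limr_le; first by apply/cvg_ex; eexists; exact: H.
by apply: nearW => n; exact: pv_reg.
Qed.

Lemma hilbert_pv_hart : hilbert_pv (hart f) x (- V).
Proof.
have p0 : (0 : R) < pi by exact: pi_gt0.
have C0 : 0 <= C by exact: I_ge0.
apply/cvgrPdist_le => eps eps0.
have h2 : 0 < 4 * C + 1 by rewrite ltr_wpDl// mulr_ge0.
have h5 : 0 < pi * eps / (4 * C + 1).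
  by apply: divr_gt0 h2; exact: mulr_gt0.
near=> e.
have e0 : 0 < e by [].
have -> : Rintegral mu [set y | e < `|x - y|] (fun y => hart f y / (x - y)) =
    I (fun z => hart f (x - z) * cut e z).
  rewrite Rintegral_mkcond -(I_refl x (L1_hart_cut x e0 cf fM f1)).
  apply: eq_I => y; rewrite subKr patchE /cut; case: ifPn.
    by rewrite inE /= => ->.
  by move=> /negP h; case: ifP => h'; [exfalso; apply: h; rewrite inE|rewrite mulr0].
have := pv_bound e0; set T := I _ => hT.
rewrite (_ : - V - _ = - (pi^-1 * (T + pi * V))); last first.
  by rewrite mulrDr mulKf ?gt_eqF//; ring.
have pi0 : 0 <= (pi : R)^-1 by rewrite invr_ge0 ltW.
rewrite normrN normrM (ger0_norm pi0).
rewrite ler_pdivrMl//; apply: (le_trans hT).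
have : e <= pi * eps / (4 * C + 1).
  by near: e; apply: nbhs_right_le; exact: h5.
rewrite ler_pdivlMr// => h3; apply: le_trans h3.
by rewrite (_ : 4 * e * C = e * (4 * C)); [lra|ring].
Unshelve. all: by end_near. Qed.
End pv.

End hilbert_pv.

(** * Existence by iteration *)

Section limits.
Context {R : realType}.
Notation mu := (@lebesgue_measure R).
Implicit Types (f g h b : R -> R) (x y e k z d t : R).

Lemma cvg_half (c : R) : c * 2^-1 ^+ n @[n --> \oo] --> (0 : R).
Proof.
rewrite -(mulr0 c); apply: cvgM; first exact: cvg_cst.
by apply: cvg_expr; rewrite ger0_norm ?invr_ge0// invf_lt1// ltr1n.
Qed.

(** Adding or subtracting the geometric tail still to come makes the sequence decreasing or
    increasing. The two modified sequences bracket the limit, and this bracket is the error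
    bound. *)
Lemma geom_cvg (u : nat -> R) (c : R) :
  (forall n, `|u n.+1 - u n| <= c * 2^-1 ^+ n) ->
  u n @[n --> \oo] --> limn u /\ forall n, `|limn u - u n| <= 2 * c * 2^-1 ^+ n.
Proof.
move=> h.
pose a n := u n + 2 * c * 2^-1 ^+ n; pose b n := u n - 2 * c * 2^-1 ^+ n.
have step n : 2 * c * 2^-1 ^+ n.+1 = c * 2^-1 ^+ n :> R.
  by rewrite exprS mulrA mulrAC -mulrA; field.
have hn n : - (c * 2^-1 ^+ n) <= u n.+1 - u n <= c * 2^-1 ^+ n by rewrite -ler_norml.
have c0 : 0 <= c by have := le_trans (normr_ge0 _) (h 0%N); rewrite expr0 mulr1.
have q0 n : 0 <= 2 * c * 2^-1 ^+ n by rewrite !mulr_ge0// exprn_ge0// invr_ge0.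
have da : nonincreasing_seq a.
  apply/nonincreasing_seqP => n; rewrite /a step.
  have /andP[_] := hn n; set q := 2^-1 ^+ n; rewrite -mulrA; lra.
have db : nondecreasing_seq b.
  apply/nondecreasing_seqP => n; rewrite /b step.
  have /andP[+ _] := hn n; set q := 2^-1 ^+ n; rewrite -mulrA; lra.
have ab n : b n <= a n by rewrite /a /b; have := q0 n; lra.
have ca : cvgn a.
  apply: nonincreasing_is_cvgn => //; exists (b 0%N) => _ [n _ <-].
  by apply: le_trans (ab n); apply: db.
have cu : u n @[n --> \oo] --> limn a.
  rewrite -[X in _ --> X]subr0 (_ : u = fun n => a n - 2 * c * 2^-1 ^+ n); last first.
    by apply/funext => n; rewrite /a addrK.
  by apply: cvgB; [exact: ca|exact: cvg_half].
have lu : limn u = limn a by apply: cvg_lim.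
rewrite lu; split => // n.
have cb : b n @[n --> \oo] --> limn a.
  rewrite -[X in _ --> X]subr0; apply: cvgB; [exact: cu|exact: cvg_half].
have h1 : limn a <= a n by apply: nonincreasing_cvgn_ge.
have h2 : b n <= limn a.
  rewrite -(cvg_lim _ cb)//; apply: nondecreasing_cvgn_le => //.
  by apply/cvg_ex; exists (limn a).
by rewrite ler_norml; rewrite /a in h1; rewrite /b in h2; apply/andP; split; lra.
Qed.

Lemma cont_unif_lim (un : nat -> R -> R) (u : R -> R) (c : R) :
  (forall n, continuous (un n)) -> (forall n x, `|u x - un n x| <= c * 2^-1 ^+ n) ->
  continuous u.
Proof.
move=> cun h x; apply/cvgrPdist_le => eps eps0.
have /cvgrPdist_le /(_ (eps / 3)) H := cvg_half c.
have e3 : 0 < eps / 3 by rewrite divr_gt0.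
have [m _ hm] := H e3.
have /cvgrPdist_le /(_ _ e3) := cun m x; apply: filterS => y hy.
have hm' : c * 2^-1 ^+ m <= eps / 3.
  by have := hm m (leqnn m); rewrite sub0r normrN => /(le_trans (ler_norm _)).
have h1 := h m x; have h2 := h m y.
rewrite (_ : u x - u y = (u x - un m x) + (un m x - un m y) - (u y - un m y)); last by ring.
apply: (le_trans (ler_normB _ _)).
have := ler_normD (u x - un m x) (un m x - un m y); lra.
Qed.

Lemma prim_cont_param (N : R -> R -> R) :
  (forall k, continuous (N ^~ k)) -> (forall t, continuous (N t)) ->
  (forall k0, exists C : R, forall t k, `|k - k0| < 1 -> `|N t k| <= C) ->
  forall x, continuous (fun k => prim (N ^~ k) x).
Proof.
move=> c1 c2 bd x k0; have [C hC] := bd k0.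
suff H y : {for k0, continuous (fun k => Rintegral mu `[-1, y] (N ^~ k))}.
  exact: (continuousB (H x) (H 0)).
have E z : `](k0 - 1), (k0 + 1)[%classic z -> `|z - k0| < 1.
  by rewrite /= in_itv/= => hz; rewrite ltr_norml; lra.
have bnd z : `](k0 - 1), (k0 + 1)[%classic z -> mu.-integrable `[-1, y] (EFin \o (N ^~ z)).
  move=> hz; apply: continuous_compact_integrable; first exact: segment_compact.
  exact: continuous_subspaceT.
apply: (@continuity_under_integral R _ _ mu (fun k t => N t k) `[-1, y] _
   (k0 - 1) (k0 + 1) bnd _ (fun=> C)) => //.
- apply: aeW => t _ z _; exact: c2.
- apply: continuous_compact_integrable; first exact: segment_compact.
  by apply: continuous_subspaceT; exact: cont_cst.
- by move=> z /E hz; apply: aeW => t _; apply: hC.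
- by rewrite inE /= in_itv/=; lra.
Qed.

(* Projection of the line onto [0, 1]: freezing time outside [0, 1] avoids subspace topologies. *)
Definition clamp t : R := (`|t| - `|t - 1| + 1) / 2.

Lemma clamp_itv t : 0 <= clamp t <= 1.
Proof.
rewrite /clamp; have := ler_dist_dist t (t - 1); rewrite subKr normr1 ler_norml.
by lra.
Qed.

Lemma clamp_id t : 0 <= t <= 1 -> clamp t = t.
Proof.
move=> /andP[h1 h2]; rewrite /clamp ger0_norm// ler0_norm ?subr_le0//; by field.
Qed.

Lemma cont_clamp : continuous clamp.
Proof. by rewrite /clamp; cont. Qed.
End limits.

(** * Weighted bounds for the quadratic term *)

Section Qbounds.
Context {R : realType}.
Implicit Types (f g h a b : R -> R) (x y e k z d t r : R).

Definition damp r k := expR (- (r * `|k|)).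

Lemma damp_ge0 r k : 0 <= damp r k. Proof. exact: expR_ge0. Qed.
Lemma dampN r k : damp r (- k) = damp r k. Proof. by rewrite /damp normrN. Qed.
Lemma damp_le1 r k : 0 <= r -> damp r k <= 1.
Proof. by move=> r0; rewrite /damp -expR0 ler_expR oppr_le0 mulr_ge0. Qed.
Lemma damp_le r r' k : r <= r' -> damp r' k <= damp r k.
Proof. by move=> h; rewrite /damp ler_expR lerN2 ler_wpM2r. Qed.

(** This is why exponential decay at rate [r] survives a convolution without loss. *)
Lemma damp_M r x y z : 0 <= r -> `|z| <= `|x| + `|y| -> damp r x * damp r y <= damp r z.
Proof.
by move=> r0 h; rewrite /damp -expRD ler_expR -opprD lerN2 -mulrDr ler_wpM2l.
Qed.

Variables (V : R -> R) (kap VM : R).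
Hypotheses (cV : continuous V) (V0 : forall k, 0 <= V k) (VN : forall k, V (- k) = V k)
  (VVM : forall k, V k <= VM) (V1 : L1 V)
  (Vconv : forall z, I (fun e => V (z - e) * V e) <= kap * V z).

(** The evenness of [V] folds the four translates of [Qker] into two. *)
Definition Qmaj z e := 2 * (V (z + e) * V e + V (z - e) * V e).

Let Vn k : `|V k| <= VM. Proof. by rewrite ger0_norm. Qed.

Lemma L1_Vconv z : L1 (fun e => V (z - e) * V e).
Proof.
apply: (L1_mull (M := VM)) => //.
by apply: cont_meas; apply: (cont_comp (h := V)) => //; cont.
Qed.

Lemma L1_Vconvr z : L1 (fun e => V (z + e) * V e).
Proof.
apply: (L1_mull (M := VM)) => //.
by apply: cont_meas; apply: (cont_comp (h := V)) => //; cont.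
Qed.

Lemma L1_Qmaj z : L1 (Qmaj z).
Proof. by apply: L1_Z; apply: L1_D; [exact: L1_Vconvr|exact: L1_Vconv]. Qed.

Lemma I_Qmaj z : I (Qmaj z) <= 4 * kap * V z.
Proof.
rewrite IZ; last by apply: L1_D; [exact: L1_Vconvr|exact: L1_Vconv].
rewrite (ID (L1_Vconvr z) (L1_Vconv z)).
have -> : I (fun e => V (z + e) * V e) = I (fun e => V (z - e) * V e).
  by rewrite -(I_opp (L1_Vconvr z)); apply: eq_I => e; rewrite VN.
by have := Vconv z; lra.
Qed.

Definition domby r c a := forall k, `|a k| <= c * (damp r k * V k).

Lemma Qker_dom r al be a b z e : 0 <= r -> domby r al a -> domby r be b ->
  0 <= al -> 0 <= be -> `|Qker a z e * b e| <= al * be * damp r z * Qmaj z e.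
Proof.
move=> r0 ha hb al0 be0.
have T y u : V y = u -> `|z| <= `|y| + `|e| ->
    `|a y * b e| <= al * be * damp r z * (u * V e).
  move=> <- hz; rewrite normrM.
  apply: (@le_trans _ _ ((al * (damp r y * V y)) * (be * (damp r e * V e)))).
    by apply: ler_pM.
  rewrite (_ : _ * _ = (damp r y * damp r e) * (al * be * (V y * V e))); last by ring.
  rewrite (_ : al * be * damp r z * _ = damp r z * (al * be * (V y * V e))); last by ring.
  by rewrite ler_wpM2r ?damp_M// !mulr_ge0.
have t1 := T (z + e) _ erefl; have t2 := T (e - z) (V (z - e)).
have t3 := T (z - e) _ erefl; have t4 := T (- z - e) (V (z + e)).
have {}t1 := t1 ltac:(have := ler_normB (z + e) e; rewrite addrK; lra).
have {}t2 := t2 ltac:(by rewrite -VN opprB)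
  ltac:(have := ler_normB e (e - z); rewrite subKr; lra).
have {}t3 := t3 ltac:(have := ler_normD (z - e) e; rewrite subrK; lra).
have {}t4 := t4 ltac:(by rewrite -VN opprB opprK addrC)
  ltac:(have := ler_normD (- z - e) e; rewrite subrK normrN; lra).
rewrite /Qker /Qmaj !(mulrDl, mulNr).
apply: (le_trans (ler_normB _ _)).
have := ler_normD (a (z + e) * b e + a (e - z) * b e) (a (z - e) * b e).
have := ler_normD (a (z + e) * b e) (a (e - z) * b e).
move: t1 t2 t3 t4; set X := al * be * damp r z; lra.
Qed.

Lemma domby_le r c a k : 0 <= r -> 0 <= c -> domby r c a -> `|a k| <= c * V k.
Proof.
move=> r0 c0 ha; apply: (le_trans (ha k)); rewrite ler_wpM2l// -[leRHS]mul1r.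
by rewrite ler_wpM2r// damp_le1.
Qed.

Lemma measurable_Qker a z : measurable_fun setT a -> measurable_fun setT (Qker a z).
Proof.
move=> ma; apply: measurable_funB; [apply: measurable_funD; [apply: measurable_funD|]|];
  apply: (measurableT_comp ma); apply: cont_meas; cont.
Qed.

Lemma L1_Qprod r al be a b z : 0 <= r -> domby r al a -> domby r be b ->
  0 <= al -> 0 <= be -> measurable_fun setT a -> measurable_fun setT b ->
  L1 (fun e => Qker a z e * b e).
Proof.
move=> r0 ha hb al0 be0 ma mb.
apply: (L1_le (g := fun e => al * be * damp r z * Qmaj z e)).
- by apply: measurable_funM => //; exact: measurable_Qker.
- by move=> e; exact: Qker_dom.
- by apply: L1_Z; exact: L1_Qmaj.
Qed.

(** [damp r z] leaves the integral by [damp_M], and the convolution hypothesis on [V] handles the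
    rest: four translates and the factor [2^-1] of [Q] make the constant [2]. *)
Lemma Q_bound r al be a b z : 0 <= r -> domby r al a -> domby r be b ->
  0 <= al -> 0 <= be -> measurable_fun setT a -> measurable_fun setT b ->
  `|Q a b z| <= 2 * al * be * kap * (damp r z * V z).
Proof.
move=> r0 ha hb al0 be0 ma mb.
rewrite /Q normrM ger0_norm ?invr_ge0//.
have h : `|I (fun e => Qker a z e * b e)| <= al * be * damp r z * (4 * kap * V z).
  apply: (@le_trans _ _ (I (fun e => al * be * damp r z * Qmaj z e))).
    apply: I_norm_le.
    - by apply: measurable_funM => //; exact: measurable_Qker.
    - by apply: L1_Z; exact: L1_Qmaj.
    - by move=> e; exact: Qker_dom.
  rewrite (IZ _ (L1_Qmaj z)) ler_wpM2l ?I_Qmaj//.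
  by rewrite !mulr_ge0// damp_ge0.
rewrite ler_pdivrMl//; apply: (le_trans h).
by apply: eq_le; ring.
Qed.

Lemma Q_diff r al de a b z : 0 <= r -> domby r al a -> domby r al b ->
  domby r de (fun k => a k - b k) -> 0 <= al -> 0 <= de ->
  measurable_fun setT a -> measurable_fun setT b ->
  `|Q a a z - Q b b z| <= 4 * al * de * kap * (damp r z * V z).
Proof.
move=> r0 ha hb hd al0 de0 ma mb.
have md : measurable_fun setT (fun k => a k - b k) by exact: measurable_funB.
(* Bilinearity of [Q] telescopes the difference of the two squares. *)
have E : Q a a z - Q b b z = Q (fun k => a k - b k) a z + Q b (fun k => a k - b k) z.
  have l1 := L1_Qprod z r0 hd ha de0 al0 md ma.
  have l2 := L1_Qprod z r0 hb hd al0 de0 mb md.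
  have l3 := L1_Qprod z r0 ha ha al0 al0 ma ma.
  have l4 := L1_Qprod z r0 hb hb al0 al0 mb mb.
  rewrite /Q -mulrBr -mulrDr -(IB l3 l4) -(ID l1 l2); congr (_ * _).
  by apply: eq_I => e; rewrite /Qker; ring.
have q1 := Q_bound z r0 hd ha de0 al0 md ma.
have q2 := Q_bound z r0 hb hd al0 de0 mb md.
rewrite E; apply: (le_trans (ler_normD _ _)); move: q1 q2.
rewrite (_ : 2 * de * al * kap * _ = 2 * (al * de * kap * (damp r z * V z))); last by ring.
rewrite (_ : 2 * al * de * kap * _ = 2 * (al * de * kap * (damp r z * V z))); last by ring.
rewrite (_ : 4 * al * de * kap * _ = 4 * (al * de * kap * (damp r z * V z))); last by ring.
set X := al * de * kap * _; lra.
Qed.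

Lemma cont_Q c a : 0 <= c -> continuous a -> domby 0 c a -> continuous (Q a a).
Proof.
move=> c0 ca ha; apply: cont_M; first by cont.
apply: (@I_continuous R _ (fun e => 4 * (c * VM) * (c * V e))).
- by move=> z; apply: measurable_funM; [apply: measurable_Qker|]; exact: cont_meas.
- by apply: L1_Z; apply: L1_Z.
- move=> z e; rewrite normrM.
  have hk k : `|a k| <= c * VM.
    by apply: (le_trans (domby_le k (lexx 0) c0 ha)); rewrite ler_wpM2l.
  have h4 : `|Qker a z e| <= 4 * (c * VM).
    rewrite /Qker; apply: (le_trans (ler_normB _ _)).
    have := ler_normD (a (z + e) + a (e - z)) (a (z - e)).
    have := ler_normD (a (z + e)) (a (e - z)).
    have := hk (z + e); have := hk (e - z); have := hk (z - e); have := hk (- z - e).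
    lra.
  by apply: ler_pM => //; apply: domby_le ha.
- move=> e; apply: cont_M; last by cont.
  apply: cont_D; [apply: cont_D; [apply: cont_D|]|apply: cont_N];
    by apply: (cont_comp (h := a)) => //; cont.
Qed.

Lemma cont_Q_t c (a : R -> R -> R) z : 0 <= c -> (forall t, continuous (a t)) ->
  (forall k, continuous (a ^~ k)) -> (forall t, domby 0 c (a t)) ->
  continuous (fun t => Q (a t) (a t) z).
Proof.
move=> c0 ca cta ha; apply: cont_M; first by cont.
apply: (@I_continuous R _ (fun e => 4 * (c * VM) * (c * V e))).
- by move=> t; apply: measurable_funM; [apply: measurable_Qker|]; exact: cont_meas.
- by apply: L1_Z; apply: L1_Z.
- move=> t e; rewrite normrM.
  have hk k : `|a t k| <= c * VM.
    by apply: (le_trans (domby_le k (lexx 0) c0 (ha t))); rewrite ler_wpM2l.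
  have h4 : `|Qker (a t) z e| <= 4 * (c * VM).
    rewrite /Qker; apply: (le_trans (ler_normB _ _)).
    have := ler_normD (a t (z + e) + a t (e - z)) (a t (z - e)).
    have := ler_normD (a t (z + e)) (a t (e - z)).
    have := hk (z + e); have := hk (e - z); have := hk (z - e); have := hk (- z - e).
    lra.
  by apply: ler_pM => //; apply: domby_le (ha t).
- move=> e; apply: cont_M; last exact: cta.
  by apply: cont_D; [apply: cont_D; [apply: cont_D|]|apply: cont_N]; exact: cta.
Qed.

End Qbounds.

(** * The linear propagator *)

Section rotation.
Context {R : realType}.
Implicit Types (f g h a b G : R -> R) (x y e k z d t r : R).

(* Dispersion relation; [rot t] is the linear propagator on the Hartley side. *)
Definition disp k : R := k * `|k|.

Lemma dispN k : disp (- k) = - disp k.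
Proof. by rewrite /disp normrN mulNr. Qed.

Lemma cont_disp : continuous disp.
Proof. by rewrite /disp; cont. Qed.

Definition rot t G k := cos (t * disp k) * G k + sin (t * disp k) * G (- k).

Lemma rot_le t G k : `|rot t G k| <= `|G k| + `|G (- k)|.
Proof.
rewrite /rot; apply: (le_trans (ler_normD _ _)); rewrite !normrM.
by apply: lerD; rewrite ler_piMl// ?cos_max ?sin_max.
Qed.

Lemma rot_B t G G' k : rot t G k - rot t G' k = rot t (fun k => G k - G' k) k.
Proof. by rewrite /rot; ring. Qed.

Lemma rot_sqr t G k : rot t G k ^+ 2 + rot t G (- k) ^+ 2 = G k ^+ 2 + G (- k) ^+ 2.
Proof.
rewrite /rot dispN opprK mulrN cosN sinN.
transitivity ((cos (t * disp k) ^+ 2 + sin (t * disp k) ^+ 2) * (G k ^+ 2 + G (- k) ^+ 2)).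
  by ring.
by rewrite cos2Dsin2 mul1r.
Qed.

Lemma cont_rot t G : continuous G -> continuous (rot t G).
Proof.
move=> cG; have cd := cont_disp.
have cGN : continuous (fun k => G (- k)) by apply: (cont_comp (h := G)) => //; cont.
by rewrite /rot; cont; apply: cont_disp.
Qed.

Lemma cont_rot_t (g : R -> R -> R) k : (forall k, continuous (g ^~ k)) ->
  continuous (fun t => rot t (g t) k).
Proof. by move=> cg; rewrite /rot; cont; exact: cg. Qed.

End rotation.

(** * The fixed point in a scale of weights *)

Section CK.
Context {R : realType}.
Implicit Types (f h a b : R -> R) (x y e k z d t r : R) (g : R -> R -> R).

Variables (V h0 : R -> R) (kap VM rho : R).
Hypotheses (cV : continuous V) (V0 : forall k, 0 <= V k) (VN : forall k, V (- k) = V k)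
  (VVM : forall k, V k <= VM) (V1 : L1 V)
  (Vconv : forall z, I (fun e => V (z - e) * V e) <= kap * V z)
  (kap0 : 0 <= kap) (rho0 : 0 < rho) (small : 64 * kap <= rho)
  (ch0 : continuous h0) (h0b : domby V rho 2^-1 h0).

(* The loss of decay [rho / 2] per unit of time absorbs the factor [k] of the nonlinearity. *)
Definition rate t := rho * (1 - clamp t / 2).

Lemma rate_itv t : rho / 2 <= rate t <= rho.
Proof.
have /andP[c0 c1] := clamp_itv t; rewrite /rate.
have h1 : 0 <= rho * clamp t by rewrite mulr_ge0// ltW.
have h2 : rho * clamp t <= rho by rewrite ler_piMr// ltW.
by apply/andP; split; lra.
Qed.

Lemma rate_ge0 t : 0 <= rate t.
Proof. by have /andP[h _] := rate_itv t; apply: le_trans h; rewrite divr_ge0// ltW. Qed.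

Definition hh g t := rot t (g t).
(** The Hartley side of [- u u_x = - (u^2)_x / 2]. *)
Definition FF g t k := k / 2 * Q (hh g t) (hh g t) (- k).
Definition NN g t := rot (- t) (FF g t).
(** Duhamel's formula in the rotating frame, with initial profile [h0] and time frozen outside
    [[0, 1]]. *)
Definition Phi g t k := h0 k + prim (fun s => NN g s k) (clamp t).

Definition adm g := [/\ (forall k, continuous (g ^~ k)), (forall t, continuous (g t)) &
  (forall t, domby V (rate t) 1 (g t))].

Lemma rot_dom r c t a : domby V r c a -> domby V r (2 * c) (rot t a).
Proof.
move=> ha k; apply: (le_trans (rot_le _ _ _)).
by have h1 := ha k; have := ha (- k); rewrite dampN VN; lra.
Qed.

Lemma domby_0 r c a : 0 <= r -> 0 <= c -> domby V r c a -> domby V 0 c a.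
Proof.
move=> r0 c0 ha k; apply: (le_trans (ha k)); rewrite ler_wpM2l// ler_wpM2r//.
exact: damp_le.
Qed.

Section adm_props.
Variable g : R -> R -> R.
Hypothesis ag : adm g.

Lemma adm_hh t : domby V (rate t) 2 (hh g t).
Proof. by case: ag => _ _ /(_ t) /(@rot_dom _ _ t); rewrite mulr1. Qed.

Lemma cont_hh t : continuous (hh g t).
Proof. by case: ag => _ /(_ t) cg _; exact: cont_rot. Qed.

Lemma cont_hh_t k : continuous (fun t => hh g t k).
Proof. by case: ag => cg _ _; exact: cont_rot_t. Qed.

Lemma FF_le t k : `|FF g t k| <= 4 * kap * `|k| * (damp (rate t) k * V k).
Proof.
have mh := cont_meas (@cont_hh t).
have h2 : (0 : R) <= 2 by [].
have hq := Q_bound cV V0 VN VVM V1 Vconv (- k) (rate_ge0 t) (adm_hh t) (adm_hh t) h2 h2 mh mh.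
rewrite dampN VN in hq; rewrite /FF normrM normf_div (ger0_norm h2).
apply: (@le_trans _ _ (`|k| / 2 * (2 * 2 * 2 * kap * (damp (rate t) k * V k)))).
  by rewrite ler_wpM2l// divr_ge0.
by apply: eq_le; field.
Qed.

Lemma NN_le t k : `|NN g t k| <= 8 * kap * `|k| * (damp (rate t) k * V k).
Proof.
apply: (le_trans (rot_le _ _ _)); have h1 := FF_le t k; have := FF_le t (- k).
by rewrite dampN VN normrN; lra.
Qed.

Lemma cont_FF t : continuous (FF g t).
Proof.
rewrite /FF; apply: cont_M; first by cont.
apply: (cont_comp (h := Q (hh g t) (hh g t))); last by cont.
have h2 : (0 : R) <= 2 by [].
exact: (cont_Q V0 VVM V1 h2 (@cont_hh t) (domby_0 (rate_ge0 t) h2 (adm_hh t))).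
Qed.

Lemma cont_FF_t k : continuous (fun t => FF g t k).
Proof.
rewrite /FF; apply: cont_M; first by cont.
have h2 : (0 : R) <= 2 by [].
apply: (cont_Q_t V0 VVM V1 h2 (@cont_hh) (@cont_hh_t)) => t.
exact: (domby_0 (rate_ge0 t) h2 (adm_hh t)).
Qed.

Lemma cont_NN t : continuous (NN g t).
Proof. exact: cont_rot (@cont_FF t). Qed.

Lemma cont_NN_t k : continuous (fun t => NN g t k).
Proof. by rewrite /NN /rot; cont; exact: cont_FF_t. Qed.

End adm_props.

Lemma NN_diff g g' de t k : adm g -> adm g' -> 0 <= de ->
  domby V (rate t) de (fun k => g t k - g' t k) ->
  `|NN g t k - NN g' t k| <= 16 * de * kap * `|k| * (damp (rate t) k * V k).
Proof.
move=> ag ag' de0 hd.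
have mh := cont_meas (@cont_hh g ag t); have mh' := cont_meas (@cont_hh g' ag' t).
have h2 : (0 : R) <= 2 by [].
have hd' : domby V (rate t) (2 * de) (fun k => hh g t k - hh g' t k).
  by move=> y; rewrite /hh rot_B; exact: (rot_dom t hd).
have D y : `|FF g t y - FF g' t y| <= 8 * de * kap * `|y| * (damp (rate t) y * V y).
  have hq := Q_diff cV V0 VN VVM V1 Vconv (- y) (rate_ge0 t) (@adm_hh g ag t)
    (@adm_hh g' ag' t) hd' h2 (mulr_ge0 h2 de0) mh mh'.
  rewrite dampN VN in hq; rewrite /FF -mulrBr normrM normf_div (ger0_norm h2).
  apply: (@le_trans _ _ (`|y| / 2 * (4 * 2 * (2 * de) * kap * (damp (rate t) y * V y)))).
    by rewrite ler_wpM2l// divr_ge0.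
  by apply: eq_le; field.
rewrite /NN rot_B; apply: (le_trans (rot_le _ _ _)).
by have h1 := D k; have := D (- k); rewrite dampN VN normrN; lra.
Qed.

(** On [[0, 1]], [|k| * damp (rate t) k] is [2 / rho] times the time derivative of
    [damp (rate t) k]. Integration in time therefore removes the factor [|k|] at the price of
    [2 / rho]. *)
Lemma prim_damp (N : R -> R) A k x : continuous N -> 0 <= x <= 1 ->
  (forall t, 0 < t < 1 -> `|N t| <= A * `|k| * damp (rate t) k) -> 0 <= A ->
  `|prim N x| <= 2 * A / rho * damp (rate x) k.
Proof.
move=> cN x01 hN A0.
have x0 : 0 <= x by case/andP: x01.
pose G t := 2 * A / rho * expR (- (rho * (1 - t / 2) * `|k|)).
have cG : continuous G by rewrite /G; cont.
have cP t : 0 <= t <= x -> {for t, continuous (prim N)}.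
  move=> ht; apply: isd_cont_at; apply: is_derive_prim => //; lra.
have := @derive_norm_le R (prim N) G N (fun t => A * `|k| * expR (- (rho * (1 - t / 2) * `|k|))) 0 x x0 cP
   (fun t _ => cG t).
rewrite prim0 subr0 => H.
have {}H : `|prim N x| <= G x - G 0.
  apply: H.
  - by move=> t ht; apply: is_derive_prim => //; lra.
  - move=> t ht; rewrite /G; apply: isd_eq; [isd|].
    by rewrite /=; field; rewrite gt_eqF.
  - move=> t ht; have := hN t ltac:(lra).
    by rewrite /damp /rate clamp_id//; lra.
apply: (le_trans H); rewrite /damp /rate clamp_id// lerBlDr lerDl /G.
by rewrite mulr_ge0 ?expR_ge0// divr_ge0 ?mulr_ge0// ltW.
Qed.

(** The data take up half of the unit ball, and the integral adds at most [16 * kap / rho], which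
    [small] keeps below a quarter. *)
Lemma Phi_adm g : adm g -> adm (Phi g).
Proof.
move=> ag; split.
- move=> k; apply: cont_D; first by cont.
  move=> t; apply: (@continuous_comp _ _ _ (@clamp R) (prim (NN g ^~ k))); first exact: cont_clamp.
  apply: isd_cont_at; apply: is_derive_prim; first exact: cont_NN_t.
  by have := clamp_itv t; lra.
- move=> t; apply: cont_D => //.
  apply: (prim_cont_param (cont_NN_t ag) (cont_NN ag)) => k0.
  exists (8 * kap * (`|k0| + 1) * VM) => s k hk.
  apply: (le_trans (NN_le ag s k)).
  have hk' : `|k| <= `|k0| + 1 by have := ler_normD (k - k0) k0; rewrite subrK; lra.
  apply: ler_pM; rewrite ?mulr_ge0 ?damp_ge0//.
    by rewrite ler_wpM2l// mulr_ge0.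
  by rewrite -[leRHS]mul1r ler_pM ?damp_ge0// damp_le1// rate_ge0.
- move=> t k; rewrite /Phi; apply: (le_trans (ler_normD _ _)).
  have c01 := clamp_itv t.
  have := @prim_damp (NN g ^~ k) (8 * kap * V k) k (clamp t) (@cont_NN_t g ag k) c01.
  have -> : rate (clamp t) = rate t by rewrite /rate (clamp_id c01).
  have A0 : 0 <= 8 * kap * V k by rewrite !mulr_ge0.
  move=> /(_ _ A0) H; have {}H := H ltac:(move=> s _; have := NN_le ag s k; lra).
  have h1 := h0b k.
  have h2 : damp rho k <= damp (rate t) k by apply: damp_le; case/andP: (rate_itv t).
  have dV : 0 <= damp (rate t) k * V k by rewrite mulr_ge0 ?damp_ge0.
  have h3 : damp rho k * V k <= damp (rate t) k * V k by rewrite ler_wpM2r.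
  have h4 : 2 * (8 * kap * V k) / rho * damp (rate t) k <= 2^-1 * (damp (rate t) k * V k).
    rewrite (_ : _ * damp _ _ = 16 * kap / rho * (damp (rate t) k * V k)); last by ring.
    by rewrite ler_wpM2r// ler_pdivrMr//; have := small; have := rho0; lra.
  by rewrite mul1r; lra.
Qed.

Lemma small32 : 32 * kap / rho <= 2^-1.
Proof. by rewrite ler_pdivrMr//; have := small; have := rho0; lra. Qed.

Lemma Phi_contract g g' de : adm g -> adm g' -> 0 <= de ->
  (forall t, domby V (rate t) de (fun k => g t k - g' t k)) ->
  forall t, domby V (rate t) (de / 2) (fun k => Phi g t k - Phi g' t k).
Proof.
move=> ag ag' de0 hd t k.
have c01 := clamp_itv t.
pose N s := NN g s k - NN g' s k.
have cN : continuous N by apply: cont_D; [|apply: cont_N]; exact: cont_NN_t.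
(* Both sides come from functions that vanish at [0] and have the same derivative. *)
have E : Phi g t k - Phi g' t k = prim N (clamp t).
  have c1 := @cont_NN_t g ag k; have c2 := @cont_NN_t g' ag' k.
  pose D s := prim (NN g ^~ k) s - prim (NN g' ^~ k) s - prim N s.
  have dD (s : R) : -1 < s -> is_derive s 1 D 0.
    move=> hs; apply: isd_eq.
      apply: isd_D; [apply: isd_D; [|apply: isd_N]|apply: isd_N]; apply: is_derive_prim => //.
    by rewrite /N subrr.
  have := @derive_norm_le R D (fun=> 0) (fun=> 0) (fun=> 0) 0 (clamp t).
  rewrite subrr => H.
  have {}H : `|D (clamp t) - D 0| <= 0.
    apply: H => //; first by case/andP: c01.
    - by move=> s hs; apply: (isd_cont_at (dD s _)); lra.
    - by move=> s hs; exact: cont_cst.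
    - by move=> s hs; apply: dD; lra.
    - by move=> s hs; rewrite normr0.
  have := normr_le0 (D (clamp t) - D 0); rewrite H => /esym/eqP.
  rewrite /D !prim0 !subr0 => /eqP; rewrite subr_eq0 => /eqP <-.
  by rewrite /Phi opprD addrACA subrr add0r.
rewrite E.
have A0 : 0 <= 16 * de * kap * V k by rewrite !mulr_ge0.
have := prim_damp cN c01 _ A0 (k := k).
have -> : rate (clamp t) = rate t by rewrite /rate (clamp_id c01).
have hN s : 0 < s < 1 -> `|N s| <= 16 * de * kap * V k * `|k| * damp (rate s) k.
  move=> _; apply: (le_trans (@NN_diff g g' de s k ag ag' de0 (hd s))).
  by apply: eq_le; ring.
move=> /(_ hN) H.
apply: (le_trans H).
have dV : 0 <= damp (rate t) k * V k by rewrite mulr_ge0 ?damp_ge0.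
rewrite (_ : _ * damp _ _ = 32 * kap / rho * de * (damp (rate t) k * V k)); last by ring.
by rewrite ler_wpM2r// mulrC ler_wpM2l// small32.
Qed.

Definition gs n := iter n Phi (fun _ _ => 0).

Lemma gs_adm n : adm (gs n).
Proof.
elim: n => [|n IH]; last exact: Phi_adm.
split => [k|t|t k] /=; try exact: cont_cst.
by rewrite normr0 mul1r mulr_ge0// damp_ge0.
Qed.

Lemma gs_step n t : domby V (rate t) (2^-1 ^+ n) (fun k => gs n.+1 t k - gs n t k).
Proof.
elim: n t => [|n IH] t.
  by move=> k; rewrite subr0 expr0; case: (gs_adm 1) => _ _ /(_ t k).
rewrite exprSr; apply: (Phi_contract (gs_adm n.+1) (gs_adm n) _ IH).
by rewrite exprn_ge0// invr_ge0.
Qed.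

Definition gl t k := limn (fun n => gs n t k).

Lemma gl_cvg t k : gs n t k @[n --> \oo] --> gl t k /\
  forall n, `|gl t k - gs n t k| <= 2 * (damp (rate t) k * V k) * 2^-1 ^+ n.
Proof. by apply: geom_cvg => n; rewrite mulrC; exact: gs_step. Qed.

Lemma damp_V t k : damp (rate t) k * V k <= VM.
Proof.
by rewrite -[leRHS]mul1r ler_pM ?damp_ge0// damp_le1// rate_ge0.
Qed.

Lemma gl_adm : adm gl.
Proof.
have err n t k : `|gl t k - gs n t k| <= 2 * VM * 2^-1 ^+ n.
  apply: (le_trans ((gl_cvg t k).2 n)); rewrite ler_wpM2r ?exprn_ge0 ?invr_ge0//.
  by rewrite ler_wpM2l// damp_V.
split.
- move=> k; apply: (@cont_unif_lim _ (fun n t => gs n t k) _ (2 * VM)) => //.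
  by move=> n; case: (gs_adm n).
- move=> t; apply: (@cont_unif_lim _ (fun n k => gs n t k) _ (2 * VM)) => //.
  by move=> n; case: (gs_adm n).
- move=> t k; have h : `|gs n t k| @[n --> \oo] --> `|gl t k|.
    by apply: cvg_norm; exact: (gl_cvg t k).1.
  rewrite -(cvg_lim _ h)//; apply: limr_le; first by apply/cvg_ex; eexists; exact: h.
  by apply: nearW => n; case: (gs_adm n) => _ _; exact.
Qed.

(** Both [gl] and [Phi gl] lie within a geometrically small distance of [gs n.+1], the second one by
    contraction from [gs n]. *)
Lemma gl_fix t k : gl t k = Phi gl t k.
Proof.
apply/eqP; rewrite -subr_eq0 -normr_le0; apply/eqP/eqP.
set c := damp (rate t) k * V k.
have c0 : 0 <= c by rewrite mulr_ge0 ?damp_ge0.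
have H n : `|gl t k - Phi gl t k| <= 2 * c * 2^-1 ^+ n.
  have q0 : 0 <= (2^-1 : R) ^+ n by rewrite exprn_ge0// invr_ge0.
  have h1 := (gl_cvg t k).2 n.+1.
  have h2 : `|Phi gl t k - gs n.+1 t k| <= c * 2^-1 ^+ n.
    have hd s : domby V (rate s) (2 * 2^-1 ^+ n) (fun y => gl s y - gs n s y).
      move=> y; apply: (le_trans ((gl_cvg s y).2 n)).
      by apply: eq_le; ring.
    have := @Phi_contract gl (gs n) (2 * 2^-1 ^+ n) gl_adm (gs_adm n) (mulr_ge0 (ler0n _ 2) q0) hd t k.
    rewrite (_ : 2 * 2^-1 ^+ n / 2 = 2^-1 ^+ n :> R); last by field.
    by rewrite -/c [_ * c]mulrC.
  rewrite (_ : gl t k - _ = (gl t k - gs n.+1 t k) - (Phi gl t k - gs n.+1 t k)); last by ring.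
  apply: (le_trans (ler_normB _ _)); move: h1 h2.
  rewrite exprS -/c; set q := _ ^+ n; move: q0; rewrite -/q.
  rewrite (_ : 2 * c * (2^-1 * q) = c * q); last by field.
  rewrite (_ : 2 * c * q = c * q + c * q); last by ring.
  by move=> _; apply: lerD.
have cv := cvg_half (2 * c).
rewrite -(cvg_lim _ cv)//; apply: limr_ge; first by apply/cvg_ex; eexists; exact: cv.
by apply: nearW => n; exact: H.
Qed.

End CK.

(** * Solutions of the Benjamin-Ono equation *)

Section decay.
Context {R : realType}.
Implicit Types (f g h a b : R -> R) (x y e k z d t r : R).

Lemma oneDsqr_gt0 k : 0 < 1 + k ^+ 2.
Proof. by rewrite ltr_pwDl// sqr_ge0. Qed.

Lemma oneDsqr_ge1 k : 1 <= 1 + k ^+ 2.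
Proof. by rewrite lerDl sqr_ge0. Qed.

(** Decay faster than every power, which puts [hart f] in every [H^sigma] and allows repeated
    differentiation in [x]. *)
Definition dec f := forall n, exists C : R, forall k, `|f k| * (1 + k ^+ 2) ^+ n <= C.

Lemma dec_dom f g : (forall k, `|f k| <= `|g k|) -> dec g -> dec f.
Proof.
move=> h dg n; have [C hC] := dg n; exists C => k; apply: le_trans (hC k).
by rewrite ler_wpM2r// exprn_ge0// ltW// oneDsqr_gt0.
Qed.

Lemma dec_norm f : dec f -> dec (fun k => `|f k|).
Proof. by apply: dec_dom => k; rewrite normr_id. Qed.

Lemma dec_Z c f : dec f -> dec (fun k => c * f k).
Proof.
move=> df n; have [C hC] := df n; exists (`|c| * C) => k.
by rewrite normrM -mulrA ler_wpM2l.
Qed.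

Lemma dec_D f g : dec f -> dec g -> dec (fun k => f k + g k).
Proof.
move=> df dg n; have [C hC] := df n; have [C' hC'] := dg n; exists (C + C') => k.
apply: le_trans (lerD (hC k) (hC' k)); rewrite -mulrDl ler_wpM2r ?ler_normD//.
by rewrite exprn_ge0// ltW// oneDsqr_gt0.
Qed.

Lemma dec_mulk f : dec f -> dec (fun k => k * f k).
Proof.
move=> df n; have [C hC] := df n.+1; exists C => k; apply: le_trans (hC k).
rewrite normrM [X in _ <= _ * X]exprS (_ : `|k| * _ * _ = `|f k| * (1 + k ^+ 2) ^+ n * `|k|); last by ring.
rewrite [leRHS](_ : _ = `|f k| * (1 + k ^+ 2) ^+ n * (1 + k ^+ 2)); last by ring.
have q0 : 0 <= (1 + k ^+ 2) ^+ n by rewrite exprn_ge0// ltW// oneDsqr_gt0.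
rewrite ler_wpM2l ?mulr_ge0//.
have := sqr_ge0 (`|k| - 1); rewrite sqrrB1 real_normK ?num_real//.
by have := sqr_ge0 k; lra.
Qed.

Lemma dec_opp f : dec f -> dec (fun k => f (- k)).
Proof. by move=> df n; have [C hC] := df n; exists C => k; have := hC (- k); rewrite sqrrN. Qed.

Lemma dec_bd f : dec f -> exists M : R, forall k, `|f k| <= M.
Proof. by move=> /(_ 0%N)[C hC]; exists C => k; have := hC k; rewrite expr0 mulr1. Qed.

Lemma dec_L1 f : measurable_fun setT f -> dec f -> L1 f.
Proof.
move=> mf /(_ 1%N)[C hC]; apply: (L1_le (g := fun k => C * (1 + k ^+ 2)^-1)) => //.
  by move=> k; rewrite ler_pdivlMr ?oneDsqr_gt0//; have := hC k; rewrite expr1.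
by apply: L1_Z; exact: L1_oneDsqrV.
Qed.

Lemma dec_damp r f M : 0 < r -> (forall k, `|f k| <= M) -> dec (fun k => damp r k * f k).
Proof.
move=> r0 fM n.
have M0 : 0 <= M by apply: le_trans (fM 0).
(* [1 + k^2 <= (1 + |k|)^2] asks for the power [2 * n]; the exponential bound [expR_ge1Dxn] supplies
   a successor exponent. *)
pose m := n.*2.+1.
exists (M * (m`!%:R * expR r / r ^+ m)) => k.
pose y := 1 + `|k|.
have y1 : 1 <= y by rewrite /y lerDl.
have y0 : 0 <= y by apply: le_trans y1.
have e1 : 1 + k ^+ 2 <= y ^+ 2.
  rewrite (_ : y ^+ 2 = 1 + 2 * `|k| + `|k| ^+ 2); last by rewrite /y; ring.
  by rewrite real_normK ?num_real//; have := normr_ge0 k; lra.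
have e2 : (1 + k ^+ 2) ^+ n <= y ^+ m.
  apply: (@le_trans _ _ (y ^+ n.*2)); last by apply: ler_weXn2l.
  rewrite -mul2n exprM; apply: lerXn2r => //; rewrite nnegrE ?exprn_ge0//.
  by rewrite ltW// oneDsqr_gt0.
have e3 : (r * y) ^+ m / m`!%:R <= expR (r * y).
  apply: (le_trans _ (expR_ge1Dxn n.*2 _)); first by rewrite lerDr.
  by rewrite mulr_ge0// ltW.
have e4 : expR (r * y) = expR r * expR (r * `|k|) by rewrite -expRD /y mulrDr mulr1.
rewrite normrM (ger0_norm (damp_ge0 _ _)).
have e5 : damp r k * y ^+ m <= m`!%:R * expR r / r ^+ m.
  have rm : 0 < r ^+ m by rewrite exprn_gt0.
  have fm : 0 < m`!%:R :> R by rewrite ltr0n fact_gt0.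
  rewrite ler_pdivlMr// -mulrA -exprMn [y * r]mulrC.
  move: e3; rewrite ler_pdivrMr// e4 => e3.
  apply: (le_trans (ler_wpM2l (damp_ge0 r k) e3)).
  rewrite (_ : damp r k * _ = m`!%:R * expR r * (damp r k * expR (r * `|k|))); last by ring.
  by rewrite /damp -expRD addNr expR0 mulr1 mulrC.
rewrite mulrAC mulrC; apply: ler_pM => //.
  by rewrite mulr_ge0 ?damp_ge0// exprn_ge0// ltW// oneDsqr_gt0.
by apply: le_trans e5; rewrite ler_wpM2l// damp_ge0.
Qed.

Lemma powR_le_expn (s : R) : exists N : nat, forall k, (1 + k ^+ 2) `^ s <= (1 + k ^+ 2) ^+ N.
Proof.
exists (Num.Def.archi_bound s) => y.
have y0 : 0 <= 1 + y ^+ 2 by rewrite ltW// oneDsqr_gt0.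
rewrite -[leRHS](powR_mulrn _ y0).
apply: ler_powR; first exact: oneDsqr_ge1.
have [s0|s0] := leP 0 s; first by rewrite ltW// archi_boundP.
by rewrite (le_trans (ltW s0)).
Qed.

End decay.

Section Hs_bound.
Context {R : realType}.
Implicit Types (f g h a b B : R -> R) (x y e k z d t r s : R).

Lemma cont_powR s : continuous (fun k : R => (1 + k ^+ 2) `^ s).
Proof.
move=> k; have k0 := oneDsqr_gt0 k.
apply: (isd_cont_at (a := s * (1 + k ^+ 2) `^ (s - 1) * (2%:R * k ^+ 1 * 1))).
apply: (@isd_comp R (fun y => y `^ s) (fun k => 1 + k ^+ 2)).
  exact: is_derive1_powR.
apply: isd_eq; first by apply: isd_D; [apply: isd_cst|apply: isd_X; apply: isd_id].
by rewrite add0r.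
Qed.

Lemma dec_pow_L1 s B : measurable_fun setT B -> dec B ->
  L1 (fun k => (1 + k ^+ 2) `^ s * B k ^+ 2).
Proof.
move=> mB dB; have [N hN] := powR_le_expn s.
have [C hC] := dB N.
apply: (L1_le (g := fun k => C * `|B k|)).
- apply: measurable_funM; first exact: cont_meas (@cont_powR s).
  exact: measurable_funX.
- move=> k; have nn : 0 <= (1 + k ^+ 2) `^ s * B k ^+ 2 by rewrite mulr_ge0 ?powR_ge0 ?sqr_ge0.
  rewrite (ger0_norm nn).
  rewrite -(real_normK (num_real (B k))) expr2 mulrA ler_wpM2r//.
  by apply: le_trans (hC k); rewrite mulrC ler_wpM2l ?hN.
- by apply: L1_Z; apply: L1_norm; apply: dec_L1.
Qed.

(** The squared norm of [hart B] for an even profile [B]: [B k] and [B (- k)] contribute equally,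
    hence [2 * pi]. *)
Definition HK s B : R := 2 * pi * I (fun k => (1 + k ^+ 2) `^ s * B k ^+ 2).

Lemma dec_le a B A : (forall k, `|a k| <= A * B k) -> dec B -> dec a.
Proof.
move=> h dB; apply: (@dec_dom _ a (fun k => A * B k)); last exact: dec_Z.
by move=> k; apply: le_trans (h k) (ler_norm _).
Qed.

Lemma Hs_norm2_le s a B A : continuous a -> measurable_fun setT B -> 0 <= A ->
  (forall k, `|a k| <= A * B k) -> (forall k, B (- k) = B k) ->
  dec B -> (Hs_norm2 s (hart a) <= (A ^+ 2 * HK s B)%:E)%E.
Proof.
move=> ca mB A0 h BN dB; have da := dec_le h dB.
have [M hM] := dec_bd da; have a1 := dec_L1 (cont_meas ca) da.
have p0 : (0 : R) <= pi by exact: pi_ge0.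
have l1 := dec_pow_L1 s mB dB.
rewrite (Hs_norm2_hart ca hM a1).
have -> : A ^+ 2 * HK s B = I (fun k => A ^+ 2 * (2 * pi) * ((1 + k ^+ 2) `^ s * B k ^+ 2)).
  by rewrite (IZ _ l1) mulrA.
rewrite -EFin_I; last exact: L1_Z.
have sq y : a y ^+ 2 <= A ^+ 2 * B y ^+ 2.
  rewrite -exprMn -(real_normK (num_real (a y))); apply: lerXn2r; rewrite ?nnegrE//.
  exact: le_trans (normr_ge0 _) (h y).
have caN : continuous (fun k => a (- k)) by apply: (cont_comp (h := a)) => //; cont.
have cp := @cont_powR s.
apply: ge0_le_integral => //.
- move=> k _; rewrite lee_fin !mulr_ge0 ?powR_ge0//.
  by rewrite addr_ge0// sqr_ge0.
- by apply/measurable_EFinP; apply: cont_meas; cont.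
- apply/measurable_EFinP; exact: L1_measurable (L1_Z _ l1).
- move=> k _; rewrite lee_fin.
  have h1 := sq k; have := sq (- k); rewrite BN => h2.
  rewrite [leRHS](_ : _ = pi * ((1 + k ^+ 2) `^ s * (A ^+ 2 * B k ^+ 2 + A ^+ 2 * B k ^+ 2))); last by ring.
  by rewrite ler_wpM2l// ler_wpM2l ?powR_ge0// lerD.
Qed.

Lemma Hs_norm_le s a B A : continuous a -> measurable_fun setT B -> 0 <= A ->
  (forall k, `|a k| <= A * B k) -> (forall k, B (- k) = B k) ->
  dec B -> Hs_norm s (hart a) <= A * Num.sqrt (HK s B).
Proof.
move=> ca mB A0 h BN dB; have H := Hs_norm2_le s ca mB A0 h BN dB.
rewrite /Hs_norm -{1}(ger0_norm A0) -sqrtr_sqr -sqrtrM ?sqr_ge0// ler_wsqrtr//.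
rewrite -[leRHS]/(fine (A ^+ 2 * HK s B)%:E); apply: fine_le => //.
rewrite ge0_fin_numE ?(le_lt_trans H) ?ltry//.
rewrite /Hs_norm2 mule_ge0 ?integral_ge0//.
  by rewrite lee_fin invr_ge0 mulr_ge0 ?pi_ge0.
by move=> k _; rewrite lee_fin mulr_ge0 ?powR_ge0 ?addr_ge0 ?sqr_ge0.
Qed.

Lemma hart_in_Hs s a : continuous a -> dec a -> in_Hs s (hart a).
Proof.
move=> ca da; have [M hM] := dec_bd da; have a1 := dec_L1 (cont_meas ca) da.
split; [|split].
- by apply: cont_meas; exact: cont_hart.
- exact: hart_L2 ca hM a1.
- pose B k := `|a k| + `|a (- k)|.
  have caN : continuous (fun k => a (- k)) by apply: (cont_comp (h := a)) => //; cont.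
  have cB : continuous B by rewrite /B; cont.
  have dB : dec B by apply: dec_D; apply: dec_norm => //; exact: dec_opp.
  apply: (le_lt_trans (@Hs_norm2_le s a B 1 ca (cont_meas cB) ler01 _ _ dB)); last exact: ltry.
  + by move=> k; rewrite mul1r lerDl.
  + by move=> k; rewrite /B opprK addrC.
Qed.

End Hs_bound.

(** * From the fixed point to a solution of the equation *)

Section BO_of_fixpoint.
Context {R : realType}.
Implicit Types (f h a b : R -> R) (x y e k z d t : R).

Variables (V h0 : R -> R) (kap VM rho : R).
Hypotheses (cV : continuous V) (V0 : forall k, 0 <= V k) (VN : forall k, V (- k) = V k)
  (VVM : forall k, V k <= VM) (V1 : L1 V)
  (Vconv : forall z, I (fun e => V (z - e) * V e) <= kap * V z)
  (kap0 : 0 <= kap) (rho0 : 0 < rho).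
Variable g : R -> R -> R.
Hypotheses (ag : adm V rho g) (gE : forall t k, g t k = Phi h0 g t k).

Let h t := hh g t.

Lemma fix_init k : g 0 k = h0 k.
Proof. by rewrite gE /Phi clamp_id ?lexx ?ler01// prim0 addr0. Qed.

(** Inside the open interval [clamp] is the identity near [t], so the fixed-point equation can be
    differentiated. *)
Lemma isd_fix t k : 0 < t < 1 -> is_derive t 1 (g ^~ k) (NN g t k).
Proof.
move=> ht.
apply: (@near_eq_is_derive _ _ _ (fun s => h0 k + prim (NN g ^~ k) s)).
  have : t \in `]0, 1[ by rewrite in_itv.
  move=> /near_in_itvoo; apply: filterS => s; rewrite in_itv/= => /andP[s0 s1].
  by rewrite gE /Phi clamp_id// !ltW.
have cN : continuous (NN g ^~ k) by exact: (cont_NN_t V0 VN VVM V1 rho0 ag).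
apply: isd_eq; first by apply: isd_D; [apply: isd_cst|apply: is_derive_prim => //; lra].
by rewrite add0r.
Qed.

Let F t := FF g t.
(** The right-hand side of the equation in frequency: the first term is the Hartley side of
    [- H u_xx], the second that of [- u u_x]. *)
Definition dh t k := disp k * h t (- k) + F t k.

Lemma isd_h t k : 0 < t < 1 -> is_derive t 1 (fun s => h s k) (dh t k).
Proof.
move=> ht; have d1 := isd_fix k ht; have d2 := isd_fix (- k) ht.
rewrite /h /hh /rot; apply: isd_eq; first by isd.
rewrite /= /dh /h /hh /NN /F /rot !dispN !opprK !mulNr !mulrN !cosN !sinN !mulNr.
set c := cos _; set s := sin _.
(* The rotation by [t] undoes the rotation by [- t] inside [NN]. *)
have cs : FF g t k = (c ^+ 2 + s ^+ 2) * FF g t k by rewrite cos2Dsin2 mul1r.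
by rewrite [X in _ = _ + X]cs; ring.
Qed.

Let D k := damp (rho / 2) k * V k.

Lemma dampVN k : D (- k) = D k. Proof. by rewrite /D dampN VN. Qed.

Lemma cont_damp (r : R) : continuous (fun k => damp r k).
Proof. by rewrite /damp; cont. Qed.

Lemma cont_dampV : continuous D.
Proof. by apply: cont_M => //; exact: cont_damp. Qed.

Lemma dec_dampV : dec D.
Proof. by apply: (@dec_damp _ _ _ VM); [rewrite divr_gt0|move=> k; rewrite ger0_norm]. Qed.

Lemma damp_rate t k : damp (rate rho t) k * V k <= D k.
Proof.
by rewrite ler_wpM2r//; apply: damp_le; case/andP: (rate_itv rho0 t).
Qed.

Lemma h_le t k : `|h t k| <= 2 * D k.
Proof.
apply: (le_trans (adm_hh VN ag t k)); rewrite ler_wpM2l//; exact: damp_rate.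
Qed.

Lemma F_le t k : `|F t k| <= 4 * kap * (`|k| * D k).
Proof.
apply: (le_trans (FF_le cV V0 VN VVM V1 Vconv rho0 ag t k)).
rewrite [leRHS]mulrA; apply: ler_wpM2l; [by rewrite !mulr_ge0|exact: damp_rate].
Qed.

(** A rapidly decaying majorant of [dh] uniform in time, which makes the solution Lipschitz in time
    with values in every [H^sigma]. *)
Let Lip k := 2 * (k * (k * D k)) + 4 * kap * (`|k| * D k).

Lemma dh_le t k : `|dh t k| <= Lip k.
Proof.
apply: (le_trans (ler_normD _ _)); apply: lerD; last exact: F_le.
rewrite normrM /disp normrM normr_id -normrM ger0_norm; last by rewrite -expr2 sqr_ge0.
have := h_le t (- k); rewrite dampVN => hk.
rewrite (_ : 2 * _ = k * k * (2 * D k)); last by ring.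
by apply: ler_wpM2l => //; rewrite -expr2 sqr_ge0.
Qed.

Lemma LipN k : Lip (- k) = Lip k.
Proof. by rewrite /Lip dampVN normrN; ring. Qed.

Lemma cont_Lip : continuous Lip.
Proof. by have cD := cont_dampV; rewrite /Lip; cont. Qed.

Lemma dec_Lip : dec Lip.
Proof.
apply: dec_D; apply: dec_Z; first by apply: dec_mulk; apply: dec_mulk; exact: dec_dampV.
apply: (@dec_dom _ _ (fun k => k * D k)); last by apply: dec_mulk; exact: dec_dampV.
by move=> k; rewrite !normrM normr_id.
Qed.

Lemma cont_h t : continuous (h t).
Proof. exact: (@cont_hh _ _ _ _ ag t). Qed.

Lemma cont_h_t k : continuous (fun t => h t k).
Proof. exact: (@cont_hh_t _ _ _ _ ag k). Qed.

Lemma h_lip t t0 k : 0 <= t <= 1 -> 0 <= t0 <= 1 -> `|h t k - h t0 k| <= `|t - t0| * Lip k.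
Proof.
wlog tt0 : t t0 / t0 <= t => [H|] ht ht0.
  have [|/ltW] := leP t0 t; first by move=> ?; apply: H.
  by move=> ?; rewrite distrC (distrC t); apply: H.
rewrite (ger0_norm (_ : 0 <= t - t0)) ?subr_ge0//.
have := @derive_norm_le R (fun s => h s k) (fun s => s * Lip k) (fun s => dh s k)
  (fun=> Lip k) t0 t tt0 (fun s _ => @cont_h_t k s).
rewrite -mulrBl; apply.
- by move=> s _; apply: (isd_cont_at (a := Lip k)); apply: isd_eq; [isd|rewrite /=; ring].
- by move=> s hs; apply: isd_h; lra.
- by move=> s hs; apply: isd_eq; [isd|rewrite /=; ring].
- by move=> s hs; apply: dh_le.
Qed.

Lemma dec_h t : dec (h t).
Proof. exact: dec_le (h_le t) dec_dampV. Qed.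

Lemma L1_h t : L1 (h t).
Proof. by apply: dec_L1; [exact: cont_meas (@cont_h t)|exact: dec_h]. Qed.

Definition usol t := hart (h t).

Lemma usol_cont_Hs s : cont_Hs s usol.
Proof.
split; first by move=> t _; apply: hart_in_Hs; [exact: cont_h|exact: dec_h].
move=> t0 ht0 eps eps0.
pose K := Num.sqrt (HK s Lip).
have K0 : 0 <= K by rewrite sqrtr_ge0.
have K1 : 0 < K + 1 by rewrite ltr_wpDl.
exists (eps / (K + 1)); first by rewrite divr_gt0.
move=> t ht htt.
rewrite (_ : (fun x => usol t x - usol t0 x) = hart (fun k => h t k - h t0 k)); last first.
  by apply/funext => x; rewrite -hart_B//; exact: L1_h.
have ca : continuous (fun k => h t k - h t0 k).
  by apply: cont_D; [|apply: cont_N]; exact: cont_h.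
apply: (le_lt_trans (@Hs_norm_le _ s _ Lip `|t - t0| ca (cont_meas cont_Lip) _ _ LipN dec_Lip)) => //.
  by move=> k; apply: h_lip.
rewrite -/K; move: htt; rewrite ltr_pdivlMr// => htt; apply: le_lt_trans htt.
by rewrite ler_wpM2l// lerDl.
Qed.

Lemma isd_usol_t t x : 0 < t < 1 -> is_derive t 1 (fun s => usol s x) (hart (dh t) x).
Proof.
move=> ht.
apply: (@I_is_derive R (fun s k => h s k * cas (x * k)) (fun s k => dh s k * cas (x * k))
  (fun k => 2 * Lip k) 0 1) => //.
- by move=> s _; apply: L1_hcas; exact: L1_h.
- move=> s k hs; apply: isd_eq; first by apply: isd_M; [apply: isd_h|apply: isd_cst].
  by rewrite /= mulr0 add0r mulrC.
- move=> s k _; apply: (le_trans (mulcas_le _ _)); rewrite ler_wpM2l//; exact: dh_le.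
- by apply: L1_Z; apply: dec_L1; [exact: cont_meas cont_Lip|exact: dec_Lip].
Qed.

Let Dx (f : R -> R) k := - (k * f (- k)).

Lemma cont_Dx f : continuous f -> continuous (Dx f).
Proof.
move=> cf; have cfN : continuous (fun k => f (- k)) by apply: (cont_comp (h := f)) => //; cont.
by rewrite /Dx; cont.
Qed.

Lemma dec_Dx f : dec f -> dec (Dx f).
Proof.
move=> df; apply: (@dec_dom _ _ (fun k => k * f (- k))); first by move=> k; rewrite normrN.
by apply: dec_mulk; exact: dec_opp.
Qed.

Lemma isd_hart_dec f x : continuous f -> dec f -> is_derive x 1 (hart f) (hart (Dx f) x).
Proof.
move=> cf df; apply: isd_hart; first by apply: dec_L1 => //; exact: cont_meas.
by apply: dec_L1; [apply: cont_meas; cont|exact: dec_mulk].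
Qed.

Lemma derive1_hart f : continuous f -> dec f -> derive1 (hart f) = hart (Dx f).
Proof.
move=> cf df; apply/funext => x; have ? := isd_hart_dec x cf df.
by rewrite derive1E derive_val.
Qed.

Let q t := Q (h t) (h t).

Lemma q_le t k : `|q t k| <= 8 * kap * D k.
Proof.
have mh := cont_meas (@cont_h t).
have h2 : (0 : R) <= 2 by [].
have hd := adm_hh VN ag t.
have := Q_bound cV V0 VN VVM V1 Vconv k (rate_ge0 rho0 t) hd hd h2 h2 mh mh.
move=> /le_trans; apply; rewrite (_ : 2 * 2 * 2 * kap = 8 * kap); last by ring.
by rewrite ler_wpM2l ?mulr_ge0// damp_rate.
Qed.

Lemma cont_q t : continuous (q t).
Proof.
have h2 : (0 : R) <= 2 by [].
apply: (cont_Q V0 VVM V1 h2 (@cont_h t)).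
exact: (domby_0 V0 (rate_ge0 rho0 t) h2 (adm_hh VN ag t)).
Qed.

Lemma dec_q t : dec (q t).
Proof. exact: dec_le (q_le t) dec_dampV. Qed.

Lemma usol_sqr t x : usol t x * usol t x = hart (q t) x.
Proof.
have mh := cont_meas (@cont_h t).
have hd := adm_hh VN ag t.
have h2 : (0 : R) <= 2 by [].
apply: hart_mul; try exact: cont_h; try exact: L1_h.
by move=> z; apply: (L1_Qprod cV V0 VN VVM V1 z (rate_ge0 rho0 t) hd hd h2 h2 mh mh).
Qed.

Lemma usol_BO : BO_solution usol.
Proof.
split; first by move=> s _; exact: usol_cont_Hs.
move=> t x ht.
have ch := @cont_h t; have dch := dec_h t.
have cD := cont_Dx ch; have dD := dec_Dx dch.
have cDD := cont_Dx cD; have dDD := dec_Dx dD.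
have i1 := isd_usol_t x ht.
have i2 := isd_hart_dec x ch dch.
have i3 := isd_hart_dec x cD dD.
rewrite (_ : usol t = hart (h t))// (derive1_hart ch dch) (derive1_hart cD dD).
split; [|split; [|split]].
- exact: ex_derive.
- exact: ex_derive.
- exact: ex_derive.
have [M hM] := dec_bd dDD.
have l1 := dec_L1 (cont_meas cDD) dDD.
have l2 : L1 (fun k => k * Dx (Dx (h t)) k).
  by apply: dec_L1; [apply: cont_meas; cont|exact: dec_mulk].
have := @hilbert_pv_hart _ _ _ x cDD hM l1 l2; set v := - I _ => hv; exists v; split=> //.
have cq := @cont_q t; have dq := dec_q t.
have i4 := isd_hart_dec x cq dq.
(* [q t] is the profile of [u^2]; its derivative is computed on the frequency side and by the
   product rule, and the two values must agree. *)
have E4 : hart (Dx (q t)) x = 2 * (hart (h t) x * hart (Dx (h t)) x).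
  have : is_derive x 1 (hart (q t)) (2 * (hart (h t) x * hart (Dx (h t)) x)).
    rewrite (_ : hart (q t) = (fun y => hart (h t) y * hart (h t) y)).
      by apply: isd_eq; [apply: isd_M; exact: i2|ring].
    by apply/funext => y; rewrite -usol_sqr.
  by move=> i5; rewrite -(@derive_val _ _ _ _ _ _ _ i4) (@derive_val _ _ _ _ _ _ _ i5).
have lF : L1 (F t).
  have cF : continuous (F t) by exact: (cont_FF V0 VN VVM V1 rho0 ag).
  apply: dec_L1; first exact: cont_meas.
  apply: (dec_le (F_le t)); apply: (@dec_dom _ _ (fun k => k * D k)).
    by move=> k; rewrite !normrM normr_id.
  by apply: dec_mulk; exact: dec_dampV.
have ld : L1 (fun k => disp k * h t (- k)).
  have chN : continuous (fun k => h t (- k)) by apply: (cont_comp (h := h t)) => //; cont.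
  have cd := @cont_disp R.
  apply: dec_L1; first by apply: cont_meas; cont.
  apply: (@dec_dom _ _ (fun k => k * (k * h t (- k)))).
    by move=> k; rewrite /disp !normrM normr_id mulrA.
  by apply: dec_mulk; apply: dec_mulk; exact: dec_opp.
have Edh : hart (dh t) x = hart (fun k => disp k * h t (- k)) x + hart (F t) x.
  by rewrite -ID; [apply: eq_I => k; rewrite mulrDl|exact: L1_hcas|exact: L1_hcas].
have EF : hart (F t) x = - (2^-1 * hart (Dx (q t)) x).
  rewrite -IZ; last by apply: L1_hcas; apply: dec_L1; [exact: cont_meas (cont_Dx cq)|exact: dec_Dx].
  rewrite -mulN1r -IZ; last first.
    by apply: L1_Z; apply: L1_hcas; apply: dec_L1; [exact: cont_meas (cont_Dx cq)|exact: dec_Dx].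
  by apply: eq_I => k; rewrite /F /FF /Dx /q /h; ring.
(* Two derivatives and the sign of [k] combine, up to sign, to [k^2 * sg k = disp k]; the reflection
   of [k] turns [cas (- (x * k))] into [cas (x * k)]. *)
have Ev : v = - hart (fun k => disp k * h t (- k)) x.
  have := I_opp (L1_hcas x ld); rewrite /v /hart => <-; congr (- _).
  by apply: eq_I => k; rewrite /Dx /disp !opprK normrN (normrEsg k) (mulrN x k); ring.
rewrite Ev.
have -> : derive1 (fun s => usol s x) t = hart (dh t) x by rewrite derive1E derive_val.
by rewrite Edh EF E4; field.
Qed.

End BO_of_fixpoint.

Section Hs_lower.
Context {R : realType}.
Implicit Types (a : R -> R) (k y lo hi s : R).

(** Only the frequencies in [[lo, hi]] are kept, and the factor [pi] of [Hs_norm2_hart] is bounded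
    below by [1]. *)
Lemma Hs_norm_ge s a y lo hi : continuous a -> dec a -> lo <= hi -> 0 <= y ->
  (forall k, lo <= k <= hi -> y <= (1 + k ^+ 2) `^ s * (a k ^+ 2 + a (- k) ^+ 2)) ->
  Num.sqrt (y * (hi - lo)) <= Hs_norm s (hart a).
Proof.
move=> ca da lohi y0 h; have [M hM] := dec_bd da; have a1 := dec_L1 (cont_meas ca) da.
rewrite /Hs_norm; apply: ler_wsqrtr.
have fin : Hs_norm2 s (hart a) \is a fin_num.
  rewrite ge0_fin_numE; first by case: (hart_in_Hs s ca da) => _ [].
  rewrite /Hs_norm2 mule_ge0 ?integral_ge0//.
    by rewrite lee_fin invr_ge0 mulr_ge0 ?pi_ge0.
  by move=> k _; rewrite lee_fin mulr_ge0 ?powR_ge0 ?addr_ge0 ?sqr_ge0.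
rewrite -lee_fin (fineK fin) (Hs_norm2_hart ca hM a1).
have lJ := L1_indic_itv lo hi.
rewrite -(I_indic_itv lohi) -(IZ _ lJ) -(EFin_I (L1_Z y lJ)).
have caN : continuous (fun k => a (- k)) by apply: (cont_comp (h := a)) => //; cont.
have cp := @cont_powR R s.
have nn k : 0 <= (1 + k ^+ 2) `^ s * (a k ^+ 2 + a (- k) ^+ 2).
  by rewrite mulr_ge0 ?powR_ge0// addr_ge0// sqr_ge0.
apply: ge0_le_integral => //.
- by move=> k _; rewrite lee_fin mulr_ge0// indicE.
- by apply/measurable_EFinP; exact: L1_measurable (L1_Z _ lJ).
- by apply/measurable_EFinP; apply: cont_meas; cont.
- move=> k _; rewrite lee_fin.
  have p1 : (1 : R) <= pi by have := @pi_ge2 R; lra.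
  apply: (@le_trans _ _ (1 * ((1 + k ^+ 2) `^ s * (a k ^+ 2 + a (- k) ^+ 2)))).
    rewrite mul1r indicE; have [|_] := boolP (k \in _); last by rewrite mulr0.
    by rewrite inE /= in_itv /= mulr1 => hk; exact: h.
  exact: ler_wpM2r.
Qed.

End Hs_lower.

(** * The envelope *)

Section periodic.
Context {R : realType}.
Implicit Types (x y z M : R).

Let w x := (1 + x ^+ 2)^-1.

Definition Cw : R := (1 + pi) * I w.

Lemma w_gt0 x : 0 < w x.
Proof. by rewrite invr_gt0; exact: oneDsqr_gt0. Qed.

Lemma cont_w : continuous w.
Proof. by apply: cont_V; [cont|move=> x; rewrite gt_eqF// oneDsqr_gt0]. Qed.

Lemma isd_V (f : R -> R) x a : f x != 0 -> isder f x a -> isder (fun x => (f x)^-1) x (- (f x) ^- 2 * a).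
Proof. by move=> f0 fa; apply: (@is_deriveV _ f x a 1 f0). Qed.

Lemma isd_atan (f : R -> R) x a : isder f x a -> isder (fun x => atan (f x)) x ((1 + f x ^+ 2)^-1 * a).
Proof.
move=> fa; apply: (@isd_comp R atan f) => //.
by apply: DeriveDef; [exact: derivable_atan|rewrite -derive1E derive1_atan].
Qed.

Lemma atan_bd x : `|atan x| <= pi.
Proof.
have := atan_gtNpi2 x; have := atan_ltpi2 x; have : (0 : R) < pi by exact: pi_gt0.
by rewrite ler_norml; move: (atan x) (pi : R) => a p; lra.
Qed.

Section M.
Variable M : R.
Hypothesis M1 : 1 <= M.

Let den x := cos x ^+ 2 + M * sin x ^+ 2.
Let den2 x := cos x ^+ 2 + M ^+ 2 * sin x ^+ 2.

Lemma den_ge1 x : 1 <= den x.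
Proof.
rewrite -(cos2Dsin2 x) /den; have := sqr_ge0 (sin x); have := M1; nra.
Qed.

Lemma den2_ge1 x : 1 <= den2 x.
Proof.
rewrite -(cos2Dsin2 x) /den2; have := sqr_ge0 (sin x); have := M1.
move: (sin x ^+ 2) (cos x ^+ 2) => s c h1 h2; have : 1 <= M ^+ 2 by nra.
by nra.
Qed.

(* [x + phase x] is the continuous branch of [atan (M * tan x)]. *)
Let phase x := atan ((M - 1) * (sin x * cos x) * (den x)^-1).

Lemma isd_phase x : is_derive x 1 phase (M / den2 x - 1).
Proof.
have d1 := den_ge1 x; have d2 := den2_ge1 x.
have d0 : den x != 0 by rewrite gt_eqF//; lra.
have d0' : den2 x != 0 by rewrite gt_eqF//; lra.
have dc : isder cos x (- sin x) := is_derive_cos x.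
have ds : isder sin x (cos x) := is_derive_sin x.
have dd : isder den x (2 * (M - 1) * (sin x * cos x)).
  rewrite /den; apply: isd_eq; first by isd.
  by move: (cos x) (sin x) => c t /=; ring.
have dn : isder (fun x => (M - 1) * (sin x * cos x)) x ((M - 1) * (cos x ^+ 2 - sin x ^+ 2)).
  apply: isd_eq; first by isd.
  by move: (cos x) (sin x) => c t /=; ring.
apply: isd_eq (isd_atan (isd_M dn (isd_V d0 dd))) _.
(* [E] and [key] hold modulo [cos^2 + sin^2 = 1]. Multiplying by powers of [cos^2 + sin^2] makes
   them homogeneous, hence provable by [ring]. *)
have E : den x ^+ 2 + ((M - 1) * (sin x * cos x)) ^+ 2 = den2 x.
  transitivity (den2 x * (cos x ^+ 2 + sin x ^+ 2)); first by rewrite /den /den2; ring.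
  by rewrite cos2Dsin2 mulr1.
have key : den x * ((M - 1) * (cos x ^+ 2 - sin x ^+ 2))
    - (M - 1) * (sin x * cos x) * (2 * (M - 1) * (sin x * cos x)) = M - den2 x.
  transitivity (M * (cos x ^+ 2 + sin x ^+ 2) ^+ 2 - den2 x * (cos x ^+ 2 + sin x ^+ 2)).
    by rewrite /den /den2; ring.
  by rewrite cos2Dsin2 expr1n !mulr1.
rewrite [RHS](_ : _ = (M - den2 x) / den2 x); last by field.
rewrite -key -E /=; rewrite -E in d0'.
move: d0 d0'; move: (den x) (cos x) (sin x) => d c t d0 d0'.
field; exact/andP.
Qed.

Lemma phase_bd x : `|phase x| <= pi.
Proof. exact: atan_bd. Qed.

Let dw x := - (2 * x * w x ^+ 2).

Lemma isd_w x : is_derive x 1 w (dw x).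
Proof.
have p0 := oneDsqr_gt0 x; have p1 : 1 + x ^+ 2 != 0 by rewrite gt_eqF.
have dp : isder (fun x => 1 + x ^+ 2) x (2 * x) by apply: isd_eq; [isd|rewrite /=; ring].
by apply: isd_eq (@isd_V (fun x => 1 + x ^+ 2) x _ p1 dp) _; rewrite /dw /w; field.
Qed.

Lemma dw_le x : `|dw x| <= w x.
Proof.
have p0 := oneDsqr_gt0 x; have w0 := w_gt0 x.
rewrite /dw normrN normrM (ger0_norm (sqr_ge0 _)) normrM (ger0_norm (_ : 0 <= 2))// expr2 mulrA.
rewrite -[leRHS]mul1r; apply: ler_wpM2r; first exact: ltW.
rewrite ler_pdivrMr// mul1r.
have := sqr_ge0 (`|x| - 1); rewrite sqrrB expr1n mulr1 real_normK ?num_real//.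
by move: `|x| (x ^+ 2) => a b; lra.
Qed.

Lemma cvg_w : w n%:R @[n --> \oo] --> (0 : R).
Proof.
apply: (squeeze_cvgr _ (cvg_cst _) (@cvg_harmonic R)).
apply: nearW => n; rewrite (ltW (w_gt0 _))/= /w /harmonic lef_pV2 ?posrE ?ltr0n ?oneDsqr_gt0//.
rewrite -natr1 addrC lerD2l -natrX ler_nat.
by case: n => // n; rewrite expnS leq_pmulr.
Qed.

Lemma L1_periodic y : L1 (fun x => (1 + (M * sin (x + y)) ^+ 2)^-1 * w x).
Proof.
apply: (L1_le (g := w)); last exact: L1_oneDsqrV.
- apply: cont_meas; apply: cont_M; last exact: cont_w.
  by apply: cont_V => [|x]; [cont|rewrite gt_eqF ?oneDsqr_gt0].
- move=> x; have w0 := ltW (w_gt0 x).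
  have p0 : 0 < 1 + (M * sin (x + y)) ^+ 2 by exact: oneDsqr_gt0.
  rewrite ger0_norm; last by apply: mulr_ge0 => //; rewrite invr_ge0 ltW.
  rewrite -[leRHS]mul1r; apply: ler_wpM2r => //.
  by rewrite invf_le1// lerDl sqr_ge0.
Qed.

(** [M / den2] is a periodic function with peaks of height [M] and mean value [1], and
    [M / den2 - 1] has the primitive [phase], bounded by [pi] for every [M]. Integration by parts
    against the slowly varying [w], with [|w'| <= w], gives [(1 + pi) * I w] uniformly in [M] and
    [y]. *)
Lemma I_periodic y : I (fun x => (1 + (M * sin (x + y)) ^+ 2)^-1 * w x) <= Cw / M.
Proof.
have m0 : 0 < M by have := M1; lra.
have L1w : L1 w by exact: L1_oneDsqrV.
have csh : continuous (fun x : R => x + y) by cont.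
have cd2 : continuous (fun x => (den2 x)^-1).
  apply: cont_V; first by rewrite /den2; cont.
  by move=> x; rewrite gt_eqF//; have := den2_ge1 x; lra.
have cdph : continuous (fun x => M / den2 (x + y) - 1).
  apply: cont_D; last by cont.
  by apply: cont_M; [cont|exact: (cont_comp cd2 csh)].
have cph : continuous (fun x => phase (x + y)).
  by apply: (@cont_comp _ phase) => //; exact: isd_cont isd_phase.
have cdw : continuous dw.
  by have cw := cont_w; rewrite /dw; cont.
have l1 : L1 (fun x => (M / den2 (x + y) - 1) * w x).
  apply: (L1_le (g := fun x => (M + 1) * w x)).
  - by apply: cont_meas; apply: cont_M => //; exact: cont_w.
  - move=> x; rewrite normrM (ger0_norm (ltW (w_gt0 x))) ler_wpM2r ?(ltW (w_gt0 x))//.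
    have d1 := den2_ge1 (x + y).
    have a0 : 0 <= M / den2 (x + y) by rewrite divr_ge0//; lra.
    have a1 : M / den2 (x + y) <= M by rewrite ler_pdivrMr; [rewrite ler_peMr//; lra|lra].
    by rewrite ler_norml; move: (M / _) a0 a1 => a; have := M1; lra.
  - exact: L1_Z.
have l2b x : `|phase (x + y) * dw x| <= pi * w x.
  by rewrite normrM ler_pM//; [exact: phase_bd|exact: dw_le].
have l2 : L1 (fun x => phase (x + y) * dw x).
  by apply: (L1_le _ l2b); [apply: cont_meas; exact: cont_M|exact: L1_Z].
have hd x : is_derive x 1 (fun x => phase (x + y) * w x)
    ((M / den2 (x + y) - 1) * w x + phase (x + y) * dw x).
  have hp : isder (fun x => phase (x + y)) x (M / den2 (x + y) - 1).
    have sh : isder (fun x : R => x + y) x 1.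
      by apply: isd_eq; [exact: isd_D (isd_id x) (isd_cst y x)|rewrite addr0].
    have := @isd_comp R phase (fun x => x + y) x _ _ (isd_phase (x + y)) sh.
    by rewrite mulr1.
  have := isd_M hp (isd_w x); rewrite addrC (mulrC (w x)); exact.
have hc : continuous (fun x => (M / den2 (x + y) - 1) * w x + phase (x + y) * dw x).
  by apply: cont_D; apply: cont_M => //; exact: cont_w.
have pw : pi * w n%:R @[n --> \oo] --> (0 : R).
  by rewrite -(mulr0 pi); apply: cvgM; [exact: cvg_cst|exact: cvg_w].
have h1 : phase (n%:R + y) * w n%:R @[n --> \oo] --> (0 : R).
  apply/norm_cvg0P; apply: (squeeze_cvgr _ (cvg_cst _) pw).
  apply: nearW => n; rewrite normr_ge0/= normrM (ger0_norm (ltW (w_gt0 _))).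
  by rewrite ler_wpM2r ?(ltW (w_gt0 _))// phase_bd.
have h2 : phase (- n%:R + y) * w (- n%:R) @[n --> \oo] --> (0 : R).
  apply/norm_cvg0P; apply: (squeeze_cvgr _ (cvg_cst _) pw).
  apply: nearW => n; rewrite normr_ge0/= normrM (ger0_norm (ltW (w_gt0 _))).
  rewrite (_ : w (- n%:R) = w n%:R); last by rewrite /w sqrrN.
  by rewrite ler_wpM2r ?(ltW (w_gt0 _))// phase_bd.
have E := I_derive0 hd hc (L1_D l1 l2) h1 h2.
rewrite (ID l1 l2) in E.
have B1 : I (fun x => (M / den2 (x + y) - 1) * w x) <= pi * I w.
  rewrite -IZ// (_ : I _ = - I (fun x => phase (x + y) * dw x)); last first.
    by move: E; move: (I _) (I _) => u v; lra.
  apply: le_trans (ler_norm _) _; rewrite normrN.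
  by apply: I_norm_le => //; [apply: cont_meas; exact: cont_M|exact: L1_Z].
rewrite ler_pdivlMr// mulrC -IZ; last exact: L1_periodic.
(* [den2 <= 1 + (M * sin)^2], and [M / den2] is split into its mean value [1] and the derivative of
   [phase]. *)
apply: (@le_trans _ _ (I (fun x => (M / den2 (x + y) - 1) * w x + w x))).
  apply: I_le; [by apply: L1_Z; exact: L1_periodic|exact: L1_D|move=> x].
  rewrite (_ : _ + w x = M / den2 (x + y) * w x); last by rewrite mulrBl mul1r subrK.
  rewrite mulrA; apply: ler_wpM2r; first exact: ltW (w_gt0 x).
  apply: ler_wpM2l; first exact: ltW.
  have d1 := den2_ge1 (x + y).
  rewrite lef_pV2 ?posrE ?oneDsqr_gt0//; last by lra.
  rewrite /den2 exprMn lerD2r -(cos2Dsin2 (x + y)) lerDl; exact: sqr_ge0.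
rewrite ID// /Cw mulrDl mul1r addrC; rewrite lerD2l; exact: B1.
Qed.
End M.
End periodic.

(** * Elementary inequalities *)

Section scalar.
Context {R : realType}.
Implicit Types (x y z u v : R).

Lemma pow_sum_le n u v : 0 <= u -> 0 <= v -> (u + v) ^+ n <= 2 ^+ n * (u ^+ n + v ^+ n).
Proof.
wlog uv : u v / u <= v => [H|] u0 v0.
  have [|/ltW] := leP u v => h; first exact: H.
  by rewrite addrC (addrC (u ^+ n)); apply: H.
apply: (@le_trans _ _ ((2 * v) ^+ n)).
  by apply: lerXn2r; rewrite ?nnegrE; [exact: addr_ge0|exact: mulr_ge0|lra].
by rewrite exprMn ler_wpM2l ?exprn_ge0// lerDr exprn_ge0.
Qed.

Lemma pow_sqr_sum_le n x y z : z ^+ 2 <= 2 * (x ^+ 2 + y ^+ 2) ->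
  (z ^+ 2) ^+ n <= 4 ^+ n * ((x ^+ 2) ^+ n + (y ^+ 2) ^+ n).
Proof.
move=> h; have x0 := sqr_ge0 x; have y0 := sqr_ge0 y.
apply: (@le_trans _ _ ((2 * (x ^+ 2 + y ^+ 2)) ^+ n)).
  by apply: lerXn2r => //; rewrite nnegrE ?sqr_ge0// mulr_ge0// addr_ge0.
rewrite exprMn (_ : 4 ^+ n = 2 ^+ n * 2 ^+ n); last by rewrite -exprMn; congr (_ ^+ _); ring.
by rewrite -mulrA ler_wpM2l ?exprn_ge0// pow_sum_le.
Qed.

Lemma sqr_sum_le x y : (x + y) ^+ 2 <= 2 * (x ^+ 2 + y ^+ 2).
Proof. by have := sqr_ge0 (x - y); rewrite sqrrB sqrrD; move: (x * y) => z; lra. Qed.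

Lemma le_pow_succ n u : 0 <= u -> u <= 1 + u ^+ n.+1.
Proof.
move=> u0; have [u1|/ltW u1] := leP u 1.
  by apply: (le_trans u1); rewrite lerDl exprn_ge0.
by apply: (@le_trans _ _ (u ^+ n.+1)); [rewrite exprS ler_peMr// exprn_ege1|rewrite lerDr].
Qed.

(** Divide [1 + z <= K * ((1 + u) + (1 + v))] by all three factors [1 + u], [1 + v], [1 + z]. A
    product of two bumps is thus traded for one bump at the sum times a sum of bumps. *)
Lemma bump_mul_le u v z K : 0 <= u -> 0 <= v -> 0 <= z -> 1 <= K -> z <= K * (u + v) ->
  (1 + u)^-1 * (1 + v)^-1 <= K * (1 + z)^-1 * ((1 + u)^-1 + (1 + v)^-1).
Proof.
move=> u0 v0 z0 K1 h.
have ha : 0 < 1 + u by lra.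
have hb : 0 < 1 + v by lra.
have hc : 0 < 1 + z by lra.
have na : 1 + u != 0 by rewrite gt_eqF.
have nb : 1 + v != 0 by rewrite gt_eqF.
have nc : 1 + z != 0 by rewrite gt_eqF.
rewrite (_ : _ * (_ + _) = (K * (1 + u + (1 + v)) / (1 + z)) * ((1 + u)^-1 * (1 + v)^-1)); last by field; rewrite na nb nc.
rewrite ler_peMl//; first by rewrite mulr_ge0// invr_ge0 ltW.
rewrite ler_pdivlMr// mul1r; nra.
Qed.

Let csin (y : R) : {for y, continuous sin}. Proof. exact: continuous_sin. Qed.
Let ccos (y : R) : {for y, continuous cos}. Proof. exact: continuous_cos. Qed.
Let dsin (y : R) : is_derive y 1 sin (cos y). Proof. exact: is_derive_sin. Qed.
Let dcos (y : R) : is_derive y 1 cos (- sin y). Proof. exact: is_derive_cos. Qed.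

Lemma sin_norm_le x : `|sin x| <= `|x|.
Proof.
wlog x0 : x / 0 <= x => [H|].
  have [|/ltW] := leP 0 x => h; first exact: H.
  by rewrite -normrN -(normrN x) -sinN; apply: H; rewrite oppr_ge0.
rewrite (ger0_norm x0).
have := derive_norm_le x0 (fun z _ => @csin z) (fun z _ => @cont_id R z) (fun z _ => dsin z)
  (fun z _ => isd_id z) (fun z _ => cos_max z).
by rewrite sin0 !subr0.
Qed.

Lemma cos_ge x : 1 - x ^+ 2 / 2 <= cos x.
Proof.
wlog x0 : x / 0 <= x => [H|].
  have [|/ltW] := leP 0 x => h; first exact: H.
  by rewrite -cosN -sqrrN; apply: H; rewrite oppr_ge0.
suff : - (x ^+ 2 / 2) - - (0 ^+ 2 / 2) <= cos x - cos 0.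
  by rewrite cos0 expr0n/= mul0r oppr0 subr0; move: (cos x) => c; lra.
have dq z : is_derive z 1 (fun y : R => - (y ^+ 2 / 2)) (- z).
  by apply: isd_eq; [isd|rewrite /=; field].
have h z : 0 < z < x -> - z <= - sin z.
  move=> /andP[z0 _]; rewrite lerN2; apply: (le_trans (ler_norm _)).
  by apply: (le_trans (sin_norm_le z)); rewrite gtr0_norm.
exact: (derive_mono x0 (fun z _ => isd_cont_at (dq z)) (fun z _ => @ccos z) (fun z _ => dq z)
  (fun z _ => dcos z) h).
Qed.

Lemma cos_ge_half x : `|x| <= 1 -> 2^-1 <= cos x.
Proof.
move=> x1; apply: le_trans (cos_ge x).
have : x ^+ 2 <= 1 by rewrite -real_normK ?num_real// exprn_ile1.
by move: (x ^+ 2) => q; lra.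
Qed.

Lemma sin_ge_half x : `|x| <= 1 -> `|x| / 2 <= `|sin x|.
Proof.
wlog x0 : x / 0 <= x => [H|].
  have [|/ltW] := leP 0 x => h; first exact: H.
  by rewrite -normrN -(normrN (sin x)) -sinN; apply: H; rewrite oppr_ge0.
rewrite ger0_norm// => x1.
have dh z : is_derive z 1 (fun y : R => y / 2) 2^-1.
  by apply: isd_eq; [isd|rewrite /=; ring].
apply: le_trans (ler_norm _).
suff : x / 2 - 0 / 2 <= sin x - sin 0 by rewrite sin0 mul0r !subr0.
have h z : 0 < z < x -> 2^-1 <= cos z.
  move=> /andP[z0 zx]; apply: cos_ge_half; rewrite gtr0_norm//.
  by apply: ltW; exact: lt_le_trans zx x1.
exact: (derive_mono x0 (fun z _ => isd_cont_at (dh z)) (fun z _ => @csin z) (fun z _ => dh z)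
  (fun z _ => dsin z) h).
Qed.

End scalar.

(** * The comb and its convolution with itself *)

Section envelope.
Context {R : realType}.
Implicit Types (x y z u v k e : R).

Variables (m be th : R) (p : nat).
Hypotheses (m1 : 1 <= m) (be0 : 0 < be) (be1 : be <= 1) (th0 : 0 < th) (th1 : th <= 1).

Let P := p.+1.
Let w x := (1 + x ^+ 2)^-1 : R.
Let m0 : 0 < m. Proof. by have := m1; lra. Qed.

(** Near each multiple of [pi * m], [(m / be) * sin (k / m)] is up to sign about the distance to it
    in units of [be], so that [W1] has teeth of width [be] there. The power [P], at least [s] in the
    application, lets a tooth absorb the Sobolev weight. *)
Definition comb k := (((m / be) * sin (k / m)) ^+ 2) ^+ P.
(** [W2] is about [1] close to zero and at most [th] from [|k| = m] on; [th] is the height of the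
    carrier relative to the bump at frequency zero. *)
Definition poly_growth k := th^-1 * ((k / m) ^+ 2) ^+ P.
Let W1 k := (1 + comb k)^-1.
Let W2 k := (1 + poly_growth k)^-1.
Definition env k := W1 k * W2 k.

Let comb_ge0 k : 0 <= comb k.
Proof. by rewrite exprn_ge0// sqr_ge0. Qed.

Let poly_growth_ge0 k : 0 <= poly_growth k.
Proof. by apply: mulr_ge0; [rewrite invr_ge0 ltW|rewrite exprn_ge0// sqr_ge0]. Qed.

Lemma bump_itv u : 0 <= u -> 0 < (1 + u)^-1 <= 1.
Proof. by move=> u0; rewrite invr_gt0 invf_le1 ?lerDl ?u0 ?andbT; lra. Qed.

Let W1_itv k : 0 < W1 k <= 1. Proof. exact: bump_itv. Qed.
Let W2_itv k : 0 < W2 k <= 1. Proof. exact: bump_itv. Qed.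
Let W1_ge0 k : 0 <= W1 k. Proof. by case/andP: (W1_itv k) => /ltW. Qed.
Let W2_ge0 k : 0 <= W2 k. Proof. by case/andP: (W2_itv k) => /ltW. Qed.
Let W1_le1 k : W1 k <= 1. Proof. by case/andP: (W1_itv k). Qed.
Let W2_le1 k : W2 k <= 1. Proof. by case/andP: (W2_itv k). Qed.

Let combN k : comb (- k) = comb k.
Proof. by rewrite /comb mulNr sinN mulrN sqrrN. Qed.

Let poly_growthN k : poly_growth (- k) = poly_growth k.
Proof. by rewrite /poly_growth mulNr sqrrN. Qed.

Lemma env_gt0 k : 0 < env k.
Proof. by rewrite mulr_gt0//; [case/andP: (W1_itv k)|case/andP: (W2_itv k)]. Qed.

Lemma env_le1 k : env k <= 1.
Proof. by rewrite /env -[leRHS]mul1r ler_pM. Qed.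

Lemma envN k : env (- k) = env k.
Proof. by rewrite /env /W1 /W2 combN poly_growthN. Qed.

Let cont_W1 : continuous W1.
Proof.
apply: cont_V; first by rewrite /comb; cont.
by move=> k; rewrite gt_eqF//; have := comb_ge0 k; lra.
Qed.

Let cont_W2 : continuous W2.
Proof.
apply: cont_V; first by rewrite /poly_growth; cont.
by move=> k; rewrite gt_eqF//; have := poly_growth_ge0 k; lra.
Qed.

Lemma cont_env : continuous env.
Proof. exact: cont_M. Qed.

Let K : R := 4 ^+ P.

Let K1 : 1 <= K.
Proof. by rewrite /K exprn_ege1//; lra. Qed.

Let comb_sum x y : comb (x + y) <= K * (comb x + comb y).
Proof.
have E a : (m / be * a) ^+ 2 = (m / be) ^+ 2 * a ^+ 2 by rewrite exprMn.
apply: pow_sqr_sum_le; rewrite !E -mulrDr [leRHS]mulrCA; apply: ler_wpM2l; first exact: sqr_ge0.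
rewrite mulrDl sinD; apply: le_trans (sqr_sum_le _ _) _.
rewrite ler_wpM2l// !exprMn; apply: lerD.
  by rewrite ler_piMr ?sqr_ge0// -(cos2Dsin2 (y / m)) lerDl sqr_ge0.
by rewrite ler_piMl ?sqr_ge0// -(cos2Dsin2 (x / m)) lerDl sqr_ge0.
Qed.

Let poly_growth_sum x y : poly_growth (x + y) <= K * (poly_growth x + poly_growth y).
Proof.
rewrite /poly_growth -mulrDr [leRHS]mulrCA; apply: ler_wpM2l; first by rewrite invr_ge0 ltW.
by apply: pow_sqr_sum_le; rewrite mulrDl; exact: sqr_sum_le.
Qed.

(* Both factors are [(1 + d)^-1] with [d (x + y) <= K (d x + d y)], which makes the product of two
   translates comparable to the envelope at the sum. *)
Lemma env_mul_le x y :
  env x * env y <= K ^+ 2 * env (x + y) * ((W1 x + W1 y) * (W2 x + W2 y)).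
Proof.
have h1 := bump_mul_le (comb_ge0 x) (comb_ge0 y) (comb_ge0 (x + y)) K1 (comb_sum x y).
have h2 := bump_mul_le (poly_growth_ge0 x) (poly_growth_ge0 y) (poly_growth_ge0 (x + y)) K1
  (poly_growth_sum x y).
have := ler_pM (mulr_ge0 (W1_ge0 x) (W1_ge0 y)) (mulr_ge0 (W2_ge0 x) (W2_ge0 y)) h1 h2.
rewrite -/(W1 _) -/(W1 _) -/(W1 _) -/(W2 _) -/(W2 _) -/(W2 _) /env.
by rewrite mulrACA => /le_trans; apply; apply: eq_le; ring.
Qed.

Let W1_le k : W1 k <= 2 * (1 + (m / be * sin (k / m)) ^+ 2)^-1.
Proof.
have a0 := sqr_ge0 (m / be * sin (k / m)); have h := le_pow_succ p a0.
have p1 := oneDsqr_gt0 (m / be * sin (k / m)).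
have c0 := comb_ge0 k.
rewrite -[leLHS]div1r ler_pdivrMr; last by lra.
rewrite mulrAC ler_pdivlMr// mul1r; move: h; rewrite -/P -/(comb k); lra.
Qed.

Let W2_le k : W2 k <= 2 * w (k / m).
Proof.
have a0 := sqr_ge0 (k / m); have h := le_pow_succ p a0.
have p1 := oneDsqr_gt0 (k / m).
have c0 := poly_growth_ge0 k.
have h' : ((k / m) ^+ 2) ^+ P <= poly_growth k.
  by apply: ler_peMl; [exact: exprn_ge0|rewrite invf_ge1].
rewrite -[leLHS]div1r ler_pdivrMr; last by lra.
rewrite mulrAC ler_pdivlMr// mul1r; move: h; rewrite -/P; lra.
Qed.

Let Mge1 : 1 <= m / be.
Proof. by rewrite ler_pdivlMr// mul1r; have := m1; have := be1; lra. Qed.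

Let crossw z := (fun e => (1 + (m / be * sin ((z - e) / m)) ^+ 2)^-1 * w (e / m)).

Let crosswE z e : crossw z e =
  (fun x => (1 + (m / be * sin (x + - (z / m))) ^+ 2)^-1 * w x) (m^-1 * e + 0).
Proof.
rewrite /crossw addr0 (mulrC m^-1); congr (_ ^-1 * _); congr (1 + _).
by rewrite -[in LHS]sqrrN -mulrN -sinN -mulNr opprB mulrBl.
Qed.

Let mV0 : m^-1 != 0. Proof. by rewrite invr_eq0 gt_eqF. Qed.

Let L1_crossw z : L1 (crossw z).
Proof. by rewrite (funext (crosswE z)); exact: (L1_affine 0 mV0 (@L1_periodic R (m / be) (- (z / m)))). Qed.

(** Rescaling the variable by [m] reduces to [I_periodic] with [M = m / be], and
    [m * (Cw / (m / be)) = Cw * be]. *)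
Let I_crossw z : I (crossw z) <= Cw * be.
Proof.
rewrite (funext (crosswE z)); have l := @L1_periodic R (m / be) (- (z / m)).
have := I_affine 0 mV0 l; have h := @I_periodic R (m / be) Mge1 (- (z / m)).
rewrite ger0_norm; last by rewrite invr_ge0 ltW.
move=> E; rewrite {}E in h; move: h; set A := I _.
rewrite (_ : Cw / (m / be) = m^-1 * (Cw * be)); last by field; rewrite !gt_eqF.
by rewrite ler_pM2l// invr_gt0.
Qed.

Let cont_refl (f : R -> R) z : continuous f -> continuous (fun e : R => f (z - e)).
Proof. by move=> cf; apply: (cont_comp (h := f)) => //; cont. Qed.

Let cross z e := W1 (z - e) * W2 e.

Let cross_ge0 z e : 0 <= cross z e. Proof. exact: mulr_ge0. Qed.

Let cross_le z e : cross z e <= 4 * crossw z e.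
Proof.
rewrite /cross /crossw (_ : 4 * _ = 2 * (1 + (m / be * sin ((z - e) / m)) ^+ 2)^-1 * (2 * w (e / m))).
  by apply: ler_pM; [exact: W1_ge0|exact: W2_ge0|exact: W1_le|exact: W2_le].
by move: (_^-1) (w _) => a b; ring.
Qed.

Let L1_cross z : L1 (cross z).
Proof.
apply: (L1_le (g := fun e => 4 * crossw z e)); last by apply: L1_Z; exact: L1_crossw.
  by apply: cont_meas; apply: cont_M => //; exact: cont_refl.
by move=> e; rewrite ger0_norm//; exact: cross_le.
Qed.

Let I_cross z : I (cross z) <= 4 * (Cw * be).
Proof.
apply: (@le_trans _ _ (I (fun e => 4 * crossw z e))).
  by apply: I_le; [exact: L1_cross|apply: L1_Z; exact: L1_crossw|exact: cross_le].
by rewrite (IZ _ (L1_crossw z)) ler_wpM2l.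
Qed.

Let cross0 e : W1 e * W2 e = cross 0 e.
Proof. by rewrite /cross sub0r /W1 combN. Qed.

Let crossr z e : W1 e * W2 (z - e) = cross z (z - e).
Proof. by rewrite /cross subKr. Qed.

Lemma L1_env : L1 env.
Proof. by rewrite (_ : env = cross 0); [exact: L1_cross|apply/funext => e; rewrite -cross0]. Qed.

(** In [env_mul_le] each product of a comb factor with a decay factor is [cross 0] or [cross z], up
    to the reflection of [e] into [z - e]. All four therefore have integral [O(be)]: the convolution
    costs only the width of one tooth, although the comb has infinitely many. *)
Lemma env_conv z : I (fun e => env (z - e) * env e) <= K ^+ 2 * (16 * (Cw * be)) * env z.
Proof.
pose G e := cross 0 (z - e) + cross z e + (cross z (z - e) + cross 0 e).
have l1 := L1_refl z (L1_cross 0); have l2 := L1_cross z.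
have l3 := L1_refl z (L1_cross z); have l4 := L1_cross 0.
have lG : L1 G by apply: L1_D; apply: L1_D.
have IG : I G <= 16 * (Cw * be).
  rewrite /G (ID (L1_D l1 l2) (L1_D l3 l4)) (ID l1 l2) (ID l3 l4).
  rewrite (I_refl z (L1_cross 0)) (I_refl z (L1_cross z)).
  have := I_cross 0; have := I_cross z; move: (I _) (I _) (Cw * be) => a b c; lra.
have le e : env (z - e) * env e <= K ^+ 2 * env z * G e.
  have := env_mul_le (z - e) e; rewrite subrK => /le_trans; apply.
  apply: ler_wpM2l; first by rewrite mulr_ge0 ?sqr_ge0// ltW// env_gt0.
  rewrite /G -crossr -!cross0 /cross mulrDl !mulrDr.
  by apply: eq_le; ring.
have ge e : 0 <= env (z - e) * env e by rewrite mulr_ge0// ltW// env_gt0.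
have lE : L1 (fun e => env (z - e) * env e).
  apply: (L1_le (g := fun e => K ^+ 2 * env z * G e)); last exact: L1_Z.
    by apply: cont_meas; apply: cont_M; [apply: cont_refl|]; exact: cont_env.
  by move=> e; rewrite ger0_norm.
apply: (@le_trans _ _ (K ^+ 2 * env z * I G)).
  by rewrite -(IZ _ lG); apply: I_le => //; exact: L1_Z.
rewrite [leRHS]mulrAC; apply: ler_wpM2l => //.
by rewrite mulr_ge0 ?sqr_ge0// ltW// env_gt0.
Qed.

Lemma env_le_th k : m <= `|k| -> env k <= th.
Proof.
move=> mk; apply: (@le_trans _ _ (W2 k)); first by rewrite /env ler_piMl.
have h : 1 <= ((k / m) ^+ 2) ^+ P.
  apply: exprn_ege1; rewrite -real_normK ?num_real// exprn_ege1//.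
  by rewrite normrM (gtr0_norm (_ : 0 < m^-1)) ?invr_gt0// ler_pdivlMr// mul1r.
rewrite -[leRHS]invrK lef_pV2 ?posrE ?invr_gt0//; last by have := poly_growth_ge0 k; lra.
have : th^-1 <= poly_growth k by rewrite /poly_growth ler_peMr// invr_ge0 ltW.
lra.
Qed.

Let W1_half k j : sin (k / m) ^+ 2 = sin (j / m) ^+ 2 -> `|j| <= be -> 2^-1 <= W1 k.
Proof.
move=> E jb; rewrite lef_pV2 ?posrE//; last by have := comb_ge0 k; lra.
suff : comb k <= 1 by lra.
have F a : (m / be * a) ^+ 2 = (m / be) ^+ 2 * a ^+ 2 by rewrite exprMn.
rewrite /comb F E -F; apply: exprn_ile1; first exact: sqr_ge0.
rewrite -real_normK ?num_real// exprn_ile1//.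
rewrite normrM (ger0_norm (_ : 0 <= m / be)); last by rewrite divr_ge0 ?ltW.
apply: (@le_trans _ _ (m / be * `|j / m|)); first by rewrite ler_wpM2l ?sin_norm_le// divr_ge0 ?ltW.
rewrite normrM (gtr0_norm (_ : 0 < m^-1)) ?invr_gt0//.
rewrite (_ : _ * _ = `|j| / be); last by field; rewrite !gt_eqF.
by rewrite ler_pdivrMr// mul1r.
Qed.

Lemma env_ge_near0 k : `|k| <= be -> 1 <= th * (m ^+ 2) ^+ P -> 4^-1 <= env k.
Proof.
move=> kb h.
have a1 : 2^-1 <= W1 k by exact: (@W1_half k k).
suff a2 : 2^-1 <= W2 k.
  rewrite (_ : 4^-1 = 2^-1 * 2^-1); last by field.
  by apply: ler_pM.
rewrite lef_pV2 ?posrE//; last by have := poly_growth_ge0 k; lra.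
suff : poly_growth k <= 1 by lra.
rewrite /poly_growth mulrC ler_pdivrMr// mul1r.
rewrite expr_div_n expr_div_n ler_pdivrMr ?exprn_gt0//.
apply: le_trans h; apply: exprn_ile1; first exact: sqr_ge0.
by rewrite -real_normK ?num_real// exprn_ile1//; have := be1; lra.
Qed.

Lemma env_ge_carrier k : `|k - pi * m| <= be -> th / (2 * (1 + 36 ^+ P)) <= env k.
Proof.
move=> kb.
have a1 : 2^-1 <= W1 k.
  apply: (@W1_half k (k - pi * m)) => //.
  by rewrite mulrBl mulfK ?gt_eqF// sinB sinpi cospi mulr0 subr0 mulrN1 sqrrN.
suff a2 : th / (1 + 36 ^+ P) <= W2 k.
  rewrite (_ : th / _ = 2^-1 * (th / (1 + 36 ^+ P))).
    by apply: ler_pM => //; rewrite divr_ge0// ?ltW// addr_ge0// exprn_ge0.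
  have : 1 + 36 ^+ P != 0 :> R by rewrite gt_eqF// addr_gt0// exprn_gt0.
  by move=> ?; field.
(* [|k| <= pi * m + be <= 6 * m], whence [36]. *)
have h : ((k / m) ^+ 2) ^+ P <= 36 ^+ P.
  apply: lerXn2r; rewrite ?nnegrE ?sqr_ge0//.
  rewrite (_ : 36 = 6 ^+ 2); last by ring.
  rewrite -real_normK ?num_real//; apply: lerXn2r; rewrite ?nnegrE//.
  rewrite normrM (gtr0_norm (_ : 0 < m^-1)) ?invr_gt0// ler_pdivrMr//.
  have -> : k = (k - pi * m) + pi * m by rewrite subrK.
  apply: le_trans (ler_normD _ _) _.
  rewrite normrM (gtr0_norm m0) (gtr0_norm (pi_gt0 R)).
  have pim : pi * m <= 4 * m by apply: ler_wpM2r; [exact: ltW|have := @pihalf_lt2 R; move: (pi : R) => q; lra].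
  apply: (@le_trans _ _ (be + 4 * m)); first exact: lerD.
  by have := m1; have := be1; lra.
have g1 : 0 < 1 + 36 ^+ P :> R by rewrite addr_gt0// exprn_gt0.
rewrite -[leLHS]invrK lef_pV2 ?posrE; last 2 first.
- by rewrite invr_gt0 divr_gt0.
- by have := poly_growth_ge0 k; lra.
rewrite invf_div ler_pdivlMr// mulrDl mul1r; apply: lerD => //.
rewrite /poly_growth mulrAC mulVf ?gt_eqF// mul1r//.
Qed.

Lemma powR_oneDsqr_le (s k : R) : s <= P%:R -> (1 + k ^+ 2) `^ s <= (1 + k ^+ 2) ^+ P.
Proof.
move=> sP; rewrite -[leRHS]powR_mulrn; last exact: ltW (oneDsqr_gt0 k).
by apply: ler_powR => //; rewrite lerDl sqr_ge0.
Qed.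

(** For [|k| <= m], [comb k >= (k^2 / 4)^P] and the factor [W1] absorbs the Sobolev weight. For
    [|k| > m] and [x = k / m], the weight is at most [2^P * m^(2 s) * x^(2 P)], and
    [W2^2 <= th^2 * x^(- 4 P)] absorbs it with a power to spare for [w x]. *)
Lemma env_energy_le (s k : R) : 0 <= s -> s <= P%:R ->
  (1 + k ^+ 2) `^ s * env k ^+ 2 <= 2 * 8 ^+ P * (1 + (m `^ s * th) ^+ 2) * (2 * crossw 0 k).
Proof.
move=> s0 sP.
have w0 : 0 <= w (k / m) by rewrite invr_ge0 ltW// oneDsqr_gt0.
have c0 := sqr_ge0 (m `^ s * th).
have W1w : W1 k * w (k / m) <= 2 * crossw 0 k.
  rewrite /crossw mulrA; apply: ler_wpM2r => //.
  by apply: le_trans (W1_le k) _; rewrite sub0r mulNr sinN mulrN sqrrN.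
have a8 : 0 <= 8 ^+ P :> R by rewrite exprn_ge0.
suff H : (1 + k ^+ 2) `^ s * env k ^+ 2 <= 2 * 8 ^+ P * (1 + (m `^ s * th) ^+ 2) * (W1 k * w (k / m)).
  apply: le_trans H _; apply: ler_wpM2l => //.
  by rewrite mulr_ge0// ?mulr_ge0// addr_ge0.
have [km|km] := leP `|k| m.
- have xk : `|k / m| <= 1.
    by rewrite normrM (gtr0_norm (_ : 0 < m^-1)) ?invr_gt0// ler_pdivrMr// mul1r.
  have x2 : (k / m) ^+ 2 <= 1 by rewrite -real_normK ?num_real// exprn_ile1.
  have wk : 2^-1 <= w (k / m).
    by rewrite lef_pV2 ?posrE ?oneDsqr_gt0//; move: x2; move: (_ ^+ 2) => q; lra.
  have D1 : (k ^+ 2 / 4) ^+ P <= comb k.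
    apply: lerXn2r; rewrite ?nnegrE ?divr_ge0 ?sqr_ge0//.
    rewrite (_ : k ^+ 2 / 4 = (`|k| / 2) ^+ 2); last first.
      by rewrite -(real_normK (num_real k)); field.
    rewrite -[leRHS]real_normK ?num_real//; apply: lerXn2r; rewrite ?nnegrE ?divr_ge0//.
    rewrite normrM (ger0_norm (_ : 0 <= m / be)); last by rewrite divr_ge0 ?ltW.
    have := sin_ge_half xk; rewrite normrM (gtr0_norm (_ : 0 < m^-1)) ?invr_gt0// => hs.
    apply: (@le_trans _ _ (m / be * (`|k| / m / 2))).
      rewrite (_ : m / be * _ = be^-1 * (`|k| / 2)); last by field; rewrite !gt_eqF.
      by rewrite ler_peMl ?divr_ge0// invf_ge1.
    by apply: ler_wpM2l => //; rewrite divr_ge0 ?ltW.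
  have A : (1 + k ^+ 2) `^ s <= 8 ^+ P * (1 + comb k).
    apply: le_trans (powR_oneDsqr_le k sP) _.
    apply: le_trans (pow_sum_le _ _ _) _ => //; first exact: sqr_ge0.
    rewrite (_ : 8 ^+ P = 2 ^+ P * 4 ^+ P); last by rewrite -exprMn; congr (_ ^+ _); ring.
    rewrite -mulrA; apply: ler_wpM2l; first by rewrite exprn_ge0.
    rewrite expr1n mulrDr mulr1; apply: lerD; first by rewrite exprn_ege1//; lra.
    rewrite (_ : (k ^+ 2) ^+ P = 4 ^+ P * (k ^+ 2 / 4) ^+ P).
      by apply: ler_wpM2l => //; rewrite exprn_ge0.
    by rewrite -exprMn; congr (_ ^+ _); field.
  have B : (1 + k ^+ 2) `^ s * W1 k <= 8 ^+ P.
    by rewrite /W1 ler_pdivrMr//; have := comb_ge0 k; lra.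
  rewrite (_ : _ * env k ^+ 2 = ((1 + k ^+ 2) `^ s * W1 k) * (W1 k * W2 k ^+ 2)); last first.
    by rewrite /env; ring.
  apply: (@le_trans _ _ (8 ^+ P * (W1 k * (2 * w (k / m))))).
    apply: ler_pM => //; first by rewrite mulr_ge0 ?powR_ge0.
      by rewrite mulr_ge0 ?sqr_ge0.
    apply: ler_wpM2l => //; apply: (@le_trans _ _ 1); first exact: exprn_ile1.
    by move: wk; move: (w _) => q; lra.
  rewrite (_ : 8 ^+ P * _ = 2 * 8 ^+ P * 1 * (W1 k * w (k / m))); last by ring.
  apply: ler_wpM2r; first exact: mulr_ge0.
  by apply: ler_wpM2l; [exact: mulr_ge0|rewrite lerDl].
- set x := k / m; have x1 : 1 <= x ^+ 2.
    rewrite -real_normK ?num_real// exprn_ege1//.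
    by rewrite normrM (gtr0_norm (_ : 0 < m^-1)) ?invr_gt0// ler_pdivlMr// mul1r ltW.
  have xP1 : 1 <= (x ^+ 2) ^+ P by exact: exprn_ege1.
  have xP0 : 0 < (x ^+ 2) ^+ P by lra.
  have A : (1 + k ^+ 2) `^ s <= 2 ^+ P * (m `^ s) ^+ 2 * (x ^+ 2) ^+ P.
    have kE : k = m * x by rewrite /x mulrC divfK// gt_eqF.
    have k1 : 1 + k ^+ 2 <= 2 * (m * m) * x ^+ 2.
      have : 1 <= (m * m) * x ^+ 2.
        by apply: mulr_ege1 => //; apply: mulr_ege1.
      have -> : k ^+ 2 = m * m * x ^+ 2 by rewrite {1}kE; ring.
      by rewrite -(mulrA 2); move: (m * m * x ^+ 2) => q; lra.
    apply: (@le_trans _ _ ((2 * (m * m) * x ^+ 2) `^ s)).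
      apply: ge0_ler_powR => //; rewrite nnegrE; first exact: ltW (oneDsqr_gt0 k).
      by apply: le_trans k1; exact: ltW (oneDsqr_gt0 k).
    have m0' := ltW m0; have mm0 : 0 <= m * m by exact: mulr_ge0.
    rewrite (powRM _ (mulr_ge0 (_ : 0 <= 2) mm0) (sqr_ge0 x))// (powRM _ _ mm0)// (powRM _ m0' m0').
    rewrite -expr2; apply: ler_pM.
    + by rewrite mulr_ge0 ?powR_ge0 ?sqr_ge0.
    + exact: powR_ge0.
    + apply: ler_wpM2r; first exact: sqr_ge0.
      by rewrite -[leRHS]powR_mulrn//; apply: ler_powR => //; lra.
    + by rewrite -[leRHS]powR_mulrn ?sqr_ge0//; exact: ler_powR.
  have B : W2 k <= th / (x ^+ 2) ^+ P.
    rewrite -[leRHS]invrK lef_pV2 ?posrE; last 2 first.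
    + by have := poly_growth_ge0 k; lra.
    + by rewrite invr_gt0 divr_gt0.
    by rewrite invf_div mulrC; rewrite -/(poly_growth k) lerDr.
  have C : W2 k ^+ 2 * (x ^+ 2) ^+ P <= th ^+ 2 * (2 * w x).
    apply: (@le_trans _ _ ((th / (x ^+ 2) ^+ P) ^+ 2 * (x ^+ 2) ^+ P)).
      apply: ler_wpM2r; first exact: ltW.
      by apply: lerXn2r; rewrite ?nnegrE// divr_ge0 ?ltW.
    rewrite (_ : _ * (x ^+ 2) ^+ P = th ^+ 2 * ((x ^+ 2) ^+ P)^-1); last by field; rewrite gt_eqF.
    apply: ler_wpM2l; first exact: sqr_ge0.
    rewrite -[leLHS]div1r ler_pdivrMr// mulrAC ler_pdivlMr ?oneDsqr_gt0// mul1r.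
    have : x ^+ 2 <= (x ^+ 2) ^+ P by rewrite [leRHS]exprS ler_peMr ?sqr_ge0// exprn_ege1.
    by move: xP1; move: ((x ^+ 2) ^+ P) (x ^+ 2) => u v; lra.
  rewrite (_ : _ * env k ^+ 2 = ((1 + k ^+ 2) `^ s * W2 k ^+ 2) * (W1 k * W1 k)); last first.
    by rewrite /env; ring.
  apply: (@le_trans _ _ (2 ^+ P * (m `^ s) ^+ 2 * (th ^+ 2 * (2 * w x)) * (W1 k * 1))).
    apply: ler_pM; rewrite ?mulr_ge0 ?powR_ge0 ?sqr_ge0//; last by apply: ler_wpM2l.
    apply: (@le_trans _ _ (2 ^+ P * (m `^ s) ^+ 2 * (x ^+ 2) ^+ P * W2 k ^+ 2)).
      by apply: ler_wpM2r => //; exact: sqr_ge0.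
    rewrite -mulrA (mulrC ((x ^+ 2) ^+ P)); apply: ler_wpM2l => //.
    by rewrite mulr_ge0 ?sqr_ge0 ?exprn_ge0.
  rewrite (_ : _ * (W1 k * 1) = 2 * 2 ^+ P * (m `^ s * th) ^+ 2 * (W1 k * w x)); last first.
    by move: (m `^ s) (w x) (W1 k) => a b c; ring.
  apply: ler_wpM2r; first exact: mulr_ge0.
  apply: ler_pM; [by rewrite mulr_ge0 ?exprn_ge0|exact: c0| |by rewrite lerDr].
  by apply: ler_wpM2l => //; apply: lerXn2r; rewrite ?nnegrE//; lra.
Qed.

Lemma L1_env_energy (s : R) : 0 <= s -> s <= P%:R -> L1 (fun k => (1 + k ^+ 2) `^ s * env k ^+ 2).
Proof.
move=> s0 sP.
apply: (L1_le (g := fun k => 2 * 8 ^+ P * (1 + (m `^ s * th) ^+ 2) * (2 * crossw 0 k))).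
- apply: cont_meas; apply: cont_M; first exact: (@cont_powR R s).
  by apply: cont_X; exact: cont_env.
- move=> k; rewrite ger0_norm; first exact: env_energy_le.
  by rewrite mulr_ge0 ?powR_ge0 ?sqr_ge0.
- by apply: L1_Z; apply: L1_Z; exact: L1_crossw.
Qed.

Lemma env_energy (s : R) : 0 <= s -> s <= P%:R ->
  I (fun k => (1 + k ^+ 2) `^ s * env k ^+ 2) <=
    2 * 8 ^+ P * (1 + (m `^ s * th) ^+ 2) * (2 * (Cw * be)).
Proof.
move=> s0 sP.
have l2 : L1 (fun k => 2 * crossw 0 k) by apply: L1_Z; exact: L1_crossw.
apply: (@le_trans _ _ (2 * 8 ^+ P * (1 + (m `^ s * th) ^+ 2) * I (fun k => 2 * crossw 0 k))).
  rewrite -(IZ _ l2); apply: I_le; [exact: L1_env_energy|exact: L1_Z|].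
  by move=> k; exact: env_energy_le.
rewrite (IZ _ (L1_crossw 0)); apply: ler_wpM2l; last by rewrite ler_wpM2l.
by rewrite !mulr_ge0 ?exprn_ge0// addr_ge0 ?sqr_ge0.
Qed.

End envelope.

(** * The interaction of the bump with the carrier *)

Section interaction.
Context {R : realType}.
Implicit Types (x y z k e t : R).

Variables (l H : R -> R) (M r : R).
Hypotheses (cl : continuous l) (cH : continuous H) (lM : forall x, `|l x| <= M)
  (HM : forall x, `|H x| <= M) (l1 : L1 l) (H1 : L1 H) (lN : forall x, l (- x) = l x)
  (lr : forall x, r <= `|x| -> l x = 0).

Lemma L1_bdmul (f b : R -> R) (C : R) : continuous f -> (forall x, `|f x| <= C) -> L1 b ->
  L1 (fun e => f e * b e).
Proof. by move=> cf; apply: L1_mull; exact: cont_meas. Qed.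

Lemma cont_Qker (f : R -> R) z : continuous f -> continuous (Qker f z).
Proof.
move=> cf.
have c1 : continuous (fun e => f (z + e)) by apply: (cont_comp cf); cont.
have c2 : continuous (fun e => f (e - z)) by apply: (cont_comp cf); cont.
have c3 : continuous (fun e => f (z - e)) by apply: (cont_comp cf); cont.
have c4 : continuous (fun e => f (- z - e)) by apply: (cont_comp cf); cont.
exact: cont_D (cont_D (cont_D c1 c2) c3) (cont_N c4).
Qed.

Lemma Qker_bd (f : R -> R) (C : R) z e : (forall x, `|f x| <= C) -> `|Qker f z e| <= 4 * C.
Proof.
move=> fC; rewrite /Qker; have a1 := fC (z + e); have a2 := fC (e - z).
have a3 := fC (z - e); have a4 := fC (- z - e).
move: a1 a2 a3 a4; rewrite !ler_norml; lra.
Qed.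

(** [l] against itself vanishes, because [|z|] exceeds twice the radius of its support. In each of
    the two mixed terms evenness of [l] cancels two of the four translates, and the remaining ones
    are equal. *)
Lemma Q_cross z : 0 <= r -> 2 * r < `|z| ->
  Q (fun k => l k + H k) (fun k => l k + H k) z - Q H H z = 2 * I (fun e => l (z - e) * H e).
Proof.
move=> r0 rz.
have cp : continuous (fun e : R => z + e) by cont.
have cm : continuous (fun e : R => z - e) by cont.
have cp' : continuous (fun e : R => e - z) by cont.
have cm' : continuous (fun e : R => - z - e) by cont.
have lHc : continuous (fun k => l k + H k) by exact: cont_D.
have lHM x : `|l x + H x| <= M + M by apply: (le_trans (ler_normD _ _)); exact: lerD.
pose cv e := l (z - e) * H e.
have Lc : L1 cv by apply: (@L1_bdmul _ _ M) => //; exact: cont_comp.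
have L3 : L1 (fun e => Qker H z e * l e).
  by apply: (@L1_bdmul _ _ (4 * M)) => // [|x]; [exact: cont_Qker|exact: Qker_bd].
have LA : L1 (fun e => Qker (fun k => l k + H k) z e * (l e + H e)).
  apply: (@L1_bdmul _ (fun e => l e + H e) (4 * (M + M))); last exact: L1_D.
    exact: cont_Qker.
  by move=> x; exact: Qker_bd.
have LB : L1 (fun e => Qker H z e * H e).
  by apply: (@L1_bdmul _ _ (4 * M)) => // [|x]; [exact: cont_Qker|exact: Qker_bd].
have far x y : `|z| <= `|x| + `|y| -> l x * l y = 0.
  move=> h; have [hx|hx] := leP r `|x|; first by rewrite (lr hx) mul0r.
  rewrite [l y]lr ?mulr0//; move: h rz hx; move: `|z| `|x| `|y| => a b c; lra.
have E e : Qker (fun k => l k + H k) z e * (l e + H e) - Qker H z e * H e =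
    2 * cv e + Qker H z e * l e.
  have z2 : l (z - e) * l e = 0.
    by apply: far; rewrite -{1}(subrK e z) (le_trans (ler_normD _ _)).
  rewrite /cv /Qker -(opprB z e) -opprD !lN.
  by rewrite -[RHS]addr0 -[X in _ = _ + X](mulr0 2) -[X in _ = _ + 2 * X]z2; ring.
have I3 : I (fun e => Qker H z e * l e) = 2 * I cv.
  have b (f : R -> R) : continuous f -> L1 (fun e => H (f e) * l e).
    by move=> cf; apply: (@L1_bdmul _ _ M) => //; exact: (cont_comp cH).
  have e1 : I (fun e => H (z - e) * l e) = I cv.
    rewrite -(I_refl z Lc); apply: eq_I => e; by rewrite /cv subKr mulrC.
  have e2 : I (fun e => H (z + e) * l e) = I cv.
    rewrite -e1 -(I_opp (b _ cp)); apply: eq_I => e; by rewrite lN.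
  have e3 : I (fun e => H (e - z) * l e) = I (fun e => H (- z - e) * l e).
    by rewrite -(I_opp (b _ cp')); apply: eq_I => e; rewrite lN addrC.
  rewrite (_ : (fun e => Qker H z e * l e) =
    (fun e => (H (z + e) * l e + H (e - z) * l e) + (H (z - e) * l e - H (- z - e) * l e))).
    rewrite (ID (L1_D (b _ cp) (b _ cp')) (L1_B (b _ cm) (b _ cm'))) (ID (b _ cp) (b _ cp')).
    rewrite (IB (b _ cm) (b _ cm')) e1 e2 e3; ring.
  by apply/funext => e; rewrite /Qker; ring.
by rewrite /Q -mulrBr -(IB LA LB) (eq_I E) (ID (L1_Z 2 Lc) L3) (IZ _ Lc) I3; field.
Qed.

End interaction.

(** * Growth of the difference of two solutions *)

Section drift.
Context {R : realType}.
Implicit Types (x y z k e t : R).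

Variables (V l H : R -> R) (kap VM rho : R).
Hypotheses (cV : continuous V) (V0 : forall k, 0 <= V k) (VN : forall k, V (- k) = V k)
  (VVM : forall k, V k <= VM) (V1 : L1 V)
  (Vconv : forall z, I (fun e => V (z - e) * V e) <= kap * V z)
  (kap0 : 0 <= kap) (rho0 : 0 < rho).

Section close.
Variables (h0 : R -> R) (g : R -> R -> R).
Hypotheses (ag : adm V rho g) (gE : forall t k, g t k = Phi h0 g t k).

Lemma fix_close t k : `|g t k - h0 k| <= 16 * kap / rho * V k.
Proof.
rewrite gE /Phi addrC addKr; have c01 := clamp_itv t.
have A0 : 0 <= 8 * kap * V k by rewrite !mulr_ge0.
have h s : 0 < s < 1 -> `|NN g s k| <= 8 * kap * V k * `|k| * damp (rate rho s) k.
  by move=> _; have := NN_le cV V0 VN VVM V1 Vconv rho0 ag s k; lra.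
have cN : continuous (NN g ^~ k) by exact: (cont_NN_t V0 VN VVM V1 rho0 ag).
apply: (le_trans (prim_damp rho0 cN c01 h A0)).
rewrite -[leRHS]mulr1 (_ : 2 * _ / rho = 16 * kap / rho * V k); last by ring.
apply: ler_wpM2l; last by apply: damp_le1; exact: rate_ge0.
by rewrite mulr_ge0// divr_ge0 ?mulr_ge0// ltW.
Qed.

Lemma hh_close t k : `|hh g t k - rot t h0 k| <= 2 * (16 * kap / rho) * V k.
Proof.
rewrite /hh rot_B; apply: (le_trans (rot_le _ _ _)).
by have := fix_close t k; have := fix_close t (- k); rewrite VN; lra.
Qed.

Lemma hh_dom t : domby V 0 2 (hh g t).
Proof. exact: (domby_0 V0 (rate_ge0 rho0 t) (ler0n _ 2) (adm_hh VN ag t)). Qed.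

End close.

Variables (g g' : R -> R -> R) (de : R).
Hypotheses (ag : adm V rho g) (gE : forall t k, g t k = Phi (fun k => l k + H k) g t k)
  (ag' : adm V rho g') (gE' : forall t k, g' t k = Phi H g' t k).
Hypotheses (cl : continuous l) (cH : continuous H) (lV : forall k, `|l k| <= V k)
  (HV : forall k, `|H k| <= V k)
  (de0 : 0 <= de) (lrot : forall t k, 0 <= t <= 1 -> `|rot t l k - l k| <= de * V k).
(** Distance, relative to [V], of the true profiles from the explicit ones: the first term is the
    nonlinear evolution, [de] comes from leaving [l] unrotated. *)
Let eps := 2 * (16 * kap / rho) + de.

Let eps0 : 0 <= eps.
Proof. by rewrite addr_ge0// mulr_ge0// divr_ge0 ?mulr_ge0// ltW. Qed.

Let a t k := l k + rot t H k.

Let rotH_le t k : `|rot t H k| <= 2 * V k.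
Proof.
apply: (le_trans (rot_le _ _ _)); have := HV k; have := HV (- k); rewrite VN; lra.
Qed.

Let domE c (f : R -> R) : (forall k, `|f k| <= c * V k) -> domby V 0 c f.
Proof. by move=> h k; rewrite /damp mul0r oppr0 expR0 mul1r. Qed.

Let damp0E k : damp 0 k * V k = V k.
Proof. by rewrite /damp mul0r oppr0 expR0 mul1r. Qed.

Lemma Q_close t z : 0 <= t <= 1 ->
  `|Q (hh g t) (hh g t) z - Q (a t) (a t) z| <= 12 * eps * kap * V z /\
  `|Q (hh g' t) (hh g' t) z - Q (rot t H) (rot t H) z| <= 12 * eps * kap * V z.
Proof.
move=> ht; have h3 : (0 : R) <= 3 by [].
have cr : continuous (rot t H) by exact: cont_rot.
have ca : continuous (a t) by exact: cont_D.
have mh := cont_meas (@cont_hh _ _ _ _ ag t).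
have mh' := cont_meas (@cont_hh _ _ _ _ ag' t).
have d3 f : domby V 0 2 f -> domby V 0 3 f.
  move=> h; apply: domE => k; apply: (le_trans (h k)); rewrite damp0E ler_wpM2r//; lra.
have dh := d3 _ (hh_dom ag t); have dh' := d3 _ (hh_dom ag' t).
have dr : domby V 0 3 (rot t H) by apply: d3; apply: domE.
have da : domby V 0 3 (a t).
  apply: domE => k; apply: (le_trans (ler_normD _ _)).
  by have := lV k; have := rotH_le t k; lra.
have V0k k := V0 k.
(* All profiles are bounded by [3 * V], and [4] is the constant of [Q_diff]. *)
split; rewrite -(damp0E z) (_ : 12 = 4 * 3); try ring.
- apply: (Q_diff cV V0 VN VVM V1 Vconv z (lexx 0) dh da _ h3 eps0 mh (cont_meas ca)).
  apply: domE => k.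
  rewrite (_ : _ - a t k = (hh g t k - rot t (fun k => l k + H k) k) + (rot t l k - l k)).
    apply: (le_trans (ler_normD _ _)).
    by rewrite /eps mulrDl; apply: lerD; [exact: (hh_close ag gE)|exact: lrot].
  by rewrite /a /rot; ring.
- apply: (Q_diff cV V0 VN VVM V1 Vconv z (lexx 0) dh' dr _ h3 eps0 mh' (cont_meas cr)).
  apply: domE => k; apply: (le_trans (hh_close ag' gE' t k)).
  by rewrite ler_wpM2r// /eps lerDl.
Qed.

Variables (lam r : R).
Hypotheses (r0 : 0 < r) (rlam : 4 * r <= lam) (rlam1 : r * (2 * lam + 2 * r) <= 1)
  (l0 : forall x, 0 <= l x) (H0 : forall x, 0 <= H x) (lN : forall x, l (- x) = l x)
  (lr : forall x, r <= `|x| -> l x = 0) (Hr : forall x, r <= `|x - lam| -> H x = 0).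

Let VMbd (f : R -> R) c : 0 <= c -> (forall k, `|f k| <= c * V k) -> forall k, `|f k| <= c * VM.
Proof. by move=> c0 h k; apply: (le_trans (h k)); rewrite ler_wpM2l. Qed.

Let L1dom (f : R -> R) c : continuous f -> (forall k, `|f k| <= c * V k) -> L1 f.
Proof.
by move=> cf h; apply: (L1_le (g := fun k => c * V k)) => //; [exact: cont_meas|exact: L1_Z].
Qed.

Let X t z := Q (a t) (a t) z - Q (rot t H) (rot t H) z.

Let lV1 k : `|l k| <= 1 * V k. Proof. by rewrite mul1r. Qed.

Let lV2 k : `|l k| <= 2 * V k.
Proof. by have := lV k; have := V0 k; lra. Qed.

Lemma XE t z : 2 * r < `|z| -> X t z = 2 * I (fun e => l (z - e) * rot t H e).
Proof.
move=> hz; have cr : continuous (rot t H) by exact: cont_rot.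
have h2 : (0 : R) <= 2 by [].
exact: (Q_cross cl cr (VMbd h2 lV2) (VMbd h2 (rotH_le t)) (L1dom cl lV1)
  (L1dom cr (rotH_le t)) lN lr (ltW r0) hz).
Qed.

Lemma L1_lH (f : R -> R) (z : R) : continuous f -> (forall k, `|f k| <= 2 * V k) ->
  L1 (fun e => l (z - e) * f e).
Proof.
move=> cf hf; have h2 : (0 : R) <= 2 by [].
apply: (@L1_bdmul _ _ _ (2 * VM)); last exact: L1dom hf.
  by apply: (cont_comp cl); cont.
by move=> e; exact: (VMbd h2 lV2).
Qed.

(** Rotating back by the phase of [k] leaves [l (k - e) * H e] times
    [2 * cos (t * (disp k - disp e))]. On the supports, [disp k - disp e = (k - e) * (k + e)] is at
    most [r * (2 * lam + 2 * r) <= 1] in absolute value, so the cosine is at least one half: this is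
    the near resonance. *)
Lemma X_bracket t k : 0 <= t <= 1 -> `|k - lam| <= r ->
  I (fun e => l (k - e) * H e) <= cos (t * disp k) * X t k - sin (t * disp k) * X t (- k).
Proof.
move=> ht hk; have kl : 2 * r < k.
  by move: hk; rewrite ler_norml => /andP[h1 h2]; have := rlam; have := r0; lra.
have kz : 2 * r < `|k| by rewrite gtr0_norm//; have := r0; lra.
have kz' : 2 * r < `|- k| by rewrite normrN.
rewrite (XE t kz) (XE t kz').
have cr : continuous (rot t H) by exact: cont_rot.
have crN : continuous (fun e => rot t H (- e)) by apply: (cont_comp cr); cont.
have rN e : `|rot t H (- e)| <= 2 * V e by have := rotH_le t (- e); rewrite VN.
have LA := L1_lH k cr (rotH_le t).
have LB := L1_lH k crN rN.
have LC := L1_lH (- k) cr (rotH_le t).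
have EB : I (fun e => l (- k - e) * rot t H e) = I (fun e => l (k - e) * rot t H (- e)).
  rewrite -(I_opp LC); apply: eq_I => e; by rewrite opprK -lN opprD !opprK.
rewrite EB; set c := cos (t * disp k); set s := sin (t * disp k).
rewrite (_ : c * _ - s * _ = I (fun e => 2 * c * (l (k - e) * rot t H e) - 2 * s * (l (k - e) * rot t H (- e)))).
  2: by rewrite (IB (L1_Z _ LA) (L1_Z _ LB)) (IZ _ LA) (IZ _ LB); ring.
have HV2 x : `|H x| <= 2 * V x by have := HV x; have := V0 x; lra.
apply: I_le; [exact: L1_lH|by apply: L1_B; apply: L1_Z|move=> e].
have [he|he] := leP r `|k - e|; first by rewrite (lr he) !mul0r !mulr0 subrr.
have e0 : 0 < e by move: he; rewrite ltr_norml => /andP[]; have := r0; lra.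
have HNe : H (- e) = 0.
  apply: Hr; rewrite -normrN opprD !opprK ger0_norm; have := rlam; have := r0; lra.
have [he2|he2] := leP r `|e - lam|.
  by rewrite /rot opprK HNe (Hr he2) !mulr0 addr0 !mulr0 subrr.
have E : 2 * c * (l (k - e) * rot t H e) - 2 * s * (l (k - e) * rot t H (- e)) =
    (l (k - e) * H e) * (2 * cos (t * (disp k - disp e))).
  by rewrite /rot dispN opprK HNe mulrN sinN mulrBr cosB -/c -/s; ring.
rewrite E ler_peMr//; first exact: mulr_ge0.
suff : 2^-1 <= cos (t * (disp k - disp e)) by move: (cos _) => q; lra.
apply: cos_ge_half; rewrite normrM; case/andP: ht => t0 t1; rewrite (ger0_norm t0).
rewrite -[leRHS]mul1r; apply: ler_pM => //.
rewrite /disp (gtr0_norm e0) (gtr0_norm (_ : 0 < k)); last by have := r0; lra.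
rewrite (_ : k * k - e * e = (k - e) * (k + e)); last by ring.
apply: le_trans rlam1; rewrite normrM; apply: ler_pM => //; first exact: ltW.
have k0 : 0 < k by have := r0; lra.
rewrite gtr0_norm; last by exact: addr_gt0.
by move: hk he2; rewrite ler_norml ltr_norml => /andP[_ h1] /andP[_ h2]; lra.
Qed.

(** The profile is observed at [- k] because [FF] at [- k] evaluates [Q] at [k], near the carrier.
    Four values of [Q] are replaced by explicit ones, at the price [12 * eps * kap * V k] each,
    whence [48]. *)
Lemma NN_drift t k : 0 <= t <= 1 -> `|k - lam| <= r ->
  NN g t (- k) - NN g' t (- k) <=
    - (k / 2 * (I (fun e => l (k - e) * H e) - 48 * eps * kap * V k)).
Proof.
move=> ht hk; have k0 : 0 <= k.
  by move: hk; rewrite ler_norml => /andP[h1 h2]; have := rlam; have := r0; lra.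
have [E1 E2] := Q_close k ht; have [E3 E4] := Q_close (- k) ht; rewrite VN in E3 E4.
have B := X_bracket ht hk.
rewrite /NN /rot /FF dispN !opprK !mulNr !mulrN !opprK.
set c := cos _ in B *; set s := sin _ in B *.
set q1 := Q _ _ k in E1 *; set q2 := Q _ _ k in E2 *.
set q3 := Q _ _ (- k) in E3 *; set q4 := Q _ _ (- k) in E4 *.
have c1 : `|c| <= 1 by exact: cos_max.
have s1 : `|s| <= 1 by exact: sin_max.
set B0 := I _ in B *; set T := 12 * eps * kap * V k in E1 E2 E3 E4.
have e1 : `|(q1 - q2) - X t k| <= 2 * T.
  rewrite (_ : _ - X t k = (q1 - Q (a t) (a t) k) - (q2 - Q (rot t H) (rot t H) k)).
    by apply: (le_trans (ler_normB _ _)); move: E1 E2; lra.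
  by rewrite /X; ring.
have e2 : `|(q3 - q4) - X t (- k)| <= 2 * T.
  rewrite (_ : _ - X t _ = (q3 - Q (a t) (a t) (- k)) - (q4 - Q (rot t H) (rot t H) (- k))).
    by apply: (le_trans (ler_normB _ _)); move: E3 E4; lra.
  by rewrite /X; ring.
have m1 : `|c * ((q1 - q2) - X t k)| <= 2 * T by rewrite normrM -[leRHS]mul1r; apply: ler_pM.
have m2 : `|s * ((q3 - q4) - X t (- k))| <= 2 * T by rewrite normrM -[leRHS]mul1r; apply: ler_pM.
suff : B0 - 4 * T <= c * (q1 - q2) - s * (q3 - q4).
  move=> HB; rewrite (_ : _ - _ = - (k / 2 * (c * (q1 - q2) - s * (q3 - q4)))); last by ring.
  rewrite lerN2 (_ : 48 * eps * kap * V k = 4 * T); last by rewrite /T; ring.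
  by apply: ler_wpM2l => //; exact: divr_ge0.
move: m1 m2; rewrite !ler_norml !mulrBr => /andP[m1 m1'] /andP[m2 m2'].
by move: B m1 m2'; rewrite !mulrBr; lra.
Qed.

(** The profiles start from the same value at [- k], since their difference [l] vanishes there, and
    [NN_drift] is integrated in time. *)
Lemma g_drift t k c : 0 <= t <= 1 -> `|k - lam| <= r ->
  c <= k / 2 * (I (fun e => l (k - e) * H e) - 48 * eps * kap * V k) ->
  g t (- k) - g' t (- k) <= - (c * t).
Proof.
move=> /andP[t0 t1] hk hc.
have E0 : g 0 (- k) - g' 0 (- k) = 0.
  rewrite (fix_init gE) (fix_init gE') addrK lN; apply: lr.
  move: hk; rewrite ler_norml => /andP[h1 h2].
  by rewrite ger0_norm; have := rlam; have := r0; lra.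
have isg (s : R) : 0 < s < t -> is_derive s 1 (fun s => g s (- k) - g' s (- k)) (NN g s (- k) - NN g' s (- k)).
  move=> /andP[s0 s1]; have hs : 0 < s < 1 by rewrite s0/=; lra.
  exact: isd_D (isd_fix V0 VN VVM V1 rho0 ag gE (- k) hs)
    (isd_N (isd_fix V0 VN VVM V1 rho0 ag' gE' (- k) hs)).
have isl (s : R) : is_derive s 1 (fun s : R => - (c * s)) (- c).
  by apply: isd_eq; [isd|rewrite /=; ring].
have cg (s : R) : {for s, continuous (fun s => g s (- k) - g' s (- k))}.
  have : continuous (fun s => g s (- k) - g' s (- k)).
    case: ag => c1 _ _; case: ag' => c2 _ _.
    by apply: cont_D; [exact: c1|apply: cont_N; exact: c2].
  exact.
have h (s : R) : 0 < s < t -> NN g s (- k) - NN g' s (- k) <= - c.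
  move=> /andP[s0 s1]; have hs : 0 <= s <= 1 by apply/andP; split; lra.
  by apply: (le_trans (NN_drift hs hk)); rewrite lerN2.
have := derive_mono t0 (fun s _ => cg s) (fun s _ => isd_cont_at (isl s)) isg (fun s _ => isl s) h.
by rewrite E0 mulr0 !subr0 oppr0 subr0.
Qed.

End drift.

(** * Choice of the parameters *)

Section tent.
Context {R : realType}.
Implicit Types (x : R).

(** The positive part of [1 - |x|], written with absolute values so that its continuity is
    structural. *)
Definition tent x : R := (`|1 - `|x| | + (1 - `|x|)) / 2.

Lemma tent_ge0 x : 0 <= tent x.
Proof. by rewrite /tent divr_ge0//; have := ler_norm (- (1 - `|x|)); rewrite normrN; lra. Qed.

Lemma tent_le1 x : tent x <= 1.
Proof.
have x0 := normr_ge0 x; rewrite /tent ler_pdivrMr// mul1r.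
have [h|h] := leP `|x| 1; first by rewrite ger0_norm ?subr_ge0//; lra.
by rewrite ltr0_norm ?subr_lt0//; lra.
Qed.

Lemma tent_out x : 1 <= `|x| -> tent x = 0.
Proof. by move=> h; rewrite /tent ler0_norm ?subr_le0// addNr mul0r. Qed.

Lemma tent_in x : `|x| <= 3 / 4 -> 4^-1 <= tent x.
Proof. by move=> h; rewrite /tent ger0_norm; lra. Qed.

Lemma tentN x : tent (- x) = tent x.
Proof. by rewrite /tent normrN. Qed.

Lemma cont_tent : continuous tent.
Proof. by rewrite /tent; cont. Qed.
End tent.

(** * A pair of solutions for one choice of the parameters *)

Section parameters.
Context {R : realType}.
Implicit Types (x y z k e t : R).

Variables (s q m om : R) (p : nat).
Let P := p.+1.
Let ms := m `^ s.
Hypotheses (s0 : 0 < s) (sP : s <= P%:R) (q1 : 1 <= q) (om0 : 0 < om) (om1 : om <= 1)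
  (omq : 1 <= om * q) (qm : 12 * q ^+ 2 <= m) (qms : q ^+ 2 <= ms).

(** The loss in [env_ge_carrier]; being at least [4], it also covers [env_ge_near0]. *)
Definition C0 : R := 2 * (1 + 36 ^+ P).
(** [expR 5] undoes the damping on [|k| <= 5 * m], [C0] the loss in the lower bounds of the
    envelope, and [4] puts each of the two pieces of the data below a quarter of the weight. *)
Definition C1 : R := 4 * expR 5 * C0.
Definition Kc : R := (4 ^+ P) ^+ 2 * (16 * Cw).
(** The drift error [48 * eps * kap * V] at the carrier, in units of [om * a * (b / be)]: the middle
    factor is [eps / om], and the last one joins [kap / a] with the bound [C1] for [V]. *)
Definition C3 : R := 48 * (32 * (C1 * Kc) + 2) * (C1 * Kc * C1).
Hypotheses (om_small : 64 * (C1 * Kc) * om <= 1) (om_drift : C3 * om <= 64^-1).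

(** Since [sqrt be = q / m], the bump has norm of order [a / sqrt be = om / q], and the carrier
    [ms * b / sqrt be = 1]. The choice of [th] gives [a * th = b], and [kap / rho = C1 * Kc * om]
    depends on [om] only. *)
Let be := (q / m) ^+ 2.
Let a := om / m.
Let b := q / (m * ms).
Let th := q / (ms * om).
Let A := C1 * a.
Let kap := A * Kc.
Let rho := m^-1.
Let lam := pi * m.

Lemma C0_ge4 : 4 <= C0.
Proof. by have : 1 <= 36 ^+ P :> R; [rewrite exprn_ege1//; lra|rewrite /C0; lra]. Qed.

Lemma C1_ge0 : 0 < C1.
Proof. by have := C0_ge4 => h; rewrite /C1 !mulr_gt0 ?expR_gt0//; lra. Qed.

Lemma Kc_ge0 : 0 <= Kc.
Proof.
rewrite /Kc mulr_ge0 ?sqr_ge0// mulr_ge0// /Cw mulr_ge0//; first by have := pi_ge0 R; lra.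
by apply: I_ge0 => x; rewrite invr_ge0 ltW// oneDsqr_gt0.
Qed.

Let qq : q <= q ^+ 2. Proof. by rewrite expr2 ler_peMl//; have := q1; lra. Qed.
Let m12 : 12 <= m. Proof. by have := qm; have := qq; have := q1; lra. Qed.
Let m1 : 1 <= m. Proof. by have := m12; lra. Qed.
Let m0 : 0 < m. Proof. by have := m12; lra. Qed.
Let q0 : 0 < q. Proof. by have := q1; lra. Qed.
Let ms0 : 0 < ms. Proof. by rewrite powR_gt0. Qed.
Let a0 : 0 < a. Proof. exact: divr_gt0. Qed.
Let b0 : 0 < b. Proof. by rewrite divr_gt0// mulr_gt0. Qed.
Let th0 : 0 < th. Proof. by rewrite divr_gt0// mulr_gt0. Qed.
Let be0 : 0 < be. Proof. by rewrite exprn_gt0// divr_gt0. Qed.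
Let A0 : 0 < A. Proof. by rewrite mulr_gt0// C1_ge0. Qed.
Let kap0 : 0 <= kap. Proof. by rewrite mulr_ge0 ?Kc_ge0// ltW. Qed.
Let rho0 : 0 < rho. Proof. by rewrite invr_gt0. Qed.

Let bem : 12 * (be * m) <= 1.
Proof.
rewrite (_ : be * m = q ^+ 2 / m); last by rewrite /be; field; rewrite gt_eqF.
by rewrite mulrA ler_pdivrMr// mul1r.
Qed.

Let be12 : 12 * be <= m^-1.
Proof. by rewrite -[leRHS]mul1r ler_pdivlMr// -mulrA. Qed.

Let mV1 : m^-1 <= 1. Proof. by rewrite invf_le1. Qed.

Let be1 : be <= 1. Proof. by have := be12; have := mV1; have := be0; lra. Qed.

Let beom : be <= om.
Proof.
have h : m^-1 <= q^-1 by rewrite lef_pV2 ?posrE//; have := qm; have := qq; have := q0; lra.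
have h2 : q^-1 <= om by rewrite -[leLHS]mul1r ler_pdivrMr.
by have := be12; have := be0; lra.
Qed.

Let th1 : th <= 1.
Proof.
rewrite ler_pdivrMr ?mulr_gt0// mul1r; apply: (@le_trans _ _ (q ^+ 2 * om)).
  by rewrite expr2 -mulrA ler_peMr ?(ltW q0)// mulrC.
by rewrite ler_wpM2r// ltW.
Qed.

Let thm : 1 <= th * (m ^+ 2) ^+ P.
Proof.
have h1 : ms <= (m ^+ 2) ^+ P.
  apply: (@le_trans _ _ (m ^+ P)); first by rewrite -[leRHS]powR_mulrn ?(ltW m0)// ler_powR.
  by rewrite -exprM ler_weXn2l// mulSn addnC leq_addl.
have h2 : ms^-1 <= th.
  rewrite /th invfM mulrA -[leLHS]mul1r mulrAC ler_pM2r ?invr_gt0//.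
  by rewrite ler_pdivlMr// mul1r; have := om1; have := q1; lra.
apply: (@le_trans _ _ (ms^-1 * ms)); first by rewrite mulVf// gt_eqF.
by apply: ler_pM => //; rewrite ?invr_ge0 ltW.
Qed.

Let bE : b / be * be = b. Proof. by rewrite divfK// gt_eqF. Qed.
Let ath : a * th = b.
Proof. by rewrite /a /th /b; field; rewrite !gt_eqF. Qed.

Let W := env m be th p.
Let V k := A / be * W k.

Let Abe0 : 0 < A / be. Proof. exact: divr_gt0. Qed.

Let cV : continuous V.
Proof. by apply: cont_M; [cont|exact: cont_env]. Qed.

Let V0 k : 0 <= V k.
Proof. by rewrite mulr_ge0 ?(ltW Abe0)// ltW// env_gt0. Qed.

Let VN k : V (- k) = V k.
Proof. by rewrite /V /W envN. Qed.

Let VVM k : V k <= A / be.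
Proof. by rewrite -[leRHS]mulr1 ler_wpM2l ?(ltW Abe0)// env_le1. Qed.

Let V1 : L1 V.
Proof. by apply: L1_Z; exact: L1_env. Qed.

Let Vconv z : I (fun e => V (z - e) * V e) <= kap * V z.
Proof.
have h := env_conv p m1 be0 be1 th0 th1 z; rewrite -/W in h.
have lW : L1 (fun e => W (z - e) * W e).
  rewrite (_ : (fun e => _) = (fun e => W e * W (z - e))); last first.
    by apply/funext => e; rewrite mulrC.
  have cW : continuous W by exact: cont_env.
  have W1 e : `|W (z - e)| <= 1 by rewrite gtr0_norm ?env_gt0// env_le1.
  apply: (@L1_Mbounded _ _ _ 1) => //; last exact: L1_env.
  by apply: cont_meas; apply: (cont_comp cW); cont.
rewrite (eq_I (g := fun e => (A / be) ^+ 2 * (W (z - e) * W e))); last by move=> e; rewrite /V; ring.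
rewrite (IZ _ lW).
rewrite (_ : kap * V z = (A / be) ^+ 2 * (4 ^+ p.+1 ^+ 2 * (16 * (Cw * be)) * W z)).
  by apply: ler_wpM2l => //; exact: sqr_ge0.
by rewrite /kap /Kc /V; field; rewrite gt_eqF.
Qed.

Let kap_small : 64 * kap <= rho.
Proof.
rewrite (_ : 64 * kap = 64 * (C1 * Kc) * om / m); last by rewrite /kap /A /a; ring.
by rewrite ler_pdivrMr// mulVf ?gt_eqF.
Qed.

Let l k := a / be * tent (k / be).
Let H k := b / be * tent ((k - lam) / be).

Let abe0 : 0 < a / be. Proof. exact: divr_gt0. Qed.
Let bbe0 : 0 < b / be. Proof. exact: divr_gt0. Qed.

Let cl : continuous l.
Proof. by apply: cont_M; [cont|apply: (cont_comp (@cont_tent R)); cont]. Qed.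
Let cH : continuous H.
Proof. by apply: cont_M; [cont|apply: (cont_comp (@cont_tent R)); cont]. Qed.
Let l0 k : 0 <= l k. Proof. by rewrite mulr_ge0 ?tent_ge0// ltW. Qed.
Let H0 k : 0 <= H k. Proof. by rewrite mulr_ge0 ?tent_ge0// ltW. Qed.
Let lN k : l (- k) = l k. Proof. by rewrite /l mulNr tentN. Qed.

Let norm_div k : `|k / be| = `|k| / be.
Proof. by rewrite normrM (gtr0_norm (_ : 0 < be^-1)) ?invr_gt0. Qed.

Let lr k : be <= `|k| -> l k = 0.
Proof. by move=> h; rewrite /l tent_out ?mulr0// norm_div ler_pdivlMr// mul1r. Qed.

Let Hr k : be <= `|k - lam| -> H k = 0.
Proof. by move=> h; rewrite /H tent_out ?mulr0// norm_div ler_pdivlMr// mul1r. Qed.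

Let lam_le : lam <= 4 * m.
Proof. by rewrite /lam ler_wpM2r ?(ltW m0)//; have := @pihalf_lt2 R; move: (pi : R) => c; lra. Qed.

Let lam_ge : 2 * m <= lam.
Proof. by rewrite /lam ler_wpM2r ?(ltW m0)// pi_ge2. Qed.

Let damp_ge k : `|k| <= 5 * m -> 1 <= expR 5 * damp rho k.
Proof.
move=> h; rewrite /damp -expRD -[leLHS](@expR0 R) ler_expR subr_ge0.
by rewrite /rho mulrC ler_pdivrMr.
Qed.

Let C0_gt0 : 0 < C0. Proof. by have := C0_ge4; lra. Qed.

(** Applied with [c = a] at frequency zero and [c = b] at the carrier, where [c / a] is [1] and [th]
    respectively. *)
Let dom_aux (y c k : R) : 0 <= c -> y <= c / be -> `|k| <= 5 * m -> c / a / C0 <= W k ->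
  y <= 4^-1 * (damp rho k * V k).
Proof.
move=> c0 hy hk hW; apply: (le_trans hy).
have h1 := damp_ge hk.
rewrite (_ : c / be = 1 * (c / be)); last by rewrite mul1r.
apply: (@le_trans _ _ (expR 5 * damp rho k * (c / be))).
  by apply: ler_wpM2r => //; exact: divr_ge0 c0 (ltW be0).
rewrite (_ : 4^-1 * _ = expR 5 * damp rho k * (C0 * (a / be) * W k)); last first.
  by rewrite /V /A /C1; field; rewrite gt_eqF.
apply: ler_wpM2l; first by rewrite mulr_ge0 ?expR_ge0.
rewrite (_ : c / be = C0 * (a / be) * (c / a / C0)); last by field; rewrite !gt_eqF.
by apply: ler_wpM2l => //; rewrite mulr_ge0// ltW.
Qed.

Let dV0 k : 0 <= 4^-1 * (damp rho k * V k).
Proof. by apply: mulr_ge0; [rewrite invr_ge0|exact: mulr_ge0 (damp_ge0 _ _) (V0 k)]. Qed.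

Let l_dom k : l k <= 4^-1 * (damp rho k * V k).
Proof.
have [h|h] := leP be `|k|; first by rewrite (lr h); exact: dV0.
apply: (@dom_aux _ a) => //.
- exact: ltW.
- by rewrite /l ler_piMr ?tent_le1// ltW.
- by have := be1; have := m1; lra.
- rewrite divff ?gt_eqF// mul1r; apply: (@le_trans _ _ 4^-1).
    by rewrite lef_pV2 ?posrE//; exact: C0_ge4.
  exact: (env_ge_near0 m1 be0 be1 th0 (ltW h) thm).
Qed.

Let H_dom k : H k <= 4^-1 * (damp rho k * V k).
Proof.
have [h|h] := leP be `|k - lam|; first by rewrite (Hr h); exact: dV0.
apply: (@dom_aux _ b) => //.
- exact: ltW.
- by rewrite /H ler_piMr ?tent_le1// ltW.
- have -> : k = k - lam + lam by rewrite subrK.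
  apply: (le_trans (ler_normD _ _)); have := be1; have := m1; have := lam_le.
  by rewrite (ger0_norm (_ : 0 <= lam)); have := lam_ge; have := m1; lra.
- rewrite (_ : b / a = th); last by rewrite -ath mulrC mulKf// gt_eqF.
  exact: (env_ge_carrier p m1 be0 be1 th0 th1 (ltW h)).
Qed.

Let dampV k : 0 <= damp rho k * V k <= V k.
Proof.
by rewrite mulr_ge0 ?damp_ge0//= ler_piMl// damp_le1// ltW.
Qed.

Let lV k : `|l k| <= V k.
Proof. by rewrite ger0_norm//; have := l_dom k; have := dampV k; have := V0 k; lra. Qed.

Let HV k : `|H k| <= V k.
Proof. by rewrite ger0_norm//; have := H_dom k; have := dampV k; have := V0 k; lra. Qed.

Let lH k := l k + H k.

Let clH : continuous lH. Proof. exact: cont_D. Qed.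

Let lH_dom : domby V rho 2^-1 lH.
Proof.
move=> k; rewrite ger0_norm; last exact: addr_ge0.
by rewrite /lH; have := l_dom k; have := H_dom k; lra.
Qed.

Let H_domby : domby V rho 2^-1 H.
Proof. by move=> k; rewrite ger0_norm//; have := H_dom k; have := dampV k; lra. Qed.

Let g := gl lH.
Let g' := gl H.
Let ag : adm V rho g := gl_adm cV V0 VN VVM V1 Vconv kap0 rho0 kap_small clH lH_dom.
Let gE : forall t k, g t k = Phi lH g t k :=
  gl_fix cV V0 VN VVM V1 Vconv kap0 rho0 kap_small clH lH_dom.
Let ag' : adm V rho g' := gl_adm cV V0 VN VVM V1 Vconv kap0 rho0 kap_small cH H_domby.
Let gE' : forall t k, g' t k = Phi H g' t k :=
  gl_fix cV V0 VN VVM V1 Vconv kap0 rho0 kap_small cH H_domby.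

(** On the support of [l] the phase is at most [be^2 <= be <= om]: frequencies this low hardly
    disperse in unit time. *)
Let lrot t k : 0 <= t <= 1 -> `|rot t l k - l k| <= 2 * om * V k.
Proof.
move=> /andP[t0 t1]; rewrite /rot lN.
have [h|h] := leP be `|k|.
  rewrite (lr h) !mulr0 addr0 subrr normr0; apply: mulr_ge0 => //.
  by apply: mulr_ge0 => //; exact: ltW.
set x := t * disp k.
have hx : `|x| <= om.
  rewrite /x normrM (ger0_norm t0) -[leRHS]mul1r; apply: ler_pM => //.
  rewrite /disp normrM normr_id; apply: le_trans beom; rewrite -[leRHS]mul1r.
  by apply: ler_pM => //; [apply: le_trans (ltW h) be1|exact: ltW].
have hc : `|cos x - 1| <= om.
  rewrite ler0_norm ?opprB; last by rewrite subr_le0; apply: le_trans (ler_norm _) (cos_max x).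
  have := cos_ge x; rewrite -(real_normK (num_real x)).
  have : `|x| ^+ 2 <= om by rewrite expr2 -[leRHS]mulr1; apply: ler_pM => //; apply: le_trans hx om1.
  by have := om0; move: (cos x) (`|x| ^+ 2) => c y; lra.
have hs : `|sin x| <= om by apply: le_trans (sin_norm_le x) hx.
rewrite (_ : _ - l k = (cos x - 1) * l k + sin x * l k); last by ring.
apply: (le_trans (ler_normD _ _)); rewrite (normrM (_ - _)) (normrM (sin x)).
apply: (@le_trans _ _ (om * `|l k| + om * `|l k|)); first by apply: lerD; apply: ler_wpM2r.
rewrite (_ : _ + _ = 2 * om * `|l k|); last by ring.
by apply: ler_wpM2l => //; apply: mulr_ge0 => //; exact: ltW.
Qed.

(** For [e] within [be / 4] of [lam], both tents have arguments of size at most [3 / 4], hence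
    values at least [4^-1]; the interval has length [be / 2]. *)
Let I_lH_ge k : `|k - lam| <= be / 2 -> a * b / (32 * be) <= I (fun e => l (k - e) * H e).
Proof.
move=> hk; pose J := `[lam - be / 4, lam + be / 4]%classic : set R.
have lJ : L1 \1_J by exact: L1_indic_itv.
have llH : L1 (fun e => l (k - e) * H e).
  apply: (@L1_bdmul _ _ _ (a / be)).
  - by apply: (cont_comp cl); cont.
  - by move=> e; rewrite ger0_norm// /l; apply: ler_piMr; [exact: ltW|exact: tent_le1].
  - by apply: (L1_le (g := V)) => //; exact: cont_meas.
rewrite (_ : a * b / (32 * be) = a / be * (b / be) * 16^-1 * I \1_J); last first.
  by rewrite I_indic_itv; [field; rewrite gt_eqF|have := be0; lra].
rewrite -(IZ _ lJ); apply: I_le => // [|e]; first exact: L1_Z.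
rewrite indicE; have [|_] := boolP (e \in J); last by rewrite mulr0 mulr_ge0.
rewrite inE /J /= in_itv /= => /andP[e1 e2]; rewrite mulr1.
have t1 : 4^-1 <= tent ((k - e) / be).
  apply: tent_in; rewrite norm_div ler_pdivrMr//; move: hk.
  by rewrite !ler_norml => /andP[h1 h2]; apply/andP; split; lra.
have t2 : 4^-1 <= tent ((e - lam) / be).
  apply: tent_in; rewrite norm_div ler_pdivrMr// ler_norml.
  by have := be0; move=> ?; apply/andP; split; lra.
rewrite (_ : a / be * (b / be) * 16^-1 = (a / be * 4^-1) * (b / be * 4^-1)); last by field; rewrite gt_eqF.
have p4 : 0 <= 4^-1 :> R by rewrite invr_ge0.
apply: ler_pM; [exact: mulr_ge0 (ltW abe0) p4|exact: mulr_ge0 (ltW bbe0) p4| |].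
  by rewrite /l; apply: ler_wpM2l => //; exact: ltW.
by rewrite /H; apply: ler_wpM2l => //; exact: ltW.
Qed.

Let drift t k : 0 <= t <= 1 -> `|k - lam| <= be / 2 ->
  g t (- k) - g' t (- k) <= - (om * b / (128 * be) * t).
Proof.
move=> ht hk.
have rlam : 4 * be <= lam by have := be1; have := lam_ge; have := m12; lra.
have rlam1 : be * (2 * lam + 2 * be) <= 1.
  apply: le_trans bem; rewrite [leRHS]mulrCA; apply: ler_wpM2l; first exact: ltW.
  by have := be1; have := lam_le; have := m12; lra.
have hk' : `|k - lam| <= be by have := be0; lra.
have de0 : 0 <= 2 * om by rewrite mulr_ge0// ltW.
apply: (g_drift cV V0 VN VVM V1 Vconv kap0 rho0 ag gE ag' gE' cl cH lV HV de0 lrot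
  be0 rlam rlam1 l0 H0 lN lr Hr ht hk').
have km : m <= k.
  by move: hk'; rewrite ler_norml => /andP[h1 h2]; have := be1; have := lam_ge; have := m12; lra.
have k0 : 0 <= k by have := m0; lra.
have hI := I_lH_ge hk; set B := I _ in hI *.
(* Beyond [m] the envelope is at most [th], so the error scales like the carrier rather than like
   the bump. *)
have hV : V k <= C1 * (b / be).
  rewrite (_ : C1 * (b / be) = A / be * th); last by rewrite /A -ath; ring.
  apply: ler_wpM2l; first exact: ltW.
  by apply: env_le_th => //; rewrite ger0_norm.
(* By [om_drift] the error is at most half of the main term [a * b / (32 * be)]. *)
have hE : 48 * (2 * (16 * kap / rho) + 2 * om) * kap * V k <= a * b / (64 * be).
  apply: (@le_trans _ _ (48 * (2 * (16 * kap / rho) + 2 * om) * kap * (C1 * (b / be)))).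
    apply: ler_wpM2l hV; apply: mulr_ge0 kap0; apply: mulr_ge0 => //; apply: addr_ge0 de0.
    by apply: mulr_ge0 => //; apply: divr_ge0 (ltW rho0); exact: mulr_ge0.
  rewrite (_ : _ * (C1 * (b / be)) = C3 * om * (a * (b / be))); last first.
    by rewrite /kap /C3 /A /a /rho; field; rewrite !gt_eqF.
  rewrite (_ : a * b / (64 * be) = 64^-1 * (a * (b / be))); last by field; rewrite gt_eqF.
  by apply: ler_wpM2r => //; rewrite mulr_ge0// ltW.
apply: (@le_trans _ _ (m / 2 * (a * b / (64 * be)))).
  by apply: eq_le; rewrite /a; field; rewrite !gt_eqF.
have X0 : 0 <= a * b / (64 * be) by rewrite divr_ge0// mulr_ge0// ltW.
apply: ler_pM => //; [by rewrite divr_ge0// ltW|by rewrite ler_wpM2r// invr_ge0|].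
have : a * b / (32 * be) = 2 * (a * b / (64 * be)) by field; rewrite gt_eqF.
by move: hI hE; move: (a * b / _) (a * b / _) (48 * _ * _ * _) => x y z; lra.
Qed.

Definition CU : R := 2 * pi * (8 * 8 ^+ P * Cw * C1 ^+ 2).
Definition C4 : R := 2 * pi * (2 ^+ P * 2).

Let Cw0 : 0 <= Cw :> R.
Proof.
rewrite /Cw mulr_ge0//; first by have := pi_ge0 R; lra.
by apply: I_ge0 => x; rewrite invr_ge0 ltW// oneDsqr_gt0.
Qed.

Let D k := damp (rho / 2) k * V k.

Let HK_D : HK s D <= CU.
Proof.
have lE := L1_env_energy m1 be0 be1 th0 (ltW s0) sP.
have hE := env_energy m1 be0 be1 th0 (ltW s0) sP; rewrite -/ms -/W in hE lE.
rewrite /HK /CU; apply: ler_wpM2l; first by rewrite mulr_ge0// pi_ge0.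
have D0 k : 0 <= D k by exact: mulr_ge0 (damp_ge0 _ _) (V0 k).
have DV k : D k <= V k.
  by apply: ler_piMl; [exact: V0|apply: damp_le1; exact: divr_ge0 (ltW rho0) (ler0n _ 2)].
have lD : L1 (fun k => (1 + k ^+ 2) `^ s * D k ^+ 2).
  by apply: dec_pow_L1; [apply: cont_meas; exact: cont_dampV|exact: dec_dampV V0 VVM rho0].
apply: (@le_trans _ _ ((A / be) ^+ 2 * I (fun k => (1 + k ^+ 2) `^ s * W k ^+ 2))).
  rewrite -(IZ _ lE); apply: I_le => //; first exact: L1_Z.
  move=> k; rewrite [leRHS]mulrCA; apply: ler_wpM2l; first exact: powR_ge0.
  have := @lerXn2r R 2 (D k) (V k); rewrite !nnegrE => /(_ (D0 k) (V0 k) (DV k)).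
  by move=> h; apply: (le_trans h); rewrite /V exprMn.
apply: (@le_trans _ _ ((A / be) ^+ 2 * (2 * 8 ^+ P * (1 + (ms * th) ^+ 2) * (2 * (Cw * be))))).
  by apply: ler_wpM2l => //; exact: sqr_ge0.
(* The powers of [m] cancel: [A^2 / be = (C1 * om / q)^2], and multiplied by [(ms * th)^2] this
   becomes [C1^2]. *)
rewrite (_ : (A / be) ^+ 2 * _ = 4 * 8 ^+ P * Cw * C1 ^+ 2 * ((om / q) ^+ 2 + 1)); last first.
  by rewrite /A /a /be /th; field; rewrite !gt_eqF.
rewrite (_ : 8 * 8 ^+ P * Cw * C1 ^+ 2 = 4 * 8 ^+ P * Cw * C1 ^+ 2 * 2); last by ring.
apply: ler_wpM2l.
  apply: mulr_ge0 (sqr_ge0 _); apply: mulr_ge0 => //; apply: mulr_ge0 => //; exact: exprn_ge0.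
have : (om / q) ^+ 2 <= 1.
  apply: exprn_ile1; first by apply: divr_ge0; exact: ltW.
  by rewrite ler_pdivrMr// mul1r; have := om1; have := q1; lra.
by move: (_ ^+ 2) => x; lra.
Qed.

Let upper (G : R -> R -> R) t : adm V rho G -> Hs_norm s (usol G t) <= 2 * Num.sqrt CU.
Proof.
move=> aG; have ch := @cont_h _ _ _ _ aG t.
have h := h_le V0 VN rho0 aG t.
have dD : dec D by exact: dec_dampV V0 VVM rho0.
have mD : measurable_fun setT D by apply: cont_meas; exact: cont_dampV.
apply: (le_trans (Hs_norm_le s ch mD (ler0n _ 2) h (dampVN rho VN) dD)).
by apply: ler_wpM2l => //; apply: ler_wsqrtr; exact: HK_D.
Qed.

Let G t k := g t k - g' t k.

Let diffE t : (fun x => usol g t x - usol g' t x) = hart (rot t (G t)).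
Proof.
apply/funext => x; have L := L1_h V0 VN VVM rho0 ag t.
have L' := L1_h V0 VN VVM rho0 ag' t.
by rewrite /usol -(hart_B x L L'); congr (hart _ x); apply/funext => k; rewrite /hh rot_B.
Qed.

Let initial : Hs_norm s (fun x => usol g 0 x - usol g' 0 x) <= Num.sqrt C4 / q.
Proof.
rewrite diffE (_ : rot 0 (G 0) = l); last first.
  apply/funext => k; rewrite /rot mul0r cos0 sin0 mul1r mul0r addr0 /G.
  by rewrite (fix_init gE) (fix_init gE') /lH addrK.
pose B k := tent (k / be).
have cB : continuous B by apply: (cont_comp (@cont_tent R)); cont.
have B0 k : 0 <= B k by exact: tent_ge0.
have Bout k : be <= `|k| -> B k = 0.
  by move=> h; rewrite /B tent_out// norm_div ler_pdivlMr// mul1r.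
have near n k : `|k| <= be -> (1 + k ^+ 2) ^+ n <= 2 ^+ n.
  move=> h; apply: lerXn2r; rewrite ?nnegrE ?(ltW (oneDsqr_gt0 k))//.
  have : k ^+ 2 <= 1.
    by rewrite -real_normK ?num_real//; apply: exprn_ile1 => //; exact: le_trans h be1.
  by move: (k ^+ 2) => x; lra.
have dB : dec B.
  move=> n; exists (2 ^+ n) => k.
  have [h|h] := leP be `|k|; first by rewrite (Bout _ h) normr0 mul0r exprn_ge0.
  rewrite ger0_norm// -[leRHS]mul1r; apply: ler_pM => //.
  - by rewrite exprn_ge0// ltW// oneDsqr_gt0.
  - exact: tent_le1.
  - by apply: near; exact: ltW.
have lB k : `|l k| <= a / be * B k by rewrite ger0_norm.
have BN k : B (- k) = B k by rewrite /B mulNr tentN.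
apply: (le_trans (Hs_norm_le s cl (cont_meas cB) (ltW abe0) lB BN dB)).
have HB : HK s B <= C4 * be.
  rewrite /HK /C4 -[leRHS]mulrA; apply: ler_wpM2l; first by rewrite mulr_ge0// pi_ge0.
  have lJ := @L1_indic_itv R (- be) be.
  apply: (@le_trans _ _ (I (fun k => 2 ^+ P * \1_`[- be, be] k))).
    apply: I_le => [| |k]; [exact: dec_pow_L1 (cont_meas cB) dB|exact: L1_Z|].
    rewrite indicE; have [|] := boolP (k \in _).
      rewrite inE /= in_itv /= -ler_norml => h; apply: ler_pM.
      - exact: powR_ge0.
      - exact: sqr_ge0.
      - apply: le_trans (near P k h); rewrite -[leRHS]powR_mulrn ?(ltW (oneDsqr_gt0 k))//.
        by apply: ler_powR => //; rewrite lerDl sqr_ge0.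
      - by apply: exprn_ile1 => //; exact: tent_le1.
    rewrite notin_setE /= in_itv /= -ler_norml => /negP; rewrite -ltNge => h.
    by rewrite (Bout _ (ltW h)) expr0n/= !mulr0.
  rewrite (IZ _ lJ) I_indic_itv; last by have := be0; lra.
  by apply: eq_le; ring.
apply: (@le_trans _ _ (a / be * Num.sqrt (C4 * be))).
  by apply: ler_wpM2l; [exact: ltW|exact: ler_wsqrtr].
have C40 : 0 <= C4 by rewrite /C4 !mulr_ge0 ?exprn_ge0 ?pi_ge0.
rewrite (sqrtrM _ C40) /be sqrtr_sqr (gtr0_norm (divr_gt0 q0 m0)).
rewrite [leLHS](_ : _ = Num.sqrt C4 * (om / q)); last first.
  by rewrite /a; move: (Num.sqrt C4) => r; field; rewrite !gt_eqF.
apply: ler_wpM2l; first exact: sqrtr_ge0.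
by apply: ler_piMl => //; rewrite invr_ge0 ltW.
Qed.

(** On an interval of length [be] around [lam] the difference of the profiles at [- k] has size at
    least [c], while the Sobolev weight is at least [ms^2]; [rot_sqr] removes the rotation. The
    normalization of [b] makes [ms * c * sqrt be] equal to [om / 128 * t]. *)
Let lower t : 0 <= t <= 1 ->
  om / 128 * t <= Hs_norm s (fun x => usol g t x - usol g' t x).
Proof.
move=> ht; case/andP: (ht) => t0 t1; rewrite diffE.
have cG : continuous (G t).
  by case: ag => _ c1 _; case: ag' => _ c2 _; apply: cont_D; [exact: c1|apply: cont_N; exact: c2].
have cR : continuous (rot t (G t)) by exact: cont_rot.
have dR : dec (rot t (G t)).
  have d1 := dec_h V0 VN VVM rho0 ag t; have d2 := dec_h V0 VN VVM rho0 ag' t.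
  have := dec_D d1 (dec_Z (-1) d2); congr (dec _); apply/funext => k.
  by rewrite mulN1r /hh rot_B.
pose c := om * b / (128 * be) * t.
have c0 : 0 <= c by rewrite mulr_ge0// divr_ge0// mulr_ge0// ltW.
have lohi : lam - be / 2 <= lam + be / 2 by have := be0; lra.
have y0 : 0 <= ms ^+ 2 * c ^+ 2 by rewrite mulr_ge0 ?sqr_ge0.
have := @Hs_norm_ge R s (rot t (G t)) _ _ _ cR dR lohi y0.
rewrite (_ : ms ^+ 2 * c ^+ 2 * (lam + be / 2 - (lam - be / 2)) = (om / 128 * t) ^+ 2); last first.
  rewrite (_ : lam + be / 2 - (lam - be / 2) = be); last by move: lam => x; field.
  by rewrite /c /b /be; field; rewrite !gt_eqF.
rewrite sqrtr_sqr => H'; apply: le_trans (ler_norm _) _; apply: H' => k /andP[k1 k2].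
have hk : `|k - lam| <= be / 2 by rewrite ler_norml; apply/andP; split; lra.
have hD := drift ht hk.
rewrite rot_sqr; apply: ler_pM; rewrite ?sqr_ge0//.
  rewrite /ms expr2 -powRM ?(ltW m0)//; apply: ge0_ler_powR; rewrite ?nnegrE ?(ltW s0)//.
  - by rewrite mulr_ge0// ltW.
  - by rewrite ltW// oneDsqr_gt0.
  - have km : m <= k by have := be1; have := lam_ge; have := m12; lra.
    apply: (@le_trans _ _ (k ^+ 2)); last by rewrite lerDr.
    by rewrite expr2; apply: ler_pM => //; exact: ltW.
apply: (@le_trans _ _ (G t (- k) ^+ 2)); last by rewrite lerDr sqr_ge0.
rewrite -[leRHS]sqrrN; apply: lerXn2r; rewrite ?nnegrE//.
  by rewrite oppr_ge0; apply: le_trans hD _; rewrite oppr_le0.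
by rewrite /G -lerN2 opprK.
Qed.

Lemma BO_pair : exists u u' : R -> R -> R, [/\ BO_solution u, BO_solution u',
  (forall t, Hs_norm s (u t) <= 2 * Num.sqrt CU /\ Hs_norm s (u' t) <= 2 * Num.sqrt CU),
  Hs_norm s (fun x => u 0 x - u' 0 x) <= Num.sqrt C4 / q &
  forall t, 0 <= t <= 1 -> om / 128 * t <= Hs_norm s (fun x => u t x - u' t x)].
Proof.
exists (usol g), (usol g'); split.
- exact (usol_BO cV V0 VN VVM V1 Vconv kap0 rho0 ag gE).
- exact (usol_BO cV V0 VN VVM V1 Vconv kap0 rho0 ag' gE').
- by move=> t; split; exact: upper.
- exact: initial.
- exact: lower.
Qed.

End parameters.

(** * Sequences of parameters and the conclusion *)

Section conclusion.
Context {R : realType}.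
Implicit Types (s q t om : R).

Lemma limn_einf_ge (u : nat -> R) (c : R) : (forall n, c <= u n) ->
  (c%:E <= limn_einf (fun n => (u n)%:E))%E.
Proof.
move=> h; rewrite limn_einf_lim; apply: lime_ge; first exact: is_cvg_einfs.
apply: nearW => n; rewrite /einfs; apply: le_ereal_inf_tmp => _ [k _ <-].
by rewrite lee_fin.
Qed.

Lemma BO_pairs s : 0 < s -> exists c C q0 : R, [/\ 0 < c, 0 < C, 1 <= q0 & forall q, q0 <= q ->
  exists u : (R -> R -> R) * (R -> R -> R), [/\ BO_solution u.1, BO_solution u.2,
  (forall t, Hs_norm s (u.1 t) <= C / 2 /\ Hs_norm s (u.2 t) <= C / 2),
  Hs_norm s (fun x => u.1 0 x - u.2 0 x) <= C / q &
  forall t, 0 <= t <= 1 -> c * t <= Hs_norm s (fun x => u.1 t x - u.2 t x)]].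
Proof.
move=> s0; pose p := Num.bound s.
have sp : s <= p.+1%:R.
  by apply: (le_trans (ltW (archi_boundP (ltW s0)))); rewrite ler_nat leqnSn.
pose K := C1 p * Kc p : R.
have K0 : 0 <= K by rewrite mulr_ge0 ?Kc_ge0// ltW// C1_ge0.
have C30 : 0 <= C3 p :> R.
  rewrite /C3 -/K; apply: mulr_ge0; first by rewrite mulr_ge0// addr_ge0// mulr_ge0.
  by rewrite mulr_ge0// ltW// C1_ge0.
(* One constant that dominates both smallness conditions on [om], which thus depends on [s]
   alone. *)
pose L := 1 + 64 * K + 64 * C3 p; pose om := L^-1.
have L1 : 1 <= L by rewrite /L; lra.
have L0 : 0 < L by lra.
have om0 : 0 < om by rewrite invr_gt0.
have om1 : om <= 1 by rewrite invf_le1.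
have omL x : x <= L -> x * om <= 1 by move=> h; rewrite ler_pdivrMr// mul1r.
have oma : 64 * K * om <= 1 by apply: omL; rewrite /L; lra.
have omb : C3 p * om <= 64^-1.
  have : 64 * C3 p * om <= 1 by apply: omL; rewrite /L; lra.
  by rewrite -mulrA; move: (C3 p * om) => x; lra.
pose C : R := 4 * Num.sqrt (CU p) + Num.sqrt (C4 p) + 1.
have r1 := sqrtr_ge0 (CU p : R); have r2 := sqrtr_ge0 (C4 p : R).
have C_ge : 2 * Num.sqrt (CU p) <= C / 2 /\ Num.sqrt (C4 p) <= C /\ 0 < C.
  by rewrite /C; move: r1 r2; move: (Num.sqrt _) (Num.sqrt _) => x y; lra.
case: C_ge => hC1 [hC2 hC0]; rewrite -/p in hC1 hC2.
(* [q >= L] gives [om * q >= 1], and [q >= 4] gives [12 * q^2 <= q^4]. *)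
exists (om / 128), C, (L + 4); split; [exact: divr_gt0|exact: hC0|by lra|].
move=> q hq; have q0 : 0 < q by lra.
have q1 : 1 <= q by lra.
have omq : 1 <= om * q by rewrite mulrC ler_pdivlMr// mul1r; lra.
(* [4 <= r] yields [q^4 <= m]; the term [2 / s] yields [m^s = q^(4 s + 2)], hence [q^2 <= m^s] even
   for small [s]. *)
pose r := 4 + 2 / s; pose m := q `^ r.
have r4 : 4 <= r by rewrite lerDl divr_ge0// ltW.
have qm : 12 * q ^+ 2 <= m.
  apply: (@le_trans _ _ (q ^+ 4)).
    rewrite (_ : q ^+ 4 = q ^+ 2 * q ^+ 2); last by rewrite -exprD.
    apply: ler_wpM2r; first exact: sqr_ge0.
    by rewrite expr2; apply: (@le_trans _ _ (4 * 4)); [lra|apply: ler_pM; lra].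
  by rewrite -[leLHS]powR_mulrn ?(ltW q0)//; apply: ler_powR.
have qms : q ^+ 2 <= m `^ s.
  rewrite /m -powRrM -[leLHS]powR_mulrn ?(ltW q0)//; apply: ler_powR => //.
  rewrite (_ : r * s = 4 * s + 2); last by rewrite /r; field; rewrite gt_eqF.
  by lra.
have [u [u' [h1 h2 h3 h4 h5]]] := BO_pair s0 sp q1 om0 om1 omq qm qms oma omb.
exists (u, u'); split => //=.
- move=> t; have [a b] := h3 t; split; [exact: le_trans a hC1|exact: le_trans b hC1].
- apply: le_trans h4 _; apply: ler_wpM2r hC2; by rewrite invr_ge0 ltW.
Qed.
End conclusion.

Theorem theorem1 (R : realType) (s : R) (hs : 0 < s) :
  exists (c C : R), 0 < c /\ 0 < C /\
  exists (u ut : nat -> R -> R -> R),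
    (forall n, BO_solution (u n) /\ BO_solution (ut n)) /\
    (* (i): sup_n ||u_n(t)|| + sup_m ||ut_m(t)|| <= C *)
    (forall t, 0 <= t <= 1 -> forall n m,
       Hs_norm s (u n t) + Hs_norm s (ut m t) <= C) /\
    (* (ii) *)
    ((fun n => Hs_norm s (fun x => u n 0 x - ut n 0 x)) @ \oo --> 0) /\
    (* (iii) *)
    (forall t, 0 <= t <= 1 ->
       ((c * sin t)%:E <=
        limn_einf (fun n => (Hs_norm s (fun x => u n t x - ut n t x))%:E))%E).
Proof.
have [c [C [q0 [c0 C0 q01 H]]]] := BO_pairs hs.
(* The sequences take [q = q0 + n]; since [q0 >= 1], the distance of the data is at most
   [C / (n + 1)]. *)
have [U HU] := choice (fun n : nat => H (q0 + n%:R) ltac:(by rewrite lerDl)).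
exists c, C; split => //; split => //.
exists (fun n => (U n).1), (fun n => (U n).2); split; [|split; [|split]].
- by move=> n; case: (HU n).
- move=> t _ n k; case: (HU n) => _ _ /(_ t) [hn _] _ _; case: (HU k) => _ _ /(_ t) [_ hk] _ _.
  by have := lerD hn hk; rewrite -splitr; apply.
- have lim : C * harmonic n @[n --> \oo] --> (0 : R).
    by rewrite -(mulr0 C); apply: cvgM; [exact: cvg_cst|exact: cvg_harmonic].
  pose f n := Hs_norm s (fun x => (U n).1 0 x - (U n).2 0 x).
  have bd n : 0 <= f n <= C * harmonic n.
    apply/andP; split; first exact: sqrtr_ge0.
    case: (HU n) => _ _ _ h _; apply: (le_trans h); apply: ler_wpM2l; first exact: ltW.
    have n0 : (0 : R) <= n%:R by exact: ler0n.
    rewrite /harmonic lef_pV2 ?posrE; [by rewrite -natr1; lra|by lra|by rewrite ltr0n].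
  have bd' : \forall n \near \oo, 0 <= f n <= C * harmonic n by exact: nearW.
  exact: (@squeeze_cvgr _ _ _ _ (fun=> 0) (fun n => C * harmonic n) f bd' 0 (cvg_cst _) lim).
(* The lower bound obtained is linear in time and holds for every [n]; [sin t <= t] gives the
   claim. *)
- move=> t /andP[t0 t1]; apply: limn_einf_ge => n; case: (HU n) => _ _ _ _ h.
  apply: le_trans (h t _); last by rewrite t0 t1.
  apply: ler_wpM2l; first exact: ltW.
  by apply: le_trans (ler_norm _) _; apply: le_trans (sin_norm_le t) _; rewrite ger0_norm.
Qed.
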